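(* Let $H$ be a graph and $H^{odd}$ an odd ballooning of $H$. Then $\mathcal{M}(H^{odd})$ is matching-good if (i) $H$ is a tree, or (ii) $H$ is isomorphic to $K_{s,t}$ with $t\ge s\ge2$.
   Context: An odd ballooning $H^{odd}$ of $H$ is obtained by replacing each edge of $H$ with an odd cycle of length at least five (through the two endpoints), where the new vertices of different cycles are distinct; cycles replacing distinct edges may have different lengths. For bipartite $H$, $\chi(H^{odd})=3$. All graphs are finite and simple. $p(\mathcal{H})=\min_{H\in\mathcal{H}}\chi(H)-1$; $T_p(n)$ is the $p$-partite Turán graph; $E_t$ the edgeless graph on $t$ vertices; $\nabla$ join, $\cup$ disjoint union; $K_k$ complete graph. $\mathrm{EX}(n,\mathcal{H})$ is the set of $n$-vertex graphs with no member of $\mathcal{H}$ as a subgraph having the maximum number of edges. Decomposition family: $\mathcal{M}(\mathcal{H})$ (with $p(\mathcal{H})=p\ge2$) consists of the minimal (under subgraphs) graphs $M$ such that for some $H\in\mathcal{H}$ and a constant $t=t(\mathcal{H})$, $H\subseteq(M\cup E_t)\nabla T_{p-1}((p-1)t)$; $\mathcal{M}(H)=\mathcal{M}(\{H\})$. $\beta(M)$ = minimum vertex cover size, $\beta=\min_{M\in\mathcal{M}(\mathcal{H})}\beta(M)$; for bipartite $M$, $\gamma(M)$ = minimum size of an independent set meeting all edges, $\gamma=\min\{\gamma(M): M\in\mathcal{M}(\mathcal{H})\text{ bipartite}\}$. If $\beta=\gamma$, $\mathcal{B}(\mathcal{H})=\{K_\gamma\}$; otherwise $\mathcal{B}(\mathcal{H})=\{M[S]: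 M\in\mathcal{M}(\mathcal{H}), S\text{ a vertex cover of }M, |S|<\gamma\}$. $\mathcal{M}(\mathcal{H})$ is matching-good if (i) $p(\mathcal{H})\ge2$ and $\mathcal{M}(\mathcal{H})$ contains a matching (a graph whose components are all $K_2$); and (ii) for sufficiently large $n$ there is $G^\star\in\mathrm{EX}(n,\mathcal{H})$ with $G^\star=H_1\nabla H_2$, $H_1\in\mathrm{EX}(\gamma-1,\mathcal{B}(\mathcal{H}))$ and $H_2$ differing from $T_p(n-\gamma+1)$ by $O(1)$ added/deleted edges (bounded independently of $n$). *)

(* Defs.v *)
From Stdlib Require Import ClassicalEpsilon.
From mathcomp Require Import all_boot.

Set Implicit Arguments.
Unset Strict Implicit.
Unset Printing Implicit Defensive.

(* The least element of a nonempty set of naturals; the value is unspecified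
   when no k satisfies P. *)
Definition natmin (P : nat -> Prop) : nat :=
  epsilon (inhabits 0) (fun m => P m /\ forall k, P k -> m <= k).

Lemma natminP (P : nat -> Prop) :
  (exists k, P k) -> P (natmin P) /\ forall k, P k -> natmin P <= k.
Proof.
move=> exP; apply: (epsilon_spec (inhabits 0) (fun m => P m /\ _)).
case: exP => k; elim/ltn_ind: k => k IH Pk.
case: (excluded_middle_informative (exists2 j, j < k & P j)) => [[j jk Pj]|noj].
  exact: IH jk Pj.
exists k; split=> // j Pj; rewrite leqNgt; apply/negP => jk.
by apply: noj; exists j.
Qed.

(* Finite simple graphs; the null graph is allowed. *)
Record graph := Graph {
  vert :> finType;
  adj : rel vert;
  adj_sym : symmetric adj;
  adj_irr : irreflexive adj }.

(* Families are only ever used up to isomorphism. *)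
Definition family := graph -> Prop.

Definition edges (G : graph) : {set {set G}} :=
  [set e : {set G} | [exists x : G, exists y : G, adj x y && (e == [set x; y])]].

(* Not necessarily induced. *)
Definition subgraph (G H : graph) : Prop :=
  exists2 f : G -> H, injective f & forall x y, adj x y -> adj (f x) (f y).

Definition iso (G H : graph) : Prop :=
  exists2 f : G -> H, bijective f & forall x y, adj (f x) (f y) = adj x y.

Definition single (G : graph) : family := fun H => iso H G.

Section Constructions.
Variables G H : graph.

Definition join_rel : rel (G + H) := fun a b =>
  match a, b with
  | inl x, inl y => adj x y
  | inr x, inr y => adj x y
  | _, _ => true
  end.
Lemma join_sym : symmetric join_rel.
Proof. by move=> [x|x] [y|y] //=; rewrite adj_sym. Qed.
Lemma join_irr : irreflexive join_rel.
Proof. by move=> [x|x] /=; rewrite adj_irr. Qed.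
Definition join := Graph join_sym join_irr.

Definition union_rel : rel (G + H) := fun a b =>
  match a, b with
  | inl x, inl y => adj x y
  | inr x, inr y => adj x y
  | _, _ => false
  end.
Lemma union_sym : symmetric union_rel.
Proof. by move=> [x|x] [y|y] //=; rewrite adj_sym. Qed.
Lemma union_irr : irreflexive union_rel.
Proof. by move=> [x|x] /=; rewrite adj_irr. Qed.
Definition union := Graph union_sym union_irr.

Variable S : {set G}.
Definition induced_rel : rel {x : G | x \in S} := fun x y => adj (val x) (val y).
Lemma induced_sym : symmetric induced_rel.
Proof. by move=> x y; apply: adj_sym. Qed.
Lemma induced_irr : irreflexive induced_rel.
Proof. by move=> x; apply: adj_irr. Qed.
Definition induced := Graph induced_sym induced_irr.

End Constructions.

Definition complete_rel n : rel 'I_n := fun x y => x != y.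
Lemma complete_sym n : symmetric (@complete_rel n).
Proof. by move=> x y; rewrite /complete_rel eq_sym. Qed.
Lemma complete_irr n : irreflexive (@complete_rel n).
Proof. by move=> x; rewrite /complete_rel eqxx. Qed.
Definition complete n := Graph (@complete_sym n) (@complete_irr n).

Definition edgeless_rel n : rel 'I_n := fun _ _ => false.
Lemma edgeless_sym n : symmetric (@edgeless_rel n).
Proof. by []. Qed.
Lemma edgeless_irr n : irreflexive (@edgeless_rel n).
Proof. by []. Qed.
Definition edgeless n := Graph (@edgeless_sym n) (@edgeless_irr n).

Definition complete_bipartite s t := join (edgeless s) (edgeless t).

(* The residue classes modulo r (r > 0) partition n vertices as evenly as
   possible into r parts. *)
Definition turan_rel r n : rel 'I_n := fun x y => x %% r != y %% r.
Lemma turan_sym r n : symmetric (@turan_rel r n).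
Proof. by move=> x y; rewrite /turan_rel eq_sym. Qed.
Lemma turan_irr r n : irreflexive (@turan_rel r n).
Proof. by move=> x; rewrite /turan_rel eqxx. Qed.
Definition turan r n := Graph (@turan_sym r n) (@turan_irr r n).

Definition colorable (G : graph) (k : nat) : Prop :=
  exists f : G -> 'I_k, forall x y, adj x y -> f x != f y.

Definition chi (G : graph) : nat := natmin (colorable G).

Definition bipartite (G : graph) : Prop := colorable G 2.

Definition is_tree (G : graph) : Prop :=
  [/\ 0 < #|G|,
      forall x y : G, connect (@adj G) x y &
      forall s : seq G, 2 < size s -> ~ ucycle (@adj G) s].

Definition is_matching (G : graph) : Prop :=
  forall x : G, iso (induced [set y | connect (@adj G) x y]) (complete 2).

(* Each edge xy of H is kept and completed to a cycle
   f x, (the vertices of c x y in order), f y, back to f x,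
   whose length size (c x y) + 2 is odd and at least five.
   As c y x is the reversal of c x y, the same cycle is described from both
   ends, and letting (x, y) range over both orientations makes the successor
   relations of these sequences account for both directions of every edge. *)
Definition odd_ballooning (H G : graph) : Prop :=
  exists (f : H -> G) (c : H -> H -> seq G),
  let C x y := f x :: rcons (c x y) (f y) in
  [/\ injective f,
      forall x y, adj x y ->
        [/\ odd (size (C x y)), 5 <= size (C x y), uniq (C x y)
          & c y x = rev (c x y)],
      forall x y z, adj x y -> f z \notin c x y,
      forall x y x' y', adj x y -> adj x' y' -> [set x; y] != [set x'; y'] ->
        forall v, v \in c x y -> v \notin c x' y' &
      (forall v : G, (exists x, v = f x) \/
                     (exists x y, adj x y /\ v \in c x y)) /\
      (forall v w : G, adj v w <->
         exists x y, [/\ adj x y, v \in C x y & w = next (C x y) v])].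

Definition free (F : family) (G : graph) : Prop :=
  forall H, F H -> ~ subgraph H G.

Definition EX (n : nat) (F : family) : family := fun G =>
  [/\ #|G| = n, free F G &
      forall G' : graph, #|G'| = n -> free F G' -> #|edges G'| <= #|edges G|].

Definition par (F : family) : nat :=
  (natmin (fun k => exists2 H, F H & chi H = k)).-1.

(* The condition is monotone in t, and t = #|H| already suffices, so whether t
   may depend on M is immaterial. *)
Definition decomposes (F : family) (M : graph) : Prop :=
  exists2 H, F H & exists t,
    subgraph H (join (union M (edgeless t))
                     (turan (par F).-1 ((par F).-1 * t))).

Definition decomposition (F : family) : family := fun M =>
  decomposes F M /\
  forall N : graph, decomposes F N -> subgraph N M -> iso N M.

Definition vertex_cover (M : graph) (S : {set M}) : Prop :=
  forall x y : M, adj x y -> (x \in S) || (y \in S).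

Definition independent (M : graph) (S : {set M}) : Prop :=
  forall x y : M, x \in S -> y \in S -> ~~ adj x y.

Definition beta (M : graph) : nat :=
  natmin (fun k => exists S : {set M}, vertex_cover S /\ #|S| = k).

Definition gamma (M : graph) : nat :=
  natmin (fun k => exists S : {set M},
    [/\ independent S, vertex_cover S & #|S| = k]).

Definition betaF (F : family) : nat :=
  natmin (fun k => exists2 M, decomposition F M & beta M = k).

Definition gammaF (F : family) : nat :=
  natmin (fun k => exists M, [/\ decomposition F M, bipartite M & gamma M = k]).

Definition Bfam (F : family) : family := fun G =>
  if betaF F == gammaF F then iso G (complete (gammaF F))
  else exists (M : graph) (S : {set M}),
    [/\ decomposition F M, vertex_cover S, #|S| < gammaF F & iso G (induced S)].

(* G becomes a copy of T after adding and deleting at most C edges in total. *)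
Definition differs_by (C : nat) (G T : graph) : Prop :=
  exists2 f : G -> T, bijective f &
    #|[set e : {set G} | (e \in edges G) != (f @: e \in edges T)]| <= C.

(* "M(F) is matching-good"; the notion depends on F and not only on M(F). *)
Definition matching_good (F : family) : Prop :=
  (2 <= par F /\ exists2 M, decomposition F M & is_matching M) /\
  exists C n0 : nat, forall n, n0 <= n ->
    exists G H1 H2 : graph,
      [/\ EX n F G, iso G (join H1 H2), EX (gammaF F - 1) (Bfam F) H1 &
          differs_by C H2 (turan (par F) (n - gammaF F + 1))].

(* Main.v *)
Require Import Defs.
From mathcomp Require Import all_boot zify.
From Stdlib Require Import ClassicalEpsilon.

(* Write B for the ballooning and k for a 2-colouring of H. The cost of a set W
   of vertices of H is |W| plus the number of edges of H missing W: the vertices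
   of W, and one more for each of these edges, hit all odd cycles of B. The least
   cost of an independent W is gamma = g + 1. To embed B in a nearly complete
   bipartite graph, each of its odd cycles needs a single irregularity, which may
   be a vertex joined to both classes or an edge inside a class.

   A B-free graph of large minimum degree and at least as many edges as the
   conjectured extremal graph therefore consists of a set U of g vertices joined
   to almost everything and of a nearly complete bipartite graph with classes V,
   and progressive induction reduces the theorem to such graphs. If some optimal
   W misses an edge, then no edge inside a class is possible, and H_1 is any
   extremal graph for B(H), H_2 a Turan graph. Otherwise (an optimal W is a
   colour class A, with D + 1 the degree of a suitable vertex of A) the edges
   inside the classes contain neither a matching of more than D edges nor a star
   that a disjoint matching completes to more than D edges. Up to the edges
   missing between the classes there are then at most D(D - 1) + 1 of them,
   unless they all join two sets L and R of size D on the same side. For a tree,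
   the expansion |N(S)| > D|S| allows all D^2 of them; for K_{s,t}, the D(D - 1)
   + 1 edges of K_{D,D} minus a matching of size D - 1 are optimal, because
   a denser pair L, R would extend to a copy of H itself. In both cases
   H_1 = K_g. *)

Set Implicit Arguments.
Unset Strict Implicit.
Unset Printing Implicit Defensive.

(** The delicate point is that edges inside the classes compete with edges missing between them. An
    inner edge on the side opposite to a star centre [x] serves a cycle through [x] only if [x] is
    adjacent to one of its ends, so the star condition holds only up to blocked edges. A blocked
    edge costs two missing pairs at [x]. The extremal problem for inner edges is therefore solved
    with the number of missing pairs as an additive error, which the edge count repays exactly. Its
    starting point is that matching number nu and maximum degree d allow at most nu (d + 1) edges,
    which pins the maximum degree to D - 1 or D. The set U consists of the vertices with linearly
    many neighbours in both classes. They are bounded in number, as many of them would give a nearly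
    complete tripartite host, and the edge count then leaves exactly g. For the lower bound in the
    second case, a cover of the added edges by D vertices turns a copy of B into a set of vertices
    of H of cost at most g + D. The block of added edges has two disjoint such covers, its sides,
    and cheap sets are too restricted for both. *)

Definition nbh (G : graph) (x : G) : {set G} := [set y | adj x y].

Definition arcs (G : graph) (X Y : {set G}) : nat := \sum_(x in X) #|nbh x :&: Y|.

(** Near-completeness is always expressed as an upper bound on [miss]; for [x] in [C] the count
    includes [x] itself. *)
Definition miss (G : graph) (x : G) (C : {set G}) : nat := #|C :\: nbh x|.

Lemma in_nbh (G : graph) (x y : G) : (y \in nbh x) = adj x y.
Proof. by rewrite inE. Qed.

Lemma adj_neq (G : graph) (x y : G) : adj x y -> x != y.
Proof. by apply: contraTneq => ->; rewrite adj_irr. Qed.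

Lemma subgraph_refl (G : graph) : subgraph G G.
Proof. by exists id. Qed.

Lemma subgraph_trans (F G K : graph) : subgraph F G -> subgraph G K -> subgraph F K.
Proof.
move=> [f fi fh] [g gi gh]; exists (g \o f); first exact: inj_comp.
by move=> x y /fh /gh.
Qed.

Lemma iso_subgraph (G K : graph) : iso G K -> subgraph G K.
Proof. by move=> [f fb fh]; exists f; [exact: bij_inj | move=> x y; rewrite fh]. Qed.

Lemma iso_sym (G K : graph) : iso G K -> iso K G.
Proof.
move=> [f [g fK gK] fh]; exists g; first by exists f.
by move=> x y; rewrite -fh !gK.
Qed.

Lemma iso_refl (G : graph) : iso G G.
Proof. by exists id => //; exists id. Qed.

Lemma inj_of_card (A B : finType) (X : {set A}) (Y : {set B}) (b0 : B) :
  #|X| <= #|Y| ->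
  exists2 f : A -> B, {in X &, injective f} & forall x, x \in X -> f x \in Y.
Proof.
move=> le; exists (fun x => nth b0 (enum Y) (index x (enum X))) => [x y xX yX|x xX].
  move/eqP; rewrite nth_uniq ?enum_uniq -?cardE ?(leq_trans _ le) //;
    try by rewrite [X in _ < X]cardE index_mem mem_enum.
  by move/eqP/(congr1 (nth x (enum X))); rewrite !nth_index ?mem_enum.
by rewrite -mem_enum mem_nth // -cardE (leq_trans _ le) // cardE index_mem mem_enum.
Qed.

Lemma subset_of_card (T : finType) (A : {set T}) k :
  k <= #|A| -> exists2 B : {set T}, B \subset A & #|B| = k.
Proof.
move=> le; have := cards_draws A k; set S := [set _ | _] => cS.
have : 0 < #|S| by rewrite cS bin_gt0.
by case/card_gt0P => B; rewrite inE => /andP[? /eqP]; exists B.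
Qed.

Lemma card_arcs (G : graph) :
  #|[set p : G * G | adj p.1 p.2]| = \sum_(x : G) #|nbh x|.
Proof.
rewrite -sum1_card (eq_bigl (fun p => true && adj p.1 p.2)); last by move=> p; rewrite inE.
rewrite -(pair_big_dep xpredT (fun x y : G => adj x y) (fun _ _ => 1)) /=.
by apply: eq_bigr => x _; rewrite sum1_card cardsE.
Qed.

Lemma card_edges (G : graph) : (#|edges G|).*2 = \sum_(x : G) #|nbh x|.
Proof.
rewrite -card_arcs -[RHS]sum1_card.
rewrite (partition_big (fun p : G * G => [set p.1; p.2]) (mem (edges G))) /=; last first.
  by move=> [x y]; rewrite !inE => /= a; apply/existsP; exists x; apply/existsP; exists y; rewrite a /=.
rewrite -muln2 -sum_nat_const; apply: eq_bigr => e.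
rewrite inE => /existsP [x /existsP [y /andP [a /eqP ->]]].
rewrite sum1_card (eq_card (B := pred2 (x, y) (y, x))).
  by rewrite card2; case: eqP => // -[e1 _]; move: a; rewrite e1 adj_irr.
move=> [u v]; rewrite !inE /=; apply/andP/orP => [[auv /eqP e2]|].
  have: u \in [set x; y] by rewrite -e2 !inE eqxx.
  have: v \in [set x; y] by rewrite -e2 !inE eqxx orbT.
  move: auv; rewrite !inE => auv /orP[]/eqP ? /orP[]/eqP ?; subst u v;
    rewrite ?adj_irr in auv => //; rewrite ?eqxx; by [left | right].
by case=> /eqP [-> ->]; rewrite inE /= ?a ?eqxx // adj_sym a setUC eqxx.
Qed.

(** Greedy extension of the partial embedding [g]: for a vertex outside [D], the used images and the
    non-neighbours of the images of its neighbours in [D] number at most [#|D| * e.+1], less than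
    its class holds. A vertex just placed in a class satisfies the last hypothesis because the
    classes are nearly complete to each other. *)
Lemma greedy_embedding (F G : graph) (col : F -> bool) (C : bool -> {set G}) (e : nat) :
  (forall b y, y \in C b -> miss y (C (~~ b)) <= e) ->
  (forall b, #|F| * e.+1 <= #|C b|) ->
  forall (D : {set F}) (g : F -> G),
  {in D &, injective g} ->
  {in D &, forall u v, adj u v -> adj (g u) (g v)} ->
  (forall u v, u \notin D -> v \notin D -> adj u v -> col u != col v) ->
  (forall u v, u \in D -> v \notin D -> adj u v -> miss (g u) (C (col v)) <= e) ->
  subgraph F G.
Proof.
move=> hC cC D g; move: {2}_.+1 (ltnSn #|~: D|) => k; elim: k => // k IH in D g *.
rewrite ltnS => kD gi gh nD mD.
have [D0|] := eqVneq (~: D) set0.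
  have inD x : x \in D by move/setP/(_ x): D0; rewrite !inE; case: (x \in D).
  by exists g => [x y|x y]; [apply: gi | apply: gh].
case/set0Pn => v; rewrite inE => vD.
pose bad := g @: D :|: \bigcup_(u in D :&: nbh v) (C (col v) :\: nbh (g u)).
have badc : #|bad| < #|C (col v)|.
  apply: leq_trans (cC (col v)).
  have h1 : #|bad| <= #|D| * e.+1.
    rewrite mulnS; apply: leq_trans (leq_card_setU _ _) _; apply: leq_add.
      exact: leq_imset_card.
    have cU : #|\bigcup_(u in D :&: nbh v) (C (col v) :\: nbh (g u))|
        <= \sum_(u in D :&: nbh v) e.
      apply: leq_trans (_ : _ <= \sum_(u in D :&: nbh v) #|C (col v) :\: nbh (g u)|) _.
        elim/big_rec2: _ => [|u A B _ AB]; first by rewrite cards0.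
        by apply: leq_trans (leq_card_setU _ _) _; rewrite leq_add2l.
      apply: leq_sum => u; rewrite !inE => /andP [uD auv].
      by apply: mD; rewrite // adj_sym.
    apply: leq_trans cU _; rewrite sum_nat_const leq_mul2r.
    by rewrite (subset_leq_card (subsetIl _ _)) orbT.
  apply: leq_ltn_trans h1 _; rewrite ltn_mul2r /=.
  by rewrite -(cardsC D) -[X in X < _]addn0 ltn_add2l; apply/card_gt0P; exists v; rewrite inE.
have /subsetPn [y yC ybad] : ~~ (C (col v) \subset bad).
  by apply: contraL badc => /subset_leq_card; rewrite -leqNgt.
move: ybad; rewrite !inE negb_or => /andP [yg /bigcupP yb].
have yadj u : u \in D -> adj u v -> adj (g u) y.
  move=> uD auv; apply/negPn/negP => n; apply: yb; exists u.
    by rewrite !inE uD adj_sym.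
  by rewrite !inE n.
have ynew u : u \in D -> g u != y.
  by move=> uD; apply: contraNneq yg => <-; apply: imset_f.
pose g' u := if u == v then y else g u.
apply: (IH (v |: D) g').
- apply: leq_trans kD; rewrite (_ : ~: (v |: D) = ~: D :\ v); last first.
    by apply/setP => u; rewrite !inE negb_or.
  by rewrite [X in _ < X](cardsD1 v) inE vD.
- move=> u w; rewrite !inE /g'; case: eqP => [->|_] /=; case: eqP => [->|_] //= uD wD.
  + by move=> e1; move/eqP: (ynew _ wD); rewrite -e1.
  + by move=> e1; move/eqP: (ynew _ uD).
  exact: gi.
- move=> u w; rewrite !inE /g'; case: eqP => [->|_] /=; case: eqP => [->|_] //= uD wD.
  + by rewrite adj_irr.
  + by rewrite adj_sym [adj y _]adj_sym; apply: yadj.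
  + exact: yadj.
  exact: gh.
- by move=> u w; rewrite !inE !negb_or => /andP [_ ?] /andP [_ ?]; apply: nD.
- move=> u w; rewrite !inE negb_or /g'; case: eqP => [->|_] /= uD /andP [wv wD] a.
    have -> : col w = ~~ col v by have := nD _ _ vD wD a; case: (col v); case: (col w).
    exact: hC.
  exact: mD.
Qed.

(** The body of [odd_ballooning] with its witnesses as parameters, so that they can be fixed in a
    section. *)
Definition ballooning_by (H B : graph) (f : H -> B) (c : H -> H -> seq B) : Prop :=
  let C x y := f x :: rcons (c x y) (f y) in
  [/\ injective f,
      forall x y, adj x y ->
        [/\ odd (size (C x y)), 5 <= size (C x y), uniq (C x y)
          & c y x = rev (c x y)],
      forall x y z, adj x y -> f z \notin c x y,
      forall x y x' y', adj x y -> adj x' y' -> [set x; y] != [set x'; y'] ->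
        forall v, v \in c x y -> v \notin c x' y' &
      (forall v : B, (exists x, v = f x) \/
                     (exists x y, adj x y /\ v \in c x y)) /\
      (forall v w : B, adj v w <->
         exists x y, [/\ adj x y, v \in C x y & w = next (C x y) v])].

Definition two_coloring (G : graph) (k : G -> bool) : Prop :=
  forall x y, adj x y -> k x != k y.

(** Each edge of a properly coloured [H] has one orientation from the class [true], so oriented
    pairs index the cycles once, although [c x y] and [c y x] describe the same cycle. *)
Definition oriented (H : graph) (k : H -> bool) (x y : H) : bool :=
  [&& adj x y, k x & ~~ k y].

(** * The cycles of an odd ballooning *)

Section Ballooning.
Variables (H B : graph) (f : H -> B) (c : H -> H -> seq B) (k : H -> bool).
Hypothesis fc : ballooning_by f c.
Hypothesis kH : two_coloring k.

Local Notation C x y := (f x :: rcons (c x y) (f y)).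
Local Notation cn x y i := (nth (f x) (c x y) i).

Lemma orient x y : adj x y -> oriented k x y || oriented k y x.
Proof.
by move=> a; rewrite /oriented [adj y x]adj_sym a /=; have := kH a; case: (k x); case: (k y).
Qed.

Lemma oriented_adj x y : oriented k x y -> adj x y.
Proof. by case/and3P. Qed.

Lemma balloon_inj : injective f. Proof. by case: fc. Qed.

Lemma balloon_size x y : adj x y -> odd (size (c x y)) /\ 3 <= size (c x y).
Proof.
by move=> a; case: fc => _ h _ _ _; case: (h _ _ a); rewrite /= size_rcons /= negbK => ->.
Qed.

Lemma balloon_uniq x y : adj x y -> uniq (C x y).
Proof. by case: fc => _ h _ _ _ /h []. Qed.

Lemma balloon_rev x y : adj x y -> c y x = rev (c x y).
Proof. by case: fc => _ h _ _ _ /h []. Qed.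

Lemma balloon_new x y z : adj x y -> f z \notin c x y.
Proof. by case: fc => _ _ h _ _ /(h _ _ z). Qed.

Lemma balloon_uniq_inner x y : adj x y -> uniq (c x y).
Proof. by move/balloon_uniq; rewrite /= rcons_uniq => /and3P[]. Qed.

Lemma balloon_disjoint x y x' y' v : oriented k x y -> oriented k x' y' ->
  v \in c x y -> v \in c x' y' -> x = x' /\ y = y'.
Proof.
move=> /and3P [a kx ky] /and3P [a' kx' ky'] v1 v2.
case: fc => _ _ _ h _; have [/setP e|/(h _ _ _ _ a a')/(_ v v1)] := eqVneq [set x; y] [set x'; y'];
  last by rewrite v2.
have := e x; rewrite !inE eqxx /= => /esym/orP [/eqP|] e1; last first.
  by move: kx; rewrite (eqP e1) (negPf ky').
have := e y; rewrite !inE eqxx orbT => /esym/orP [|/eqP //] e2.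
by move: ky; rewrite (eqP e2) kx'.
Qed.

Lemma balloon_cover v : (exists x, v = f x) \/
  exists x y i, [/\ oriented k x y, i < size (c x y) & v = cn x y i].
Proof.
case: fc => _ _ _ _ [/(_ v) [?|[x [y [a vc]]]] _]; [by left | right].
case/orP: (orient a) => o.
  by exists x, y, (index v (c x y)); rewrite index_mem nth_index.
have vc' : v \in c y x by rewrite (balloon_rev a) mem_rev.
by exists y, x, (index v (c y x)); rewrite index_mem nth_index.
Qed.

Lemma next_cycle x y i : adj x y -> i < (size (c x y)).+2 ->
  next (C x y) (nth (f x) (C x y) i) = nth (f x) (rcons (c x y) (f y)) i.
Proof.
move=> a il; rewrite next_nth mem_nth /= ?size_rcons //.
congr nth; have := @index_uniq _ (f x) i (C x y); rewrite /= size_rcons => -> //.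
exact: balloon_uniq.
Qed.

Lemma balloon_adj x y i : adj x y -> i < (size (c x y)).+2 ->
  adj (nth (f x) (C x y) i) (nth (f x) (rcons (c x y) (f y)) i).
Proof.
move=> a il; case: fc => _ _ _ _ [_ h]; apply/h; exists x, y.
by rewrite next_cycle // mem_nth //= size_rcons.
Qed.

Lemma nth_cn x y i : i < size (c x y) -> nth (f x) (rcons (c x y) (f y)) i = cn x y i.
Proof. by move=> il; rewrite nth_rcons il. Qed.

Lemma balloon_adj_ends x y : adj x y -> adj (f x) (f y).
Proof.
move=> a; rewrite adj_sym; have := @balloon_adj x y (size (c x y)).+1 a (ltnSn _) => /=.
by rewrite !nth_rcons ltnn eqxx ltnNge leqnSn /= eqn_leq ltnn.
Qed.

Lemma balloon_adj_first x y : adj x y -> adj (f x) (cn x y 0).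
Proof.
move=> a; have [_ l3] := balloon_size a; have := @balloon_adj x y 0 a erefl.
by rewrite /= nth_cn //; lia.
Qed.

Lemma balloon_adj_step x y i : adj x y -> i.+1 < size (c x y) ->
  adj (cn x y i) (cn x y i.+1).
Proof.
move=> a l; have := @balloon_adj x y i.+1 a; rewrite /= !nth_cn //; last exact: ltnW.
by apply; lia.
Qed.

Lemma balloon_adj_last x y : adj x y -> adj (cn x y (size (c x y)).-1) (f y).
Proof.
move=> a; have [_ l3] := balloon_size a.
have /(balloon_adj a) : (size (c x y)).-1.+1 < (size (c x y)).+2 by lia.
have e : (size (c x y)).-1.+1 = size (c x y) by lia.
by rewrite /= !nth_rcons e ltnn eqxx leqnn.
Qed.

(** Adjacency is given by [next] on either description of a cycle. A forward step on the reversed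
    cycle is a backward step on the oriented one, so symmetry of [R] leaves only the base edge and
    the steps along the inner path. *)
Lemma balloon_adj_ind (R : B -> B -> Prop) :
  (forall v w, R v w -> R w v) ->
  (forall x y, oriented k x y -> R (f x) (f y)) ->
  (forall x y, oriented k x y -> R (f x) (cn x y 0)) ->
  (forall x y i, oriented k x y -> i.+1 < size (c x y) -> R (cn x y i) (cn x y i.+1)) ->
  (forall x y, oriented k x y -> R (cn x y (size (c x y)).-1) (f y)) ->
  forall v w, adj v w -> R v w.
Proof.
move=> sR h1 h2 h3 h4.
have hC x y i : oriented k x y -> i < (size (c x y)).+2 ->
    R (nth (f x) (C x y) i) (nth (f x) (rcons (c x y) (f y)) i).
  move=> o; have a := oriented_adj o; have [_ l3] := balloon_size a.
  rewrite ltnS leq_eqVlt => /orP [/eqP ->|].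
    apply: sR; rewrite /= !nth_rcons ltnn eqxx ltnNge leqnSn /= eqn_leq ltnn /=; exact: h1.
  case: i => [_|i il] /=; first by rewrite nth_cn; [exact: h2 | lia].
  rewrite nth_cn //; move: il; rewrite ltnS leq_eqVlt => /orP [/eqP e|il].
    by rewrite nth_rcons e ltnn eqxx; have := h4 _ _ o; rewrite -e.
  by rewrite nth_cn //; exact: h3.
move=> v w; case: fc => _ _ _ _ [_ h] /h [x [y [a vC ->]]].
case/orP: (orient a) => o.
  have il : index v (C x y) < (size (c x y)).+2 by move: vC; rewrite -index_mem /= size_rcons.
  by have := hC _ _ _ o il; rewrite -next_cycle // nth_index.
have a' := oriented_adj o.
have e : C x y = rev (C y x) by rewrite (balloon_rev a') rev_cons rev_rcons.
have u' := balloon_uniq a'.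
rewrite e next_rev //; apply: sR.
have vC' : v \in C y x by rewrite -mem_rev -e.
rewrite -{2}(next_prev u' v).
have pC : prev (C y x) v \in C y x by rewrite mem_prev.
have il : index (prev (C y x) v) (C y x) < (size (c y x)).+2.
  by move: pC; rewrite -index_mem /= size_rcons.
by have := hC _ _ _ o il; rewrite -next_cycle // nth_index.
Qed.

(** All embeddings and colourings of [B] are defined this way: values may be prescribed freely
    because the ends and the inner positions of the oriented cycles are pairwise distinct. *)
Lemma balloon_slots (S : Type) (s0 : S) (sg : H -> S) (ta : H -> H -> nat -> S) :
  exists2 h : B -> S, forall x, h (f x) = sg x &
    forall x y i, oriented k x y -> i < size (c x y) -> h (cn x y i) = ta x y i.
Proof.
exists (fun v => if [pick x | f x == v] is Some x then sg x else
  if [pick p : H * H | oriented k p.1 p.2 && (v \in c p.1 p.2)] is Some p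
  then ta p.1 p.2 (index v (c p.1 p.2)) else s0) => [x|x y i o il].
  case: pickP => [y /eqP/balloon_inj -> //|/(_ x)]; by rewrite eqxx.
have a := oriented_adj o; have inc : cn x y i \in c x y by apply: mem_nth.
case: pickP => [z /eqP e|_]; first by have := balloon_new z a; rewrite e inc.
case: pickP => [[x' y'] /= /andP [o' i']|/(_ (x, y))]; last by rewrite /= o inc.
have [-> ->] := balloon_disjoint o' o i' inc.
by rewrite index_uniq // balloon_uniq_inner.
Qed.

End Ballooning.

(* How an odd cycle of the ballooning is placed in a nearly bipartite host: the
   inner vertices alternate between the classes, with one defect at position
   [switch]. The defect is absorbed by the end in the class [true] ([Center], or
   [Leaf] when moreover the first inner vertex is prescribed), by the other end,
   by a single vertex joined to both classes, or by an edge inside a class. *)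
Inductive gadget (G : Type) : Type :=
  | Center | Leaf of G | CoCenter | Single of G | InTrue of G & G | InFalse of G & G.
Arguments Center {G}.
Arguments CoCenter {G}.

Definition switch (G : Type) (l : nat) (m : gadget G) : nat :=
  match m with
  | Center | Leaf _ => 0
  | CoCenter => l
  | Single _ | InFalse _ _ => 1
  | InTrue _ _ => 2
  end.

Definition before (G : Type) (m : gadget G) : option G :=
  match m with Single u => Some u | InTrue p _ | InFalse p _ => Some p | _ => None end.

Definition after (G : Type) (m : gadget G) : option G :=
  match m with Leaf z => Some z | InTrue _ q | InFalse _ q => Some q | _ => None end.

Definition points (G : Type) (m : gadget G) : seq G :=
  match m with
  | Leaf z => [:: z] | Single u => [:: u]
  | InTrue p q | InFalse p q => [:: p; q]
  | _ => [::]
  end.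

(** * Embedding the odd cycles by gadgets *)

Section GadgetEmbedding.
Variables (H B G : graph) (f : H -> B) (c : H -> H -> seq B) (k : H -> bool).
Hypothesis fc : ballooning_by f c.
Hypothesis kH : two_coloring k.
Variables (C : bool -> {set G}) (e : nat) (g0 : G).

(** [ox] and [oy] are the prescribed images of the ends in the classes [true] and [false], with
    [None] for an end left to the greedy embedding. A prescribed vertex must miss few vertices of
    the class where its unprescribed neighbours on the cycle are placed. *)
Definition gadget_ok (ox oy : option G) (m : gadget G) : Prop :=
  match m with
  | Center => exists w, [/\ ox = Some w, oy = None & forall b, miss w (C b) <= e]
  | Leaf z => exists w, [/\ ox = Some w, oy = None, adj w z,
                 miss w (C false) <= e & miss z (C false) <= e]
  | CoCenter => exists w, [/\ ox = None, oy = Some w & forall b, miss w (C b) <= e]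
  | Single u => [/\ ox = None, oy = None & forall b, miss u (C b) <= e]
  | InTrue p q => [/\ oy = None, adj p q, miss p (C false) <= e, miss q (C false) <= e
                 & forall w, ox = Some w -> miss w (C false) <= e]
  | InFalse p q => [/\ oy = None, adj p q, miss p (C true) <= e, miss q (C true) <= e
                 & forall w, ox = Some w -> miss w (C false) <= e /\ adj w p]
  end.

(** A slot is a class with an optional prescribed image; the cases are the hypotheses of
    [greedy_embedding] on an edge. *)
Definition slot_ok (a b : bool * option G) : Prop :=
  match a.2, b.2 with
  | Some p, Some q => adj p q
  | None, None => a.1 != b.1
  | Some p, None => miss p (C b.1) <= e
  | None, Some q => miss q (C a.1) <= e
  end.

(** Before the [switch] the classes alternate starting from [f x], afterwards they alternate so as
    to fit [f y]. For odd [l] the two alternations disagree, and prescribed vertices can sit only at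
    the two positions around the disagreement. *)
Definition inner_slot (l : nat) (m : gadget G) (i : nat) : bool * option G :=
  (~~ odd i (+) (i < switch l m),
   if i.+1 == switch l m then before m else if i == switch l m then after m else None).

Lemma inner_slot_points l m i z : (inner_slot l m i).2 = Some z -> z \in points m.
Proof.
rewrite /inner_slot /=; case: ifP => _; last case: ifP => _ //;
  by case: m => [|y||y|p q|p q] //= [->]; rewrite !inE eqxx ?orbT.
Qed.

(** Within one cycle the only conceivable repetition is [p = q], which their adjacency excludes. *)
Lemma gadget_inj ox oy l m i j z : gadget_ok ox oy m -> 
  (inner_slot l m i).2 = Some z -> (inner_slot l m j).2 = Some z -> i = j.
Proof.
move=> ok; rewrite /inner_slot /=.
by case: m ok => [|y||y|p q|p q] //= ok; do ?[case: ifP => //]; try lia;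
  move=> *; try lia;
  repeat match goal with h : Some _ = Some _ |- _ => case: h => ? end; subst;
  case: ok => _; rewrite adj_irr.
Qed.

Lemma slot_ok_sym a b : slot_ok a b -> slot_ok b a.
Proof.
by case: a b => [a [p|]] [b [q|]]; rewrite /slot_ok //= 1?adj_sym 1?eq_sym.
Qed.

Lemma gadget_ends ox oy m : gadget_ok ox oy m -> slot_ok (true, ox) (false, oy).
Proof.
rewrite /slot_ok; case: m => [|y||y|p q|p q] /=.
- by case=> w [-> -> /(_ false)].
- by case=> w [-> -> _].
- by case=> w [-> -> /(_ true)].
- by case=> -> ->.
- by case=> -> _ _ _; case: ox => // w /(_ _ erefl).
- by case=> -> _ _ _; case: ox => // w /(_ _ erefl) [].
Qed.

Lemma gadget_first ox oy m l : odd l -> 3 <= l -> gadget_ok ox oy m ->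
  slot_ok (true, ox) (inner_slot l m 0).
Proof.
move=> ol l3; rewrite /slot_ok /inner_slot; case: m => [|y||y|p q|p q] /=.
- by case=> w [-> _ /(_ true)].
- by case=> w [-> _ ? _].
- by case=> w [-> _ _]; rewrite (_ : 0 < l); [case: l ol l3 => [|[|[|l]]] | lia].
- by case=> -> _ /(_ true).
- by case=> _ _ _ _; case: ox => // w /(_ _ erefl).
- by case=> _ _ ? _; case: ox => // w /(_ _ erefl) [].
Qed.

Lemma gadget_step ox oy m l i : odd l -> 3 <= l -> i.+1 < l -> gadget_ok ox oy m ->
  slot_ok (inner_slot l m i) (inner_slot l m i.+1).
Proof.
move=> ol l3 il; rewrite /slot_ok /inner_slot; case: m => [|y||y|p q|p q] /=.
- by case=> w _; case: i il => [|i] //= _; case: (odd i).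
- case=> w [_ _ _ _ mz]; case: i il => [|i] //= _.
  by case: (odd i).
- by case=> w _; rewrite !if_same il (ltnW il) /=; case: (odd i).
- case=> _ _ my; case: i il => [|[|i]] //= _.
  by case: (odd i).
- case=> _ apq mp mq _; case: i il => [|[|[|i]]] //= _.
  by case: (odd i).
- case=> _ apq mp mq _; case: i il => [|[|i]] //= _.
  by case: (odd i).
Qed.

Lemma gadget_last ox oy m l : odd l -> 3 <= l -> gadget_ok ox oy m ->
  slot_ok (inner_slot l m l.-1) (false, oy).
Proof.
move=> ol l3; case: l ol l3 => // l; rewrite /= => ol l3.
have {ol} ol : odd l = false by apply/negbTE.
rewrite /slot_ok /inner_slot; case: m => [|y||y|p q|p q] /=; rewrite ?ol ?ltnn.
- by case=> w [_ -> _]; rewrite /=; case: l l3 ol.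
- by case=> w [_ -> _ _ _]; rewrite /=; case: l l3 ol => [|[]].
- by case=> w [_ -> /(_ false)]; rewrite eqxx /= ltnSn.
- by case=> _ -> _; case: l l3 ol => [|[|l]].
- by case=> -> _ _ mq _; case: l l3 ol => [|[|[|l]]].
- by case=> -> _ _ mq _; case: l l3 ol => [|[|l]].
Qed.

Theorem gadget_embedding (sg : H -> option G) (gd : H -> H -> gadget G) :
  (forall b y, y \in C b -> miss y (C (~~ b)) <= e) ->
  (forall b, #|B| * e.+1 <= #|C b|) ->
  (forall x x' w, sg x = Some w -> sg x' = Some w -> x = x') ->
  (forall x y z w, oriented k x y -> sg z = Some w -> w \notin points (gd x y)) ->
  (forall x y x' y' w, oriented k x y -> oriented k x' y' ->
     w \in points (gd x y) -> w \in points (gd x' y') -> x = x' /\ y = y') ->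
  (forall x y, oriented k x y -> gadget_ok (sg x) (sg y) (gd x y)) ->
  subgraph B G.
Proof.
move=> hC cC isg sgd dgd ok.
have [h hf hc] := balloon_slots k fc (true, None) (fun x => (k x, sg x))
  (fun x y i => inner_slot (size (c x y)) (gd x y) i).
have R v w : adj v w -> slot_ok (h v) (h w).
  apply: (balloon_adj_ind fc kH (R := fun v w => slot_ok (h v) (h w))) => {v w}.
  - by move=> v w; apply: slot_ok_sym.
  - move=> x y o; rewrite !hf; case/and3P: (o) => _ -> /negbTE ->.
    exact: gadget_ends (ok _ _ o).
  - move=> x y o; case/and3P: (o) => a kx _; have [l1 l2] := balloon_size fc a.
    by rewrite hf hc ?kx //; [apply: gadget_first (ok _ _ o) | lia].
  - move=> x y i o il; case/and3P: (o) => a kx _; have [l1 l2] := balloon_size fc a.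
    by rewrite !hc //; [apply: gadget_step (ok _ _ o) | lia].
  - move=> x y o; case/and3P: (o) => a _ /negbTE ky; have [l1 l2] := balloon_size fc a.
    by rewrite hf hc ?ky //; [apply: gadget_last (ok _ _ o) | lia].
pose D := [set v | (h v).2 != None :> option G].
pose g v := odflt g0 (h v).2.
have inD v : v \in D -> (h v).2 = Some (g v).
  by rewrite inE /g; case: (h v).2.
have ninD v : v \notin D -> (h v).2 = None by rewrite inE negbK => /eqP.
apply: (@greedy_embedding B G (fun v => (h v).1) C e hC cC D g).
- move=> v w /inD hv /inD hw e1; move: hv hw; rewrite -e1 {e1}; move: (g v) => z.
  case: (balloon_cover fc kH v) => [[x ->]|[x [y [i [o il ->]]]]];
  case: (balloon_cover fc kH w) => [[x' ->]|[x' [y' [i' [o' il' ->]]]]].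
  + by rewrite !hf /= => e1 e2; rewrite (isg _ _ _ e1 e2).
  + rewrite hf hc //= => e1 /inner_slot_points e2.
    by have := sgd _ _ _ _ o' e1; rewrite e2.
  + rewrite hf hc //= => /inner_slot_points e2 e1.
    by have := sgd _ _ _ _ o e1; rewrite e2.
  rewrite !hc //= => e1 e2.
  have [? ?] := dgd _ _ _ _ _ o o' (inner_slot_points e1) (inner_slot_points e2).
  subst x' y'; congr nth; exact: gadget_inj (ok _ _ o) e1 e2.
- by move=> v w /inD hv /inD hw /R; rewrite /slot_ok hv hw.
- by move=> v w /ninD hv /ninD hw /R; rewrite /slot_ok hv hw.
- by move=> v w /inD hv /ninD hw /R; rewrite /slot_ok hv hw.
Qed.

End GadgetEmbedding.

(* A matching is encoded as an involution moving every matched vertex to its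
   partner and fixing the unmatched ones. *)
Definition matching (T : finType) (q : rel T) (M : T -> T) : Prop :=
  forall x, M (M x) = x /\ (M x != x -> q x (M x)).

Definition cov (T : finType) (M : T -> T) : {set T} := [set x | M x != x].

(** A choice of one end of each matching edge, so that edges can be counted and selected as
    vertices. *)
Definition lower (T : finType) (M : T -> T) : {set T} :=
  [set x | enum_rank x < enum_rank (M x)].

Section Matchings.
Variables (T : finType) (q : rel T) (M : T -> T).
Hypothesis hM : matching q M.

Lemma matchingK : involutive M. Proof. by move=> x; case: (hM x). Qed.

Lemma matching_edge x : x \in cov M -> q x (M x).
Proof. by rewrite inE => h; case: (hM x) => _; apply. Qed.

Lemma cov_partner x : (M x \in cov M) = (x \in cov M).
Proof. by rewrite !inE matchingK eq_sym. Qed.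

Lemma lower_cov x : x \in lower M -> x \in cov M.
Proof. by rewrite !inE; apply: contraTneq => ->; rewrite ltnn. Qed.

Lemma card_cov : #|cov M| = #|lower M|.*2.
Proof.
have mI := can_inj matchingK.
rewrite -addnn -{2}(card_imset (lower M) mI) -cardsUI.
rewrite (_ : _ :&: _ = set0); last first.
  apply/setP => x; rewrite !inE; apply/negbTE/negP => /andP [h1 /imsetP [y h2 e]].
  by move: h1 h2; rewrite inE e matchingK => h1 /(ltn_trans h1); rewrite ltnn.
rewrite cards0 addn0; apply: eq_card => x; rewrite !inE.
have -> : (x \in M @: lower M) = (enum_rank (M x) < enum_rank x).
  apply/imsetP/idP => [[y + ->]|h]; first by rewrite inE matchingK.
  by exists (M x); rewrite ?inE matchingK.
have -> : (M x != x) = (enum_rank x != enum_rank (M x) :> nat).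
  by rewrite eq_sym; congr negb; apply/eqP/eqP => [<-|/ord_inj/enum_rank_inj].
by rewrite neq_ltn.
Qed.

Lemma lower_disjoint x y z : x \in lower M -> y \in lower M ->
  z \in [:: x; M x] -> z \in [:: y; M y] -> x = y.
Proof.
rewrite !inE => hx hy /orP [] /eqP -> /orP [] /eqP e //; subst.
- by move: hx; rewrite matchingK => /(ltn_trans hy); rewrite ltnn.
- by move: hy; rewrite matchingK => /(ltn_trans hx); rewrite ltnn.
- by rewrite -(matchingK x) e matchingK.
Qed.

End Matchings.

Definition oedges (H : graph) (k : H -> bool) : {set H * H} :=
  [set p | oriented k p.1 p.2].

(** * Hosts given by matchings, stars and single edges *)

Section Embeddings.
Variables (H B : graph) (f : H -> B) (c : H -> H -> seq B) (k : H -> bool).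
Hypothesis fc : ballooning_by f c.
Hypothesis kH : two_coloring k.
Hypothesis B0 : 0 < #|B|.

Section Host.
Variables (G : graph) (C : bool -> {set G}) (e : nat) (U : {set G}).
Hypothesis hC : forall b y, y \in C b -> miss y (C (~~ b)) <= e.
Hypothesis cC : forall b, #|B| * e.+1 <= #|C b|.
Hypothesis hU : forall u b, u \in U -> miss u (C b) <= e.

Section Sided.
Variables (s : G -> bool) (M : G -> G).
Hypothesis hM : matching (fun x y => adj x y && (s x == s y)) M.
Hypothesis hs : forall x, x \in cov M -> miss x (C (~~ s x)) <= e.

Definition side_gadget (z : G) : gadget G :=
  if s z then InTrue z (M z) else InFalse z (M z).

Lemma points_side_gadget z : points (side_gadget z) = [:: z; M z].
Proof. by rewrite /side_gadget; case: ifP. Qed.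

Lemma matching_sides z : z \in cov M ->
  [/\ adj z (M z), s (M z) = s z, miss z (C (~~ s z)) <= e & miss (M z) (C (~~ s z)) <= e].
Proof.
move=> zM; have /andP [a /eqP es] := matching_edge hM zM; split=> //; first exact: hs.
by rewrite es; apply: hs; rewrite (cov_partner hM).
Qed.

Lemma side_gadget_ok z : z \in cov M -> gadget_ok C e None None (side_gadget z).
Proof.
move=> /matching_sides []; rewrite /side_gadget; case: (s z) => a _ h1 h2;
  by split.
Qed.

Lemma host_point : exists g0 : G, g0 \in C true.
Proof.
by apply/card_gt0P; apply: leq_trans (cC true); rewrite muln_gt0 B0.
Qed.

(** Each cycle uses one matching edge for its defect, and all vertices of [H] are placed
    greedily. *)
Lemma embed_by_matching : 2 * #|oedges k| <= #|cov M| -> subgraph B G.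
Proof.
rewrite (card_cov hM) -mul2n leq_pmul2l // => le; have [g0 _] := host_point.
have [io ioi ioM] := inj_of_card g0 le.
apply: (@gadget_embedding H B G f c k fc kH C e g0 (fun _ => None)
  (fun x y => side_gadget (io (x, y)))) => //.
- move=> x y x' y' w o o'; rewrite !points_side_gadget => w1 w2.
  have i1 : (x, y) \in oedges k by rewrite inE.
  have i2 : (x', y') \in oedges k by rewrite inE.
  have := lower_disjoint hM (ioM _ i1) (ioM _ i2) w1 w2.
  by move/(ioi _ _ i1 i2) => [-> ->].
- by move=> x y o; apply/side_gadget_ok/lower_cov/ioM; rewrite inE.
Qed.

Variable a : H.
Hypothesis ka : k a.
Let W := [set x | k x] :\ a.
Hypothesis cU : #|W| = #|U|.

Lemma oriented_class x y : oriented k x y -> (x == a) || (x \in W).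
Proof. by case/and3P => _ kx _; rewrite !inE kx andbT; case: (x == a). Qed.

Lemma oriented_right x y : oriented k x y -> y \notin W.
Proof. by case/and3P => _ _ ky; rewrite !inE (negbTE ky) andbF. Qed.

Lemma oriented_right_a x y : oriented k x y -> y == a = false.
Proof. by case/and3P => _ _ ky; apply/negbTE; apply: contraNneq ky => ->. Qed.

Hypothesis UM : [disjoint cov M & U].

(** The class of [a] without [a] goes to [U] and absorbs the defects of its cycles; each cycle
    through [a] uses a matching edge. *)
Lemma embed_matching_at_vertex :
  2 * #|nbh a| <= #|cov M| -> subgraph B G.
Proof.
rewrite (card_cov hM) -mul2n leq_pmul2l // => le; have [g0 _] := host_point.
have [io ioi ioM] := inj_of_card g0 le.
have [om omi omU] := inj_of_card g0 (eq_leq cU).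
apply: (@gadget_embedding H B G f c k fc kH C e g0
  (fun x => if x \in W then Some (om x) else None)
  (fun x y => if x \in W then Center else side_gadget (io y))) => //.
- by move=> x y w; case: ifP => // xW [<-]; case: ifP => // yW [/omi ->].
- move=> x y z w o; case: ifP => // zW [<-]; case: ifP => // xW.
  move: (oriented_class o); rewrite xW orbF => /eqP ?; subst x.
  have yN : y \in nbh a by rewrite inE (oriented_adj o).
  rewrite points_side_gadget; apply/negP => h.
  have /(disjointFr UM) : om z \in cov M.
    have := lower_cov (ioM _ yN); move: h; rewrite !inE => /orP [] /eqP ->;
    by rewrite // (matchingK hM) eq_sym.
  by rewrite omU.
- move=> x y x' y' w o o'; case: ifP => // xW; case: ifP => // xW'.
  move: (oriented_class o) (oriented_class o'); rewrite xW xW' !orbF => /eqP ? /eqP ?; subst x x'.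
  rewrite !points_side_gadget => w1 w2.
  have i1 : y \in nbh a by rewrite inE (oriented_adj o).
  have i2 : y' \in nbh a by rewrite inE (oriented_adj o').
  by have := lower_disjoint hM (ioM _ i1) (ioM _ i2) w1 w2; move/(ioi _ _ i1 i2).
- move=> x y o; rewrite (negbTE (oriented_right o)).
  case: ifP => xW; first by exists (om x); split=> // b; apply/hU/omU.
  move: (oriented_class o); rewrite xW orbF => /eqP ?; subst x.
  by apply/side_gadget_ok/lower_cov/ioM; rewrite inE (oriented_adj o).
Qed.

Variables (x0 : G) (J : {set G}).
Hypothesis x0U : x0 \notin U.
Hypothesis mx0 : miss x0 (C false) <= e.
Hypothesis Jx0 : J \subset nbh x0.
Hypothesis JU : [disjoint J & U].
Hypothesis mJ : forall z, z \in J -> miss z (C false) <= e.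
Hypothesis x0M : x0 \notin cov M.
Hypothesis JM : [disjoint J & cov M].
(** [x0] acts as a vertex of the class [true]. An edge inside the class [false] is entered directly
    from [x0], so one of its ends must be adjacent to [x0]. *)
Hypothesis unblocked : forall z, z \in cov M -> s z = false -> adj x0 z || adj x0 (M z).

Definition star_gadget (z : G) : gadget G :=
  if s z then InTrue z (M z) else
  if adj x0 z then InFalse z (M z) else InFalse (M z) z.

Lemma points_star_gadget z w :
  (w \in points (star_gadget z)) = (w \in [:: z; M z]).
Proof. by rewrite /star_gadget; do 2?case: ifP => // _; rewrite !inE orbC. Qed.

Lemma star_gadget_ok z : z \in cov M -> gadget_ok C e (Some x0) None (star_gadget z).
Proof.
move=> zM; have [a1 _ h1 h2] := matching_sides zM; have := unblocked zM.
move: h1 h2; rewrite /star_gadget; case: (s z) => h1 h2.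
  by move=> _; split=> // w [<-].
case: ifP => a2 /(_ erefl) /= a3; split => //; try by move=> w [<-].
by rewrite adj_sym.
Qed.

(** Here [a] is sent to [x0]: some cycles through [a] start with an edge from [x0] to [J], the
    others use the matching. *)
Lemma embed_star_at_vertex :
  2 * #|nbh a| <= 2 * #|J| + #|cov M| -> subgraph B G.
Proof.
rewrite (card_cov hM) -mul2n -mulnDr leq_pmul2l // => le; have [g0 _] := host_point.
(* [Y1] collects the neighbours of [a] whose cycles are served by [J]. *)
have [Y1 Y1s cY1] : exists2 Y1 : {set H}, Y1 \subset nbh a & #|Y1| = minn #|J| #|nbh a|.
  by apply: subset_of_card; apply: geq_minr.
have [la lai laJ] : exists2 f0 : H -> G, {in Y1 &, injective f0} & forall x, x \in Y1 -> f0 x \in J.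
  by apply: (inj_of_card g0); rewrite cY1 geq_minl.
have [io ioi ioM] : exists2 f0 : H -> G, {in nbh a :\: Y1 &, injective f0} &
    forall x, x \in nbh a :\: Y1 -> f0 x \in lower M.
  apply: (inj_of_card g0); rewrite cardsD (setIidPr Y1s) cY1; lia.
have [om omi omU] := inj_of_card g0 (eq_leq cU).
have cM z w : z \in lower M -> w \in [:: z; M z] -> w \in cov M.
  move=> /lower_cov zM; rewrite !inE => /orP [] /eqP ->; first by move: zM; rewrite inE.
  by rewrite (matchingK hM) eq_sym; move: zM; rewrite inE.
apply: (@gadget_embedding H B G f c k fc kH C e g0
  (fun x => if x \in W then Some (om x) else if x == a then Some x0 else None)
  (fun x y => if x \in W then Center else if y \in Y1 then Leaf (la y) else star_gadget (io y))) => //.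
- move=> x y w; case: (boolP (x \in W)) => xW; case: (boolP (y \in W)) => yW /=.
  + by move=> [<-] [/omi ->].
  + by move=> [<-]; case: ifP => // _ [e1]; move: x0U; rewrite e1 omU.
  + by case: ifP => // _ [<-] [e1]; move: x0U; rewrite -e1 omU.
  by case: eqP => // ->; case: eqP.
- move=> x y z w o; case: (boolP (x \in W)) => //= xW.
  move: (oriented_class o); rewrite (negbTE xW) orbF => /eqP ?; subst x.
  have yN : y \in nbh a by rewrite inE (oriented_adj o).
  case: (boolP (y \in Y1)) => yY /=.
    case: ifP => [zW [<-]|_]; last case: ifP => // _ [<-].
      rewrite inE; apply: contraTneq (omU _ zW) => ->.
      by rewrite (disjointFr JU) // laJ.
    rewrite inE; apply/eqP => e1; have := subsetP Jx0 _ (laJ _ yY).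
    by rewrite -e1 inE adj_irr.
  have yD : y \in nbh a :\: Y1 by rewrite inE yY.
  rewrite points_star_gadget => e1; apply/negP => /(cM _ _ (ioM _ yD)) wM; move: e1.
  case: ifP => [zW [e1]|_]; first by move: (disjointFr UM wM); rewrite -e1 omU.
  by case: ifP => // _ [e1]; move: x0M; rewrite e1 wM.
- move=> x y x' y' w o o'.
  case: (boolP (x \in W)) => //= xW; case: (boolP (x' \in W)) => //= xW'.
  move: (oriented_class o) (oriented_class o'); rewrite (negbTE xW) (negbTE xW') !orbF => /eqP ? /eqP ?; subst x x'.
  have i1 : y \in nbh a by rewrite inE (oriented_adj o).
  have i2 : y' \in nbh a by rewrite inE (oriented_adj o').
  case: (boolP (y \in Y1)) => yY; case: (boolP (y' \in Y1)) => yY' /=.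
  + by rewrite !inE => /eqP -> /eqP /lai ->.
  + rewrite inE points_star_gadget => /eqP -> wM.
    have /cM/(_ wM) : io y' \in lower M by apply: ioM; rewrite inE yY'.
    by rewrite (disjointFr JM) ?laJ.
  + rewrite inE points_star_gadget => wM /eqP e1.
    have /cM/(_ wM) : io y \in lower M by apply: ioM; rewrite inE yY.
    by rewrite e1 (disjointFr JM) ?laJ.
  rewrite !points_star_gadget => w1 w2.
  have d1 : y \in nbh a :\: Y1 by rewrite inE yY.
  have d2 : y' \in nbh a :\: Y1 by rewrite inE yY'.
  by have := lower_disjoint hM (ioM _ d1) (ioM _ d2) w1 w2; move/(ioi _ _ d1 d2).
- move=> x y o; rewrite (negbTE (oriented_right o)) (oriented_right_a o).
  case: ifP => xW; first by exists (om x); split=> // b; apply/hU/omU.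
  move: (oriented_class o); rewrite xW orbF => /eqP ?; subst x; rewrite eqxx.
  have yN : y \in nbh a by rewrite inE (oriented_adj o).
  case: ifP => yY.
    exists x0; split=> //; last exact/mJ/laJ.
    by have := subsetP Jx0 _ (laJ _ yY); rewrite inE.
  by apply/star_gadget_ok/lower_cov/ioM; rewrite inE yY.
Qed.

End Sided.

(* The set [W] and all but one of the edges missing [W] are handled by [U]. *)
Lemma embed_by_edge (W : {set H}) (p q : G) :
  independent W ->
  #|W| + #|[set xy in oedges k | (xy.1 \notin W) && (xy.2 \notin W)]| = #|U|.+1 ->
  (exists xy, [/\ xy \in oedges k, xy.1 \notin W & xy.2 \notin W]) ->
  adj p q -> p \notin U -> q \notin U ->
  miss p (C false) <= e -> miss q (C false) <= e -> subgraph B G.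
Proof.
set E0 := [set _ in _ | _] => iW cE [e0 [oe0 e01 e02]] apq pU qU mp mq.
have eE : e0 \in E0 by rewrite inE oe0 e01.
have cW : #|W| <= #|U|.
  have : 0 < #|E0| by apply/card_gt0P; exists e0.
  lia.
have [om omi omU] := inj_of_card p cW.
have cI : #|om @: W| = #|W| by apply: card_in_imset.
have sI : om @: W \subset U by apply/subsetP => u /imsetP [x xW ->]; apply: omU.
have [io ioi ioU] : exists2 f0 : H * H -> G, {in E0 :\ e0 &, injective f0} &
    forall x, x \in E0 :\ e0 -> f0 x \in U :\: om @: W.
  apply: (inj_of_card p); rewrite cardsD (setIidPr sI) cI.
  by move: cE; rewrite (cardsD1 e0 E0) eE /= addnCA add1n => -[<-]; rewrite addKn.
(* The missed edge [e0] receives the edge [p q]; every other missed edge receives a spare vertex of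
   [U]. *)
pose gd x y := if x \in W then Center else if y \in W then CoCenter else
   if (x, y) == e0 then InTrue p q else Single (io (x, y)).
have gdP x y : oriented k x y -> gd x y = if x \in W then Center else if y \in W then CoCenter else
   if (x, y) == e0 then InTrue p q else Single (io (x, y)) by [].
have inE0 x y : oriented k x y -> x \in W = false -> y \in W = false -> (x, y) != e0 ->
    (x, y) \in E0 :\ e0 by move=> o h1 h2 h3; rewrite !inE h3 /= o h1 h2.
apply: (@gadget_embedding H B G f c k fc kH C e p
  (fun x => if x \in W then Some (om x) else None) gd) => //.
- by move=> x y w; case: ifP => // xW [<-]; case: ifP => // yW [/omi ->].
- move=> x y z w o; case: ifP => // zW [<-]; rewrite /gd.
  case: ifP => // xW; case: ifP => // yW; case: ifPn => [_|ne] /=; rewrite !inE.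
    by apply/norP; split; [apply: contraNneq pU | apply: contraNneq qU] => <-; apply: omU.
  have := ioU _ (inE0 _ _ o xW yW ne); rewrite inE => /andP [h _].
  by apply: contraNneq h => <-; apply: imset_f.
- move=> x y x' y' w o o'; rewrite /gd.
  case xW: (x \in W) => //; case yW: (y \in W) => //.
  case xW': (x' \in W) => //; case yW': (y' \in W) => //.
  case: (eqVneq (x, y) e0) => [e1|ne]; case: (eqVneq (x', y') e0) => [e2|ne'] /=.
  + by move: e1; rewrite -e2 => -[-> ->].
  + rewrite !inE => w1 /eqP w2; have := ioU _ (inE0 _ _ o' xW' yW' ne').
    by rewrite -w2 inE; case/orP: w1 => /eqP ->; rewrite ?(negbTE pU) ?(negbTE qU) andbF.
  + rewrite !inE => /eqP w2 w1; have := ioU _ (inE0 _ _ o xW yW ne).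
    by rewrite -w2 inE; case/orP: w1 => /eqP ->; rewrite ?(negbTE pU) ?(negbTE qU) andbF.
  rewrite !inE => /eqP -> /eqP /ioi.
  by case/(_ (inE0 _ _ o xW yW ne) (inE0 _ _ o' xW' yW' ne')).
- move=> x y o; rewrite /gd; case: ifP => xW.
    case: ifP => yW; first by have := iW _ _ xW yW; rewrite (oriented_adj o).
    by exists (om x); split=> // b; apply/hU/omU.
  case: ifP => yW; first by exists (om y); split=> // b; apply/hU/omU.
  case: ifPn => [_|ne]; first by split.
  by split=> // b; apply: hU; have := ioU _ (inE0 _ _ o xW yW ne); rewrite inE => /andP [].
Qed.

End Host.
End Embeddings.

(** * Decomposition families of balloonings *)

Lemma natmin_eq (P : nat -> Prop) m :
  P m -> (forall k, P k -> m <= k) -> natmin P = m.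
Proof.
move=> Pm le; have [P1 le1] := natminP (ex_intro _ m Pm).
by apply/eqP; rewrite eqn_leq le1 // le.
Qed.

Lemma colorable_sub (F G : graph) m : subgraph F G -> colorable G m -> colorable F m.
Proof. by move=> [j _ jh] [h hh]; exists (h \o j) => x y /jh /hh. Qed.

Lemma colorable_leq (G : graph) m n : m <= n -> colorable G m -> colorable G n.
Proof. by move=> le [h hh]; exists (widen_ord le \o h) => x y /hh. Qed.

Lemma bipartite_coloring (G : graph) : (exists k : G -> bool, two_coloring k) -> bipartite G.
Proof.
move=> [k hk]; exists (fun x => if k x then ord0 else ord_max) => x y /hk.
by case: (k x); case: (k y).
Qed.

Lemma coloring_bipartite (G : graph) : bipartite G -> exists k : G -> bool, two_coloring k.
Proof.
move=> [h hh]; exists (fun x => h x == ord0) => x y /hh.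
apply: contraNN; case: (h x) (h y) => [[|[|?]] ?] [[|[|?]] ?] //.
Qed.

(** Vertices plus arcs are a measure on which a proper subgraph is strictly smaller, so minimal
    members of a family are reached by induction. *)
Lemma subgraph_measure (N M : graph) : subgraph N M ->
  #|N| + #|[set p : N * N | adj p.1 p.2]| <= #|M| + #|[set p : M * M | adj p.1 p.2]| /\
  (#|N| + #|[set p : N * N | adj p.1 p.2]| = #|M| + #|[set p : M * M | adj p.1 p.2]| -> iso N M).
Proof.
move=> [j ji jh]; pose jj (p : N * N) := (j p.1, j p.2).
have jji : injective jj by move=> [? ?] [? ?] [/ji -> /ji ->].
have sub : jj @: [set p : N * N | adj p.1 p.2] \subset [set p : M * M | adj p.1 p.2].
  by apply/subsetP => _ /imsetP [p + ->]; rewrite !inE => /jh.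
have cV : #|N| <= #|M| by apply: (leq_card j ji).
have := subset_leq_card sub; rewrite (card_imset _ jji) => cE.
split=> [|e]; first exact: leq_add.
exists j.
  by apply: inj_card_bij => //; lia.
have /eqP es : jj @: [set p : N * N | adj p.1 p.2] == [set p : M * M | adj p.1 p.2].
  by rewrite eqEcard sub (card_imset _ jji); lia.
move=> x y; apply/idP/idP => [a|/jh //].
have : (j x, j y) \in jj @: [set p : N * N | adj p.1 p.2] by rewrite es inE.
by case/imsetP => -[u v]; rewrite inE /= => auv [/ji -> /ji ->].
Qed.

Lemma minimal_decomposition (F : graph -> Prop) (M : graph) : decomposes F M ->
  exists2 N, decomposition F N & subgraph N M.
Proof.
move: {2}_.+1 (ltnSn (#|M| + #|[set p : M * M | adj p.1 p.2]|)) => n.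
elim: n M => // n IH M lt dM.
case: (classic (exists N, [/\ decomposes F N, subgraph N M & ~ iso N M])) => [[N [dN sN nN]]|no].
  have [le eqi] := subgraph_measure sN.
  have [|N' dN' sN'] := IH N _ dN.
    rewrite ltnS in lt; apply: leq_trans lt; rewrite ltn_neqAle le andbT.
    by apply/eqP => /eqi.
  by exists N' => //; apply: subgraph_trans sN.
exists M; last exact: subgraph_refl.
by split=> // N dN sN; apply: NNPP => nN; apply: no; exists N.
Qed.

Section Family.
Variables (H B : graph) (f : H -> B) (c : H -> H -> seq B) (k : H -> bool).
Hypothesis fc : ballooning_by f c.
Hypothesis kH : two_coloring k.
Hypothesis oe : exists xy, xy \in oedges k.

Local Notation cn x y i := (nth (f x) (c x y) i).

Definition missed (W : {set H}) : {set H * H} :=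
  [set xy in oedges k | (xy.1 \notin W) && (xy.2 \notin W)].

Definition cost (W : {set H}) : nat := #|W| + #|missed W|.

(* Each odd cycle meets [Z]; a cycle avoiding [f @: H :&: Z] needs a vertex
   of its own. *)
Lemma hitting_cost (Z : {set B}) (col : B -> bool) :
  (forall v w, v \notin Z -> w \notin Z -> adj v w -> col v != col w) ->
  cost [set x | f x \in Z] <= #|Z|.
Proof.
move=> hcol; set W := [set _ | _].
have hit xy : xy \in missed W -> [exists v, (v \in c xy.1 xy.2) && (v \in Z)].
  case: xy => x y; rewrite !inE /= => /andP [o /andP [xZ yZ]].
  apply: contraT => /existsPn no.
  have a := oriented_adj o; have [ol l3] := balloon_size fc a.
  have nZ i : i < size (c x y) -> cn x y i \notin Z.
    by move=> il; move: (no (cn x y i)); rewrite mem_nth.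
  (* Without a vertex of [Z] the colours alternate along the odd number of inner vertices; the last
     one gets the colour opposite to [f x], which is that of its neighbour [f y]. *)
  have alt i : i < size (c x y) -> col (cn x y i) = col (f x) (+) ~~ odd i.
    elim: i => [|i IH] il.
      have := hcol _ _ xZ (nZ _ il) (balloon_adj_first fc a).
      by case: (col _); case: (col _).
    have := hcol _ _ (nZ _ (ltnW il)) (nZ _ il) (balloon_adj_step fc a il).
    by rewrite IH ?(ltnW il) //=; case: (col _); case: (col _); case: (odd i).
  have ll : (size (c x y)).-1 < size (c x y) by lia.
  have := hcol _ _ (nZ _ ll) yZ (balloon_adj_last fc a).
  have := hcol _ _ xZ yZ (balloon_adj_ends fc a).
  have -> : col (cn x y (size (c x y)).-1) = col (f x) (+) true.
    by rewrite alt //; congr addb; case: (size _) ol l3.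
  by case: (col (f x)); case: (col (f y)).
have [e0 oe0] := oe; have fi := balloon_inj fc.
pose v0 := f e0.1.
pose vv xy := odflt v0 [pick v | (v \in c xy.1 xy.2) && (v \in Z)].
have vvP xy : xy \in missed W -> vv xy \in c xy.1 xy.2 /\ vv xy \in Z.
  move=> /hit /existsP [v hv]; rewrite /vv; case: pickP => [w /andP [] //|/(_ v)].
  by rewrite hv.
have vi : {in missed W &, injective vv}.
  move=> [x y] [x' y'] m m' e; have [h1 _] := vvP _ m; have [h2 _] := vvP _ m'.
  have := @balloon_disjoint H B f c k fc x y x' y' (vv (x, y)).
  move: m m' h1 h2; rewrite -e !inE /= => /andP [o _] /andP [o' _] h1 h2.
  by case/(_ o o' h1 h2) => -> ->.
rewrite /cost -(card_imset W fi) -(card_in_imset vi) -cardsUI.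
rewrite (_ : _ :&: _ = set0) ?cards0 ?addn0.
  apply/subset_leq_card/subsetP => v; rewrite inE => /orP [] /imsetP [z hz ->].
    by move: hz; rewrite inE.
  by have [] := vvP _ hz.
apply/setP => v; rewrite !inE; apply/negbTE/negP => /andP [] /imsetP [z hz ->] /imsetP [xy m e].
have [h _] := vvP _ m; move: m; rewrite !inE => /andP [o _].
by have := balloon_new fc z (oriented_adj o); rewrite e h.
Qed.

(** With the empty hitting set, [hitting_cost] would make the cost of the empty set zero, but this
    cost is the number of edges of [H]. *)
Lemma ballooning_not_bipartite : ~ bipartite B.
Proof.
move=> /coloring_bipartite [col hcol].
have := @hitting_cost set0 col (fun v w _ _ => hcol v w); rewrite cards0 leqn0 /cost.
case: oe => e0 h0; rewrite addn_eq0 => /andP [_]; rewrite cards_eq0 => /eqP/setP/(_ e0).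
by rewrite !inE => /andP []; split; move: h0; rewrite inE.
Qed.

(** The third colour is spent on the first inner vertex of each cycle. *)
Lemma ballooning_colorable3 : colorable B 3.
Proof.
pose b2o (b : bool) : 'I_3 := if b then inord 0 else inord 1.
have [h hf hc] := balloon_slots k fc (ord0 : 'I_3) (fun x => b2o (k x))
  (fun x y i => if i == 0 then inord 2 else b2o (~~ odd i)).
exists h => v w; apply: (balloon_adj_ind fc kH (R := fun v w => h v != h w)) => {v w}.
- by move=> v w; rewrite eq_sym.
- by move=> x y /and3P [a kx /negbTE ky]; rewrite !hf kx ky -val_eqE /= !inordK.
- move=> x y o; case/and3P: (o) => a kx ky; have [l1 l2] := balloon_size fc a.
  by rewrite hf hc //=; [rewrite kx -val_eqE /= !inordK | lia].
- move=> x y i o il; rewrite !hc ?(ltnW il) //=.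
  by case: i {il} => [|i]; rewrite /= -val_eqE /=; [|case: (odd i)]; rewrite /= !inordK.
- move=> x y o; case/and3P: (o) => a kx /negbTE ky; have [l1 l2] := balloon_size fc a.
  rewrite hf ky hc //; last by lia.
  by case: (size _) l1 l2 => [|[|[|l]]] //= ol _; rewrite negbK in ol; rewrite ol -val_eqE /= !inordK.
Qed.

Lemma par_ballooning : par (single B) = 2.
Proof.
rewrite /par (natmin_eq (m := 3)) //.
  exists B; first exact: iso_refl.
  apply: natmin_eq; first exact: ballooning_colorable3.
  by move=> [|[|[|m]]] // cm; case: ballooning_not_bipartite; apply: colorable_leq cm.
move=> m [G iG cG]; have nb : ~ bipartite G.
  move=> bG; apply: ballooning_not_bipartite; apply: colorable_sub bG.
  exact/iso_subgraph/iso_sym.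
have c3 : colorable G 3 by apply: colorable_sub ballooning_colorable3; apply: iso_subgraph.
have [] := natminP (ex_intro _ 3 c3); rewrite -/(chi G) cG.
by move: m {cG} => [|[|[|m]]] // cm; case: nb; apply: colorable_leq cm.
Qed.

(* Coordinates on the condition defining [decomposes]: [col] selects the
   vertices outside the edgeless part, [ph] those that land in [M]. *)
Definition splits (M : graph) (col : B -> bool) (ph : B -> option M) : Prop :=
  [/\ forall u v x, ph u = Some x -> ph v = Some x -> u = v,
      forall u v, adj u v -> col u || col v &
      forall u v, adj u v -> col u -> col v ->
        exists x y, [/\ ph u = Some x, ph v = Some y & adj x y]].

Lemma decomposesP (M : graph) :
  decomposes (single B) M <-> exists col ph, @splits M col ph.
Proof.
rewrite /decomposes par_ballooning; split=> [[B' iB [t sB]]|[col [ph [pi cI ch]]]].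
  have [g gi gh] := subgraph_trans (iso_subgraph (iso_sym iB)) sB.
  exists (fun u => if g u is inl _ then true else false).
  exists (fun u => if g u is inl (inl x) then Some x else None); split.
  - move=> u v x; case eu: (g u) => [[y|]|] // [e1]; case ev: (g v) => [[z|]|] // [e2].
    by apply: gi; rewrite eu ev e1 e2.
  (* As [par] is 2, the Turan graph has a single part and hence no edge. *)
  - move=> u v /gh; case: (g u) => [//|i]; case: (g v) => [//|j] /=.
    by rewrite /turan_rel !modn1 eqxx.
  - move=> u v /gh; case: (g u) => [[x|i]|i] //; case: (g v) => [[y|j]|j] //= a _ _.
    by exists x, y.
exists B; first exact: iso_refl.
exists #|B|.
have e : #|B| = 2.-1 * #|B| by rewrite mul1n.
pose g u : join (union M (edgeless #|B|)) (turan 2.-1 (2.-1 * #|B|)) :=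
  if col u then inl (if ph u is Some x then inl x else inr (enum_rank u))
  else inr (cast_ord e (enum_rank u)).
exists g => [u v|u v a]; rewrite /g.
  case: (col u); case: (col v) => //.
    case eu: (ph u) => [x|]; case ev: (ph v) => [y|] // [].
      by move=> xy; subst; apply: pi eu ev.
    exact: enum_rank_inj.
  by case=> /ord_inj/enum_rank_inj.
have := cI _ _ a; have := ch _ _ a; case: (col u); case: (col v) => //.
by case/(_ erefl erefl) => x [y [-> -> /=]].
Qed.

Definition core (col : B -> bool) : {set B} :=
  [set v | col v && [exists w, adj v w && col w]].

(** Vertices of the class without neighbours in it can go to the edgeless part, so [M] has to supply
    only the core. *)
Lemma decomposes_core (col : B -> bool) :
  (forall u v, adj u v -> col u || col v) -> decomposes (single B) (induced (core col)).
Proof.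
move=> hcol; apply/decomposesP; exists col, insub; split=> //.
  move=> u v x; case: insubP => // x1 _ <- [->]; case: insubP => // x2 _ <- [->] //.
move=> u v a cu cv.
have iu : u \in core col by rewrite inE cu; apply/existsP; exists v; rewrite a.
have iv : v \in core col by rewrite inE cv; apply/existsP; exists u; rewrite adj_sym a.
by exists (exist _ u iu), (exist _ v iv); split; rewrite ?insubT.
Qed.

(** An isolated vertex could be moved to the edgeless part, against minimality. *)
Lemma decomposition_no_isolated (M : graph) (x : M) :
  decomposition (single B) M -> exists y, adj x y.
Proof.
case=> /decomposesP [col [ph [pi cI ch]]] minM; apply: NNPP => no.
have dN : decomposes (single B) (induced [set~ x]).
  apply/decomposesP; exists col, (fun u => obind insub (ph u)); split=> //.
    move=> u v z; case eu: (ph u) => [y|] //=; case ev: (ph v) => [y'|] //=.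
    case: insubP => // y1 _ e1 [e3]; case: insubP => // y2 _ e2 [e4].
    by apply: (pi _ _ y'); rewrite // eu -e1 -e2 e3 e4.
  move=> u v a cu cv; have [y [z [-> -> ayz]]] := ch _ _ a cu cv.
  have iy : y \in [set~ x] by rewrite !inE; apply/eqP => e; apply: no; exists z; rewrite -e.
  have iz : z \in [set~ x].
    by rewrite !inE; apply/eqP => e; apply: no; exists y; rewrite -e adj_sym.
  by exists (exist _ y iy), (exist _ z iz); split; rewrite //= insubT.
have sN : subgraph (induced [set~ x]) M by exists val => //; apply: val_inj.
have [j jb _] := minM _ dN sN.
have := bij_eq_card jb; rewrite card_sig (eq_card (B := [set~ x])) // cardsC1.
have : 0 < #|M| by apply/card_gt0P; exists x.
by case: #|M| => // n _ /= e; lia.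
Qed.

End Family.

Lemma induced_sub (M N : graph) (j : N -> M) (S : {set N}) (R : {set M}) :
  injective j -> (forall x y, adj x y -> adj (j x) (j y)) ->
  (forall x, x \in S -> j x \in R) -> subgraph (induced S) (induced R).
Proof.
move=> ji jh jS; exists (fun x : induced S => exist _ (j (val x)) (jS _ (valP x)) : induced R).
  by move=> x y /(congr1 val) /= /ji /val_inj.
by move=> x y; apply: jh.
Qed.

Section Family.
Variables (H B : graph) (f : H -> B) (c : H -> H -> seq B) (k : H -> bool).
Hypothesis fc : ballooning_by f c.
Hypothesis kH : two_coloring k.
Hypothesis oe : exists xy, xy \in oedges k.

Local Notation cn x y i := (nth (f x) (c x y) i).

(** The cover pulls back to [Z]. Outside [Z] no edge has both ends in the class [col], so [col] is a
    proper colouring there and [hitting_cost] applies. *)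
Lemma cover_splits (M : graph) (S : {set M}) (col : B -> bool) (ph : B -> option M) :
  splits col ph -> vertex_cover S ->
  exists Z : {set B}, [/\ #|Z| <= #|S|, cost k [set x | f x \in Z] <= #|Z| &
    forall u, u \in Z -> exists x, [/\ col u, ph u = Some x & x \in S]].
Proof.
move=> [pi cI ch] cS.
pose Z := [set u | col u && (if ph u is Some x then x \in S else false)].
have ZP u : u \in Z -> exists x, [/\ col u, ph u = Some x & x \in S].
  by rewrite inE => /andP [cu]; case: (ph u) => // x xS; exists x.
exists Z; split=> //.
  have [->|[u0 /ZP [x0 _]]] := set_0Vmem Z; first by rewrite cards0.
  pose j u := odflt x0 (ph u).
  have ji : {in Z &, injective j}.
    move=> u v /ZP [x [_ ux _]] /ZP [y [_ vy _]]; rewrite /j ux vy /= => e.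
    by apply: pi ux _; rewrite vy e.
  rewrite -(card_in_imset ji); apply/subset_leq_card/subsetP => _ /imsetP [u /ZP [x [_ ux xS]] ->].
  by rewrite /j ux.
apply: (hitting_cost fc oe (col := col)) => v w vZ wZ a.
have := cI _ _ a; case cv: (col v); case cw: (col w) => // _.
have [x [y [vx wy axy]]] := ch _ _ a cv cw.
by have := cS _ _ axy; move: vZ wZ; rewrite !inE cv cw vx wy /= => /negbTE -> /negbTE ->.
Qed.

(** An edge [x y] of [H] survives as the edge [f x f y]; with both ends in [Z] it would become an
    edge of [M] inside [S]. *)
Lemma independent_splits (M : graph) (S : {set M}) (col : B -> bool) (ph : B -> option M) (Z : {set B}) :
  splits col ph -> independent S ->
  (forall u, u \in Z -> exists x, [/\ col u, ph u = Some x & x \in S]) ->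
  independent [set x | f x \in Z].
Proof.
move=> [pi cI ch] iS ZP x y; rewrite !inE => /ZP [u [cu xu uS]] /ZP [v [cv yv vS]].
apply/negP => a; have [u' [v' [e1 e2]]] := ch _ _ (balloon_adj_ends fc a) cu cv.
by apply/negP; move: e1 e2; rewrite xu yv => -[<-] [<-]; apply: iS.
Qed.

Lemma bipartite_cover (M : graph) : bipartite M ->
  exists S : {set M}, independent S /\ vertex_cover S.
Proof.
move=> /coloring_bipartite [h hh]; exists [set x | h x]; split=> x y; rewrite !inE.
  by move=> hx hy; apply/negP => /hh; rewrite hx hy.
by move/hh; case: (h x); case: (h y).
Qed.

Lemma cover_bipartite (M : graph) (S : {set M}) :
  independent S -> vertex_cover S -> bipartite M.
Proof.
move=> iS cS; apply: bipartite_coloring; exists (fun x => x \in S) => x y a.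
have := cS _ _ a; case xS: (x \in S); case yS: (y \in S) => // _.
by have := iS _ _ xS yS; rewrite a.
Qed.

Lemma gammaP (M : graph) : bipartite M ->
  exists S : {set M}, [/\ independent S, vertex_cover S & #|S| = gamma M].
Proof.
move=> /bipartite_cover [S0 [i0 c0]].
have ex : exists m, exists S : {set M},
    [/\ independent S, vertex_cover S & #|S| = m] by exists #|S0|, S0.
by have [] := natminP ex.
Qed.

Lemma gamma_le (M : graph) (S : {set M}) :
  independent S -> vertex_cover S -> gamma M <= #|S|.
Proof.
move=> iS cS; have ex : exists m, exists S : {set M},
    [/\ independent S, vertex_cover S & #|S| = m] by exists #|S|, S.
by have [_] := natminP ex; apply; exists S.
Qed.

Lemma betaP (M : graph) : exists S : {set M}, vertex_cover S /\ #|S| = beta M.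
Proof.
have ex : exists m, exists S : {set M}, vertex_cover S /\ #|S| = m.
  by exists #|[set: M]|, [set: M]; split=> // x y _; rewrite inE.
by have [] := natminP ex.
Qed.

Lemma beta_le (M : graph) (S : {set M}) : vertex_cover S -> beta M <= #|S|.
Proof.
move=> cS; have ex : exists m, exists S : {set M}, vertex_cover S /\ #|S| = m by exists #|S|, S.
by have [_] := natminP ex; apply; exists S.
Qed.

Variable g : nat.
Hypothesis ming : forall W, independent W -> g <= cost k W.

Lemma gamma_decomposition (M : graph) :
  decomposition (single B) M -> bipartite M -> g <= gamma M.
Proof.
move=> [/(decomposesP fc kH oe) [col [ph sp]] _] /gammaP [S [iS cS <-]].
have [Z [le1 le2 ZP]] := cover_splits sp cS.
have := ming (independent_splits sp iS ZP) => le3; exact: leq_trans (leq_trans le3 le2) le1.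
Qed.

Variable W : {set H}.
Hypothesis iW : independent W.
Hypothesis cW : cost k W = g.

(** In each oriented cycle exactly one edge stays inside the class [col]: the base edge if [y] is in
    [W], otherwise the edge from [f x] to the first inner vertex. One end of it is in [S], whose
    elements are the images of [W] and one inner vertex for each edge missing [W], so that the cost
    bounds [#|S|]. *)
Lemma star_forest : exists (col : B -> bool) (S : {set B}), [/\ forall u v : B, adj u v -> col u || col v,
  forall u v, adj u v -> col u -> col v -> (u \in S) (+) (v \in S) & #|S| <= g].
Proof.
have [h hf hc] := balloon_slots k fc (true, false) (fun x => (k x || (x \in W), x \in W))
  (fun x y i => if y \in W then (odd i, false) else (~~ odd i, (i == 0) && (x \notin W))).
pose R v w := ((h v).1 || (h w).1) && ((h v).1 ==> (h w).1 ==> ((h v).2 (+) (h w).2)).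
have hR v w : adj v w -> R v w.
  apply: (balloon_adj_ind fc kH (R := R)) => {v w}.
  - move=> v w; rewrite /R orbC addbC => /andP [-> /=] /implyP i1.
    by apply/implyP => wi; apply/implyP => vi; exact: (implyP (i1 vi) wi).
  - move=> x y /and3P [a kx /negbTE ky]; rewrite /R !hf kx ky /=.
    case xW: (x \in W); case yW: (y \in W) => //.
    by have := iW xW yW; rewrite a.
  - move=> x y o; case/and3P: (o) => a kx ky; have [l1 l2] := balloon_size fc a.
    rewrite /R hf hc //=; last by lia.
    by rewrite kx /=; case: (y \in W) => //=; case: (x \in W).
  - move=> x y i o il; rewrite /R !hc ?(ltnW il) //=.
    by case: (y \in W); case: (odd i).
  - move=> x y o; case/and3P: (o) => a kx /negbTE ky; have [l1 l2] := balloon_size fc a.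
    rewrite /R hf ky hc //=; last by lia.
    have -> : odd (size (c x y)).-1 = false by case: (size _) l1 l2 => //= l /negbTE.
    by case: (y \in W).
have oc x y : oriented k x y -> 0 < size (c x y).
  by move=> o; have [_ l3] := balloon_size fc (oriented_adj o); lia.
exists (fun v => (h v).1), [set v | (h v).1 && (h v).2]; split.
- by move=> u v /hR /andP [].
- move=> u v /hR /andP [_] /implyP h1 cu cv; rewrite !inE cu cv.
  exact: (implyP (h1 cu) cv).
pose fst_in (xy : H * H) := cn xy.1 xy.2 0.
rewrite -cW; apply: leq_trans (_ : #|f @: W :|: fst_in @: missed k W| <= _); last first.
  by apply: leq_trans (leq_card_setU _ _) _; apply: leq_add; apply: leq_imset_card.
apply/subset_leq_card/subsetP => v; rewrite !inE.
case: (balloon_cover fc kH v) => [[x ->]|[x [y [i [o il ->]]]]].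
  by rewrite hf /= => /andP [_ xW]; rewrite imset_f.
rewrite hc //; case yW: (y \in W); rewrite /= ?andbF // => /and3P [_ /eqP -> xW].
apply/orP; right; apply/imsetP; exists (x, y) => //.
by rewrite !inE o xW yW.
Qed.

Lemma star_forest_decomposition : exists M : graph, exists S : {set M},
  [/\ decomposition (single B) M, independent S, vertex_cover S & #|S| <= g].
Proof.
have [col [S [h1 h2 h3]]] := star_forest.
have [N dN [j ji jh]] := minimal_decomposition (decomposes_core fc kH oe h1).
have inC (v : induced (core col)) : col (val v) by have := valP v; rewrite inE => /andP [].
exists N, [set x | val (j x) \in S]; split=> //.
- move=> x y; rewrite !inE => xS yS; apply/negP => /jh a.
  by have := h2 _ _ a (inC _) (inC _); rewrite xS yS.
- move=> x y /jh a; rewrite !inE.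
  by have := h2 _ _ a (inC _) (inC _); case: (_ \in S); case: (_ \in S).
apply: leq_trans h3; have vi : injective (val \o j) by apply: inj_comp ji; apply: val_inj.
rewrite -(card_imset _ vi); apply/subset_leq_card/subsetP => _ /imsetP [x + ->].
by rewrite inE.
Qed.

Lemma gammaF_ballooning : gammaF (single B) = g.
Proof.
have [M [S [dM iS cS leS]]] := star_forest_decomposition.
have bM := cover_bipartite iS cS.
apply: natmin_eq; last by move=> m [N [dN bN <-]]; apply: gamma_decomposition.
exists M; split=> //; apply/eqP; rewrite eqn_leq gamma_decomposition // andbT.
exact: leq_trans (gamma_le iS cS) leS.
Qed.

Lemma betaF_le (M : graph) (S : {set M}) :
  decomposition (single B) M -> vertex_cover S -> betaF (single B) <= #|S|.
Proof.
move=> dM cS; apply: leq_trans (beta_le cS).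
have ex : exists m, exists2 M, decomposition (single B) M & beta M = m by exists (beta M), M.
by have [_] := natminP ex; apply; exists M.
Qed.

Lemma betaF_ballooning : (forall V, g <= cost k V) -> betaF (single B) = g.
Proof.
move=> minV; have [M [S [dM iS cS leS]]] := star_forest_decomposition.
have lb N : decomposition (single B) N -> g <= beta N.
  move=> [/(decomposesP fc kH oe) [col [ph sp]] _].
  have [T [cT <-]] := betaP N; have [Z [le1 le2 _]] := cover_splits sp cT.
  exact: leq_trans (leq_trans (minV _) le2) le1.
apply: natmin_eq; last by move=> m [N dN <-]; apply: lb.
exists M => //; apply/eqP; rewrite eqn_leq lb // andbT.
exact: leq_trans (beta_le cS) leS.
Qed.

(** A member [M[S]] inside an edgeless graph has [S] independent, hence at least [gammaF] vertices,
    against [#|S| < gammaF]. If the family is a complete graph, it has too many vertices. *)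
Lemma edgeless_Bfree : free (Bfam (single B)) (edgeless (g - 1)).
Proof.
move=> K BK sK; move: BK; rewrite /Bfam gammaF_ballooning; have g0 : 0 < g.
  rewrite -cW /cost; have [[x y] oxy] := oe.
  have [->|[z zW]] := set_0Vmem W; last first.
    by have : 0 < #|W| by [apply/card_gt0P; exists z]; lia.
  by rewrite addn_gt0; apply/orP; right; apply/card_gt0P; exists (x, y); rewrite inE oxy !inE.
case: ifP => _; last first.
  move=> [M [S [dM cS ltS iK]]].
  have [j ji jh] := subgraph_trans (iso_subgraph (iso_sym iK)) sK.
  have iS : independent S.
    by move=> x y xS yS; apply/negP => a; have := jh (exist _ x xS) (exist _ y yS) a.
  have := gamma_decomposition dM (cover_bipartite iS cS); have := gamma_le iS cS; lia.
move=> iK; have [j ji _] := subgraph_trans (iso_subgraph (iso_sym iK)) sK.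
by have := leq_card j ji; rewrite !card_ord; lia.
Qed.

End Family.

Section Bfamily.
Variables (H B : graph) (f : H -> B) (c : H -> H -> seq B) (k : H -> bool).
Hypothesis fc : ballooning_by f c.
Hypothesis kH : two_coloring k.
Hypothesis oe : exists xy, xy \in oedges k.

(** Once [S] has been sent to [U], no edge inside the class [col] is left, since [S] covers [M]; the
    rest is properly coloured and is embedded greedily. *)
Lemma embed_Bfam (M G : graph) (S : {set M}) (C : bool -> {set G}) (e : nat) (U : {set G}) :
  (forall b y, y \in C b -> miss y (C (~~ b)) <= e) ->
  (forall b, #|B| * e.+1 <= #|C b|) ->
  (forall u b, u \in U -> miss u (C b) <= e) ->
  decomposition (single B) M -> vertex_cover S -> subgraph (induced S) (induced U) ->
  subgraph B G.
Proof.
move=> hC cC hU [/(decomposesP fc kH oe) [col [ph [pi cI ch]]] _] cS [j ji jh].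
have [[x0 y0] oxy] := oe; have [g0 _] : exists y, y \in C true.
  apply/card_gt0P; apply: leq_trans (cC true); rewrite muln_gt0 andbT.
  by apply/card_gt0P; exists (f x0).
pose g u : G := if ph u is Some x then (if insub x is Some y then val (j y) else g0) else g0.
pose D := [set u | col u && (if ph u is Some x then x \in S else false)].
have DP u : u \in D -> exists x (xS : x \in S), [/\ col u, ph u = Some x & g u = val (j (exist _ x xS))].
  rewrite inE /g; case eu: (ph u) => [x|]; rewrite ?andbF // => /andP [cu xS].
  by exists x, xS; rewrite insubT.
apply: (@greedy_embedding B G col C e hC cC D g).
- move=> u v /DP [x [xS [_ ux ->]]] /DP [y [yS [_ vy ->]]] /val_inj /ji [xy].
  by apply: pi ux _; rewrite vy xy.
- move=> u v /DP [x [xS [cu ux ->]]] /DP [y [yS [cv vy ->]]] a.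
  have [x' [y' []]] := ch _ _ a cu cv; rewrite ux vy => -[<-] [<-] axy.
  by have := jh (exist _ x xS) (exist _ y yS) axy.
- move=> u v uD vD a; have := cI _ _ a; case cu: (col u); case cv: (col v) => // _.
  have [x [y [ux vy axy]]] := ch _ _ a cu cv; have := cS _ _ axy.
  by move: uD vD; rewrite !inE cu cv ux vy /= => /negbTE -> /negbTE ->.
- move=> u v /DP [x [xS [_ _ ->]]] _ _; apply: hU; exact: valP.
Qed.

(** A converse to [embed_Bfam]: [U] and one class form a side whose complement is independent, and
    in a minimal decomposing subgraph the vertices sent to [U] form a cover. *)
Lemma Bfam_of_embedding (G : graph) (U : {set G}) (col : G -> bool) :
  (forall x y, x \notin U -> y \notin U -> adj x y -> col x != col y) ->
  subgraph B G -> exists (M : graph) (S : {set M}),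
    [/\ decomposition (single B) M, vertex_cover S, #|S| <= #|U| &
        subgraph (induced S) (induced U)].
Proof.
move=> hcol [j ji jh]; pose kk u := (j u \in U) || col (j u).
have [|N dN [i ii ih]] := minimal_decomposition (decomposes_core fc kH oe (col := kk) _).
  move=> u v /jh /hcol h; rewrite /kk.
  case: (boolP (j u \in U)) => // uU; case: (boolP (j v \in U)) => [_|vU]; first by rewrite orbT.
  by have := h uU vU; case: (col _); case: (col _).
have inC (v : induced (core kk)) : kk (val v) by have := valP v; rewrite inE => /andP [].
have si : injective (fun x => j (val (i x))) by move=> x y /ji /val_inj /ii.
exists N, [set x | j (val (i x)) \in U]; split=> //.
- move=> x y /ih a; rewrite !inE; apply/negPn/negP; rewrite negb_or => /andP [xU yU].
  have := hcol _ _ xU yU (jh _ _ a); have := inC (i x); have := inC (i y).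
  by rewrite /kk (negbTE xU) (negbTE yU) /= => -> ->.
- rewrite -(card_imset _ si); apply/subset_leq_card/subsetP => _ /imsetP [x + ->].
  by rewrite inE.
- apply: (induced_sub (j := fun x => j (val (i x)))) => // [x y /ih a|x]; last by rewrite inE.
  exact: jh.
Qed.

(** Put the defect of every cycle on its inner vertices 1 and 2, as in the gadget [InTrue]: the
    class then spans only these disjoint edges. The second label of a matched vertex is its
    partner. *)
Lemma matching_member : exists2 M, decomposition (single B) M & is_matching M.
Proof.
have [v0 _] : exists v : B, true.
  by have [[x y] _] := oe; exists (f x).
have [h hf hc] := balloon_slots k fc (true, v0) (fun x => (k x, f x))
  (fun x y i => (~~ odd i (+) (i < 2), if i == 1 then nth (f x) (c x y) 2 else nth (f x) (c x y) 1)).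
pose R v w := ((h v).1 || (h w).1) /\ ((h v).1 -> (h w).1 -> (h v).2 = w /\ (h w).2 = v).
have hR v w : adj v w -> R v w.
  apply: (balloon_adj_ind fc kH (R := R)) => {v w}.
  - by move=> v w [h1 h2]; split; [rewrite orbC | move=> a b; case: (h2 b a)].
  - by move=> x y /and3P [_ kx /negbTE ky]; rewrite /R !hf kx ky.
  - move=> x y o; case/and3P: (o) => a kx ky; have [l1 l2] := balloon_size fc a.
    by rewrite /R hf hc //=; [rewrite kx | lia].
  - move=> x y i o il; rewrite /R !hc ?(ltnW il) //=.
    by case: i il => [|[|i]] //= il; case: (odd i).
  - move=> x y o; case/and3P: (o) => a kx /negbTE ky; have [l1 l2] := balloon_size fc a.
    rewrite /R hf ky hc //=; last by lia.
    by case: (size _) l1 l2 => [|[|[|l]]] //= -> _.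
have [|N dN [j ji jh]] := minimal_decomposition (decomposes_core fc kH oe (col := fun v => (h v).1) _).
  by move=> u v /hR [].
exists N => // x; have [y axy] := decomposition_no_isolated fc kH oe x dN.
have inC (v : induced (core (fun v => (h v).1))) : (h (val v)).1.
  by have := valP v; rewrite inE => /andP [].
have uniq_nb (u v w : N) : adj u v -> adj u w -> v = w.
  move=> /jh auv /jh auw; have [_ /(_ (inC _) (inC _)) [e1 _]] := hR _ _ auv.
  have [_ /(_ (inC _) (inC _)) [e2 _]] := hR _ _ auw.
  by apply/ji/val_inj; rewrite -e1 -e2.
have comp : [set z | connect (@adj N) x z] = [set x; y].
  apply/setP => z; rewrite !inE; apply/idP/orP => [|[/eqP ->|/eqP ->]]; last 2 first.
  - exact: connect0.
  - exact: connect1.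
  move=> /connectP [p pp ->] {z}; elim/last_ind: p pp => [|p z IH]; first by left.
  rewrite rcons_path last_rcons => /andP [/IH []] /eqP -> a; [right | left].
    by rewrite (uniq_nb _ _ _ axy a).
  by rewrite adj_sym in axy; rewrite (uniq_nb _ _ _ axy a).
rewrite comp; have xy := adj_neq axy.
have cT : #|induced [set x; y]| = 2 by rewrite card_sig cards2 xy.
have e2 : #|induced [set x; y]| = #|complete 2| by rewrite cT card_ord.
exists (fun z => cast_ord cT (enum_rank z)).
  apply: inj_card_bij; last by rewrite e2.
  by move=> u v /cast_ord_inj/enum_rank_inj.
move=> u v; rewrite /complete /= /complete_rel (inj_eq (@cast_ord_inj _ _ _)) (inj_eq enum_rank_inj).
rewrite /induced_rel; have := valP u; have := valP v; rewrite !inE -val_eqE => /orP [] /eqP -> /orP [] /eqP ->;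
  rewrite ?eqxx ?adj_irr // ?axy // 1?adj_sym ?axy // eq_sym; rewrite ?xy //.
Qed.

End Bfamily.

(** * Matchings and the number of edges *)

Definition decide (P : Prop) : bool := if excluded_middle_informative P then true else false.

Lemma decideP (P : Prop) : reflect P (decide P).
Proof. by rewrite /decide; case: excluded_middle_informative => h; constructor. Qed.

Definition nbr (T : finType) (q : rel T) (x : T) : {set T} := [set y | q x y].

Definition arcn (T : finType) (q : rel T) : nat := \sum_x #|nbr q x|.

Lemma matching_id (T : finType) (q : rel T) : matching q id.
Proof. by move=> x; split=> //; rewrite eqxx. Qed.

Lemma cov_id (T : finType) : cov (@id T) = set0.
Proof. by apply/setP => x; rewrite !inE eqxx. Qed.

Lemma sub_matching (T : finType) (q q' : rel T) M :
  (forall x y, q x y -> q' x y) -> matching q M -> matching q' M.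
Proof. by move=> s hM x; have [h1 h2] := hM x; split=> // /h2 /s. Qed.

Section AddEdge.
Variables (T : finType) (q : rel T).
Hypothesis q_sym : symmetric q.
Hypothesis q_irr : irreflexive q.

Lemma q_neq x y : q x y -> x != y.
Proof. by apply: contraTneq => ->; rewrite q_irr. Qed.

Lemma add_edge (M : T -> T) x y : matching q M -> M x = x -> M y = y -> q x y ->
  exists2 M', matching q M' & cov M' = x |: (y |: cov M).
Proof.
move=> hM Mx My qxy; have xy := q_neq qxy.
have MK := matchingK hM.
exists (fun z => if z == x then y else if z == y then x else M z) => [z|].
  have [->|zx] := eqVneq z x.
    by rewrite eq_sym (negbTE xy) eqxx.
  have [->|zy] := eqVneq z y; first by rewrite eqxx q_sym.
  have Mzx : M z != x by apply: contraNneq zx => e; rewrite -[z]MK e Mx.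
  have Mzy : M z != y by apply: contraNneq zy => e; rewrite -[z]MK e My.
  by rewrite (negbTE Mzx) (negbTE Mzy).
apply/setP => z; rewrite !inE; have [->|zx] := eqVneq z x; first by rewrite eq_sym.
by have [->|zy] := eqVneq z y; first rewrite xy.
Qed.

Variable nu : nat.
Hypothesis hnu : forall M, matching q M -> #|cov M| <= nu.*2.

Definition maximal (M : T -> T) : Prop := matching q M /\ #|cov M| = nu.*2.

(** Distinct linked vertices are never missed together. The conclusion [u = v], instead of a
    contradiction, makes the relation reflexive and thus, after [linked_trans], an equivalence. *)
Definition linked (u v : T) : Prop :=
  forall M, maximal M -> M u = u -> M v = v -> u = v.

Lemma linked_sym u v : linked u v -> linked v u.
Proof. by move=> h M hM Mv Mu; rewrite (h M). Qed.

Lemma not_both_free M x y : maximal M -> q x y -> M x = x -> M y = y -> False.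
Proof.
move=> [hM cM] qxy Mx My; have [M' hM' cM'] := add_edge hM Mx My qxy.
have := hnu hM'; rewrite cM' cardsU1 cardsU1 !inE Mx My eqxx cM orbF (negbTE (q_neq qxy)) /=.
lia.
Qed.

Lemma linked_edge x y : q x y -> linked x y.
Proof. by move=> qxy M hM Mx My; case: (not_both_free hM qxy Mx My). Qed.

Hypothesis missable : forall v, exists2 M, maximal M & M v = v.

Definition agree (M N : T -> T) : {set T} := [set x | (M x == N x) && (M x != x)].

(* Gallai's lemma: if [u] and [v] were missed together by [M], then among the
   maximum matchings missing [t] the one agreeing most with [M] could be
   rotated to agree with [M] even more. *)
Lemma linked_trans t u v : linked u t -> linked t v -> linked u v.
Proof.
move=> ut tv M maxM Mu Mv; have [hM cM] := maxM; apply/eqP/negPn/negP => uv.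
have Mt : M t != t.
  apply/eqP => Mt; move/negP: uv; apply; apply/eqP.
  by rewrite (ut M maxM Mu Mt) (tv M maxM Mt Mv).
have MK := matchingK hM.
pose P m := decide (exists N, [/\ maximal N, N t = t & #|agree M N| = m]).
have exP : exists m, P m.
  by have [N mN Nt] := missable t; exists #|agree M N|; apply/decideP; exists N.
have ubP m : P m -> m <= #|T| by move=> /decideP [N [_ _ <-]]; apply: max_card.
case: (ex_maxnP exP ubP) => m /decideP [N [maxN Nt <-]] best.
have [hN cN] := maxN; have NK := matchingK hN.
have Nu : N u != u by apply: contraNneq Mt => Nu; rewrite -(ut N maxN Nu Nt) Mu.
have Nv : N v != v by apply: contraNneq Mt => Nv; rewrite (tv N maxN Nt Nv) Mv.
(* [u] and [v] are covered by [N] and missed by [M]. Both matchings have the same size, so at least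
   two vertices are covered by [M] only, and one of them differs from [t]. *)
have [x xM xt] : exists2 x, x \in cov M :\: cov N & x != t.
  have c2 : 2 <= #|cov M :\: cov N|.
    have e : #|cov M :\: cov N| = #|cov N :\: cov M|.
      by apply/eqP; rewrite -(eqn_add2l #|cov M :&: cov N|) cardsID {1}setIC cardsID cM cN.
    rewrite e (leq_trans _ (subset_leq_card (_ : [set u; v] \subset _))) ?cards2 ?uv //.
    by apply/subsetP => z; rewrite !inE => /orP [] /eqP ->; rewrite ?Mu ?Mv eqxx ?Nu ?Nv.
  have /card_gt0P [x] : 0 < #|(cov M :\: cov N) :\ t|.
    by have := cardsD1 t (cov M :\: cov N); case: (t \in _); lia.
  by rewrite in_setD1 => /andP [? ?]; exists x.
move: xM; rewrite !inE negbK => /andP [/eqP Nx Mx].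
pose y := M x; have qxy : q x y by apply: (matching_edge hM); rewrite inE.
have My : M y = x by rewrite /y MK.
have xy := q_neq qxy.
have Ny : N y != y by apply/eqP => Ny; apply: (not_both_free maxN qxy Nx Ny).
pose z := N y; have Nz : N z = y by rewrite /z NK.
have zx : z != x by apply: contraNneq xy => e; rewrite -Nx -e Nz.
have zy : z != y by [].
(* The edge [y z] of [N] is traded for the edge [x y] of [M]: the size is kept, [t] is still missed,
   and the agreement with [M] grows. *)
pose N' w := if w == x then y else if w == y then x else if w == z then z else N w.
have N'x : N' x = y by rewrite /N' eqxx.
have N'y : N' y = x by rewrite /N' eq_sym (negbTE xy) eqxx.
have N'z : N' z = z by rewrite /N' (negbTE zx) (negbTE zy) eqxx.
have N'w w : w != x -> w != y -> w != z -> N' w = N w.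
  by rewrite /N' => /negbTE -> /negbTE -> /negbTE ->.
have Nw w : w != x -> w != y -> w != z -> [/\ N w != x, N w != y & N w != z].
  move=> wx wy wz; split; apply/eqP => e.
  - by move/eqP: wx; apply; rewrite -[w]NK e Nx.
  - by move/eqP: wz; apply; rewrite -[w]NK e.
  - by move/eqP: wy; apply; rewrite -[w]NK e Nz.
have hN' : matching q N'.
  move=> w; have [->|wx] := eqVneq w x; first by rewrite N'x N'y.
  have [->|wy] := eqVneq w y; first by rewrite N'y N'x q_sym.
  have [->|wz] := eqVneq w z; first by rewrite !N'z eqxx.
  have [h1 h2 h3] := Nw _ wx wy wz.
  by rewrite N'w // N'w //; apply: hN.
have cN' : cov N' = x |: (cov N :\ z).
  apply/setP => w; rewrite !inE; have [->|wx] := eqVneq w x; first by rewrite N'x eq_sym.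
  have [->|wy] := eqVneq w y; first by rewrite N'y xy /= [y == z]eq_sym zy ?Ny.
  have [->|wz] := eqVneq w z; first by rewrite N'z eqxx.
  by rewrite N'w.
have maxN' : maximal N'.
  split=> //; rewrite cN' cardsU1 !inE Nx eqxx andbF /= add1n -cN [in RHS](cardsD1 z).
  by rewrite inE Nz eq_sym zy.
have N't : N' t = t.
  have ty : t != y by apply: contraNneq Ny => <-; rewrite Nt.
  have tz : t != z by apply: contraNneq zy => e; rewrite -Nz -e Nt.
  by rewrite N'w // eq_sym.
have /best : P #|agree M N'| by apply/decideP; exists N'.
rewrite leqNgt => /negP; apply; apply: proper_card; apply/properP; split.
  apply/subsetP => w; rewrite !inE => /andP [/eqP e Mw].
  have wx : w != x by apply: contraNneq Mw => ew; rewrite e ew Nx.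
  have wy : w != y.
    by apply: contraNneq zx => ew; rewrite /z -ew -e ew My.
  have wz : w != z.
    by apply: contraNneq zx => ew; rewrite -[z]MK -ew e ew Nz My.
  by rewrite N'w // e eqxx /= -e.
by exists x; rewrite !inE ?N'x ?eqxx //= Nx (negbTE Mx).
Qed.

(** Neighbours are linked, and a maximum matching misses at most one vertex of each class of
    [linked]. A class with [b + 1] vertices has at least [b] covered ones, and its degree sum is at
    most [(b + 1) * minn b d], hence at most [b * (d + 1)]. *)
Lemma sum_degrees_missable d : (forall x, #|nbr q x| <= d) ->
  arcn q <= nu.*2 * d.+1.
Proof.
move=> hd; case: (pickP T) => [v0 _|T0]; last first.
  by rewrite /arcn big_pred0.
have [M [hM cM] _] := missable v0.
pose lk u v := decide (linked u v).
have lkP u v : reflect (linked u v) (lk u v) by apply: decideP.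
have lks : symmetric lk by move=> u v; apply/lkP/lkP; apply: linked_sym.
have lkt : transitive lk by move=> t u v /lkP h1 /lkP h2; apply/lkP; apply: linked_trans h1 h2.
have lkr : reflexive lk by move=> u; apply/lkP.
pose rep u := odflt u [pick w | lk u w].
have repP u : lk u (rep u).
  by rewrite /rep; case: pickP => [w //|/(_ u)]; rewrite lkr.
have rep_eq u v : lk u v -> rep u = rep v.
  move=> uv; rewrite /rep.
  have e : lk u =1 lk v by move=> w; apply/idP/idP; apply: lkt; rewrite // lks.
  rewrite (eq_pick e); case: pickP => // /(_ v); by rewrite lkr.
rewrite /arcn (partition_big rep xpredT) //= -cM -sum1_card.
rewrite [X in _ <= X * _](partition_big rep xpredT) //= big_distrl /=.
apply: leq_sum => r _.
pose Cr := [set u | rep u == r].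
have deg u : u \in Cr -> #|nbr q u| <= #|Cr|.-1.
  move=> uC; rewrite [#|Cr|](cardsD1 u) uC /=; apply/subset_leq_card/subsetP => w.
  rewrite !inE => quw; rewrite eq_sym q_neq //= -(rep_eq u); first by move: uC; rewrite inE.
  by apply/lkP/linked_edge.
have -> : \sum_(i in cov M | rep i == r) 1 = #|cov M :&: Cr|.
  by rewrite -sum1_card; apply: eq_bigl => i; rewrite !inE.
have unc : #|Cr :\: cov M| <= 1.
  apply/card_le1P => u; rewrite !inE negbK => /andP [/eqP Mu /eqP ru] w.
  rewrite !inE negbK; apply/andP/eqP => [[/eqP Mw /eqP rw]|->]; last by rewrite Mu ru.
  have /lkP : lk w u.
    by apply: lkt (repP w) _; rewrite rw -ru lks repP.
  by apply; first split.
have cC := cardsID (cov M) Cr; rewrite [Cr :&: _]setIC in cC.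
have h1 : \sum_(u | rep u == r) #|nbr q u| <= #|Cr| * d.
  rewrite -sum_nat_const (eq_bigl (fun u => u \in Cr)) => [|u]; last by rewrite inE.
  by apply: leq_sum => u _; apply: hd.
have h2 : \sum_(u | rep u == r) #|nbr q u| <= #|Cr| * #|Cr|.-1.
  rewrite -sum_nat_const (eq_bigl (fun u => u \in Cr)) => [|u]; last by rewrite inE.
  by apply: leq_sum => u /deg.
move: (\sum_(u | _) _) #|Cr| #|cov M :&: Cr| #|Cr :\: cov M| cC unc h1 h2 => a b x y.
case: b => [|b] /=; first by case: a.
move=> e y1 h1 h2; have bx : b <= x by lia.
apply: leq_trans (_ : b * d.+1 <= _); last by rewrite leq_mul2r bx orbT.
by case: (leqP b d) => bd; nia.
Qed.

End AddEdge.

(* A weak form of the Chvatal-Hanson theorem. *)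
Lemma arcs_le_matching (T : finType) (q : rel T) nu d :
  symmetric q -> irreflexive q ->
  (forall M, matching q M -> #|cov M| <= nu.*2) ->
  (forall x, #|nbr q x| <= d) -> arcn q <= nu.*2 * d.+1.
Proof.
elim: nu q => [|nu IH] q qs qi hnu hd; last first.
  case: (classic (forall v, exists2 M, maximal q nu.+1 M & M v = v)) => [hv|nv].
    exact: (sum_degrees_missable qs qi hnu hv hd).
  (* Every maximum matching covers [v]: deleting [v] lowers the matching number and loses at most
     [2 * d] arcs. *)
  have [v hv] := not_all_ex_not _ _ nv.
  pose q' x y := [&& q x y, x != v & y != v].
  have sub x y : q' x y -> q x y by case/and3P.
  have h : arcn q' <= nu.*2 * d.+1.
    apply: IH => [x y|x|M hM|x].
    - by rewrite /q' qs; congr andb; rewrite andbC.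
    - by rewrite /q' qi.
    - have Mv : M v = v.
        by apply/eqP/negPn/negP => e; have := hM v => -[_ /(_ e)]; rewrite /q' eqxx /= andbF.
      have hM' := sub_matching sub hM; have := hnu _ hM'; rewrite (card_cov hM').
      rewrite !leq_double leq_eqVlt => /orP [/eqP e|//].
      by case: hv; exists M => //; split=> //; rewrite (card_cov hM') e.
    - by apply: leq_trans (hd x); apply/subset_leq_card/subsetP => y; rewrite !inE => /sub.
  have h2 : arcn q <= arcn q' + (d + d).
    rewrite /arcn (bigD1 v) //= [X in _ <= X + _](bigD1 v) //=.
    have : \sum_(i | i != v) #|nbr q i| <= \sum_(i | i != v) #|nbr q' i| + \sum_(i | i != v) (q v i : nat).
      rewrite -big_split /=; apply: leq_sum => u uv.
      rewrite (cardsD1 v) [v \in _]inE qs addnC leq_add2r.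
      by apply/subset_leq_card/subsetP => y; rewrite !inE /q' uv => /andP [-> ->].
    have : \sum_(i | i != v) (q v i : nat) <= #|nbr q v|.
      rewrite -sum1_card [X in _ <= X]big_mkcond /= [X in X <= _]big_mkcond /=.
      by apply: leq_sum => u _; rewrite inE; case: (u != v); case: (q v u).
    have := hd v; lia.
  apply: leq_trans h2 _; apply: leq_trans (leq_add h (leqnn _)) _; lia.
rewrite leqn0 sum_nat_eq0; apply/forallP => x; rewrite cards_eq0; apply/eqP/setP => y.
rewrite !inE; apply/negbTE/negP => qxy.
have [M' hM' cM'] := add_edge qs qi (matching_id q) (erefl x) (erefl y) qxy.
by have := hnu _ hM'; rewrite cM' cov_id leqn0 cards_eq0 => /eqP/setP/(_ x); rewrite !inE eqxx.
Qed.

Lemma max_matching (T : finType) (q : rel T) : exists M nu,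
  [/\ matching q M, #|cov M| = nu.*2 & forall M', matching q M' -> #|cov M'| <= nu.*2].
Proof.
pose P m := decide (exists2 M, matching q M & #|lower M| = m).
have exP : exists m, P m by exists #|lower (@id T)|; apply/decideP; exists id => //; apply: matching_id.
have ubP m : P m -> m <= #|T| by move=> /decideP [M _ <-]; apply: max_card.
case: (ex_maxnP exP ubP) => nu /decideP [M hM e] best; exists M, nu; split=> //.
  by rewrite (card_cov hM) e.
by move=> M' hM'; rewrite (card_cov hM') leq_double best //; apply/decideP; exists M'.
Qed.

Lemma arcn_eq0 (T : finType) (q : rel T) : arcn q = 0 -> forall x y, ~~ q x y.
Proof.
move=> /eqP; rewrite sum_nat_eq0 => /forallP h x y; apply/negP => qxy.
by have := h x; rewrite cards_eq0 => /eqP/setP/(_ y); rewrite !inE qxy.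
Qed.

Lemma arcn_gt0 (T : finType) (q : rel T) : 0 < arcn q -> exists x y, q x y.
Proof.
move=> h; apply: NNPP => no; move: h; rewrite /arcn big1 // => x _.
by apply/eqP; rewrite cards_eq0; apply/eqP/setP => y; rewrite !inE; apply/negbTE/negP => ?; apply: no; exists x, y.
Qed.

Lemma card_nbr (T : finType) (q : rel T) x : #|nbr q x| = \sum_y (q x y : nat).
Proof. by rewrite -sum1_card big_mkcond; apply: eq_bigr => y _; rewrite inE; case: (q x y). Qed.

(** The [bound] lemmas are the numeric ends of the cases in [split_star_bound]. There [d] and [df]
    are the largest degrees overall and on the second side, [nt] and [nf] the matching numbers of
    the sides, [sd] is the degree sum over a neighbourhood, [aL] counts the arcs inside it and [aw]
    those away from it; [mx], [my], [sm] and [Mi] refer to missing pairs. *)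
Lemma bound_degree1 D : D.*2 <= 2 * (D * D.-1 + 1).
Proof. by case: D => [|[|n]] //=; nia. Qed.

Lemma bound_small_degree D d : d.+1 < D -> D.*2 * d.+1 <= 2 * (D * D.-1 + 1).
Proof.
case: D => [|D] //= dD; apply: leq_trans (_ : D.+1.*2 * D <= _); last by lia.
by rewrite leq_mul2l; apply/orP; right; lia.
Qed.

Lemma bound_one_side d sd aL aw S :
  S + aL = 2 * sd + aw -> sd <= d * d -> aw <= 1.*2 * d.+1 -> S <= 2 * (d.+1 * d + 1).
Proof. lia. Qed.

Lemma bound_full D S mx my Mi : S <= D.*2 * D.+1 -> D < mx -> D < my ->
  2 * (mx + my) <= Mi + 2 -> S <= 2 * (D * D.-1 + 1) + Mi.
Proof. by case: D => [|D] /=; lia. Qed.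

Lemma bound_nearly_full d nt nf St Sf mx my Mi : 1 < d ->
  St <= nt.*2 * d.+1 -> Sf <= nf.*2 * d.+1 -> nt + nf <= d.+1 ->
  2 * d + nf.*2 <= d.+1.*2 + mx -> 2 * d + nt.*2 <= d.+1.*2 + my ->
  2 * mx <= Mi -> 2 * my <= Mi -> 2 * (mx + my) <= Mi + 2 ->
  St + Sf <= 2 * (d.+1 * d + 1) + Mi.
Proof.
move=> d1 h1 h2 h3 h4 h5 h6 h7 h8.
have s1 : St + Sf <= 2 * ((nt + nf) * d.+1) by lia.
apply: leq_trans s1 _; move: h3; rewrite leq_eqVlt => /orP [/eqP e|]; last first.
  rewrite ltnS => le; have : (nt + nf) * d.+1 <= d * d.+1 by rewrite leq_mul2r le orbT.
  lia.
rewrite e; lia.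
Qed.

Lemma bound_gap d nf df : df < d -> 0 < nf -> d + nf * df.+1 <= d * nf + df.+1.
Proof.
case: nf => // nf lt _; have : nf * df.+1 <= nf * d by rewrite leq_mul2l lt orbT.
lia.
Qed.

Lemma bound_star0 d nf df sd sm aL St Sf mx Mi : 0 < d ->
  St + aL = 2 * sd -> Sf <= nf.*2 * df.+1 -> sd + d * nf <= d * d + sm ->
  2 * (mx + sm) <= Mi -> df < mx -> d + nf * df.+1 <= d * nf + df.+1 ->
  St + Sf <= 2 * (d * d.-1 + 1) + Mi.
Proof. by case: d => // d _ /=; lia. Qed.

Lemma bound_star1 d nf df sd sm aL aw St Sf mx Mi : df < d -> 0 < nf ->
  St + aL = 2 * sd + aw -> Sf <= nf.*2 * df.+1 -> sd + d * nf <= d * d.+1 + sm ->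
  2 * (mx + sm) <= Mi -> aw <= 1.*2 * d.+1 -> aw = 0 \/ df < mx ->
  St + Sf <= 2 * (d.+1 * d + 1) + Mi.
Proof.
move=> lt nf0 h1 h2 h3 h4 h5 h6; have gap := bound_gap lt nf0.
have : nf * df.+1 <= nf * d by rewrite leq_mul2l lt orbT.
case: h6 => [e|h6]; rewrite ?e in h1; lia.
Qed.

(** * Edges inside the classes *)

Section SplitStar.
Variables (T : finType) (q mis : rel T) (s : T -> bool) (D : nat).
Hypothesis q_sym : symmetric q.
Hypothesis q_irr : irreflexive q.
Hypothesis q_side : forall x y, q x y -> s x = s y.
Hypothesis mis_sym : symmetric mis.
Hypothesis mis_side : forall x y, mis x y -> s x != s y.
Hypothesis no_matching : forall M, matching q M -> #|cov M| <= D.*2.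
(** A star [J] at [x] and a disjoint matching have at most [D] edges together, but a matching edge
    on the other side may be used only if at most one of its ends forms a missing pair with [x]. *)
Hypothesis no_star : forall x (J : {set T}) M,
  J \subset nbr q x -> matching q M -> x \notin cov M -> [disjoint J & cov M] ->
  (forall z, z \in cov M -> s z != s x -> ~~ (mis x z && mis x (M z))) ->
  2 * #|J| + #|cov M| <= D.*2.

Local Notation dg x := (#|nbr q x|).
Local Notation mi x := (#|nbr mis x|).

Lemma deg_le x : dg x <= D.
Proof.
have := @no_star x (nbr q x) id (subxx _) (@matching_id _ _).
rewrite cov_id cards0 inE => /(_ isT); rewrite disjoint_sym disjoints_subset sub0set => /(_ isT).
by move=> h; have := h (fun z => _); rewrite addn0 mul2n leq_double; apply => z; rewrite inE.
Qed.

Lemma nbr_disjoint x P : matching q P -> x \notin cov P ->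
  (forall z, z \in cov P -> s z != s x) -> [disjoint nbr q x & cov P].
Proof.
move=> hP xP h; apply/pred0P => z; apply/negbTE/negP => /andP [/=].
by rewrite inE => /q_side e /h; rewrite e eqxx.
Qed.

(** Remove from [P] the edges both of whose ends form missing pairs with [x]. The rest obeys
    [no_star], and the removed vertices are counted by the last term. *)
Lemma blocked x P : matching q P -> x \notin cov P -> [disjoint nbr q x & cov P] ->
  2 * dg x + #|cov P| <= D.*2 + #|nbr mis x :&: cov P|.
Proof.
move=> hP xP dP; have PK := matchingK hP.
pose bl z := [&& s z != s x, mis x z & mis x (P z)].
have blP z : z \in cov P -> bl (P z) = bl z.
  by move=> /(matching_edge hP)/q_side e; rewrite /bl -e PK [mis x (P z) && _]andbC.
pose P' z := if bl z then z else P z.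
have bE z : bl z -> P' z = z by rewrite /P' => ->.
have nE z : ~~ bl z -> P' z = P z by rewrite /P' => /negbTE ->.
have hP' : matching q P'.
  move=> z; case: (boolP (bl z)) => bz; first by rewrite !bE // eqxx.
  have [e|Pz] := eqVneq (P z) z; first by rewrite !(nE _ bz) e (nE _ bz) e eqxx.
  have zP : z \in cov P by rewrite inE.
  by rewrite (nE _ bz) nE ?blP // PK; split=> // _; apply: (matching_edge hP).
have cP' : cov P' = cov P :\: [set z | bl z].
  by apply/setP => z; rewrite !inE /P'; case: (bl z); rewrite ?eqxx.
have sub z : z \in cov P' -> z \in cov P by rewrite cP' inE => /andP [].
have h : 2 * dg x + #|cov P'| <= D.*2.
  apply: (no_star _ hP') => //.
  - by apply: contra xP; apply: sub.
  - apply: disjointWr dP; apply/subsetP; exact: sub.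
  - move=> z; rewrite cP' inE => /andP [nb zP] sz.
    have nbz : ~~ bl z by move: nb; rewrite inE.
    by rewrite nE //; move: nbz; rewrite /bl sz.
apply: leq_trans (leq_add h (leqnn _)); rewrite -addnA leq_add2l cP'.
rewrite -(cardsID [set z | bl z] (cov P)) addnC leq_add2l.
apply/subset_leq_card/subsetP => z; rewrite !inE => /andP [-> /and3P [_ -> _]] //.
Qed.

(** The star at [x] and [P] already reach the limit, so one usable edge of the other side in
    addition would violate [no_star]. *)
Lemma all_blocked x P : matching q P -> x \notin cov P -> [disjoint nbr q x & cov P] ->
  (forall z, z \in cov P -> s z = s x) -> D.*2 <= 2 * dg x + #|cov P| ->
  forall y z, q y z -> s y != s x -> mis x y.
Proof.
move=> hP xP dP sP full y z qyz sy; apply: contraT => nm.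
have out w : s w != s x -> P w = w.
  move=> sw; apply/eqP/negPn/negP => Pw; move/negP: sw; apply; apply/eqP/sP.
  by rewrite inE.
have sz : s z != s x by rewrite -(q_side qyz).
have [P' hP' cP'] := add_edge q_sym q_irr hP (out _ sy) (out _ sz) qyz.
have yP : y \notin cov P by rewrite inE negbK out.
have zP : z \notin cov P by rewrite inE negbK out.
have yz : y != z by apply: contraTneq qyz => ->; rewrite q_irr.
have h : 2 * dg x + #|cov P'| <= D.*2.
  apply: (no_star _ hP') => //.
  - rewrite cP' !in_setU1 !negb_or xP andbT; apply/andP; split.
      by apply: contraNneq sy => ->.
    by apply: contraNneq sz => ->.
  - apply/pred0P => w; apply/negbTE/negP => /= /andP [wx]; rewrite cP' !in_setU1.
    case/or3P => [/eqP e|/eqP e|]; last by rewrite (disjointFr dP wx).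
      by move: sy wx; rewrite inE e => sy /q_side e'; rewrite e' eqxx in sy.
    by move: sz wx; rewrite inE e => sz /q_side e'; rewrite e' eqxx in sz.
  - move=> w wP' sw; have : w \in [:: y; z].
      by move: wP'; rewrite cP' !inE out // eqxx orbF.
    rewrite !inE => /orP [] /eqP ->; first by rewrite (negbTE nm).
    apply/negP => /andP [_]; have : P' z \in [:: y; z].
      have : P' z \in cov P' by rewrite (cov_partner hP') cP' !inE eqxx orbT.
      rewrite cP' !inE out ?eqxx ?orbF //.
      have zP' : z \in cov P' by rewrite cP' !inE eqxx orbT.
      by rewrite -(q_side (matching_edge hP' zP')).
    have : P' z != z by have : z \in cov P' by [rewrite cP' !inE eqxx orbT]; rewrite inE.
    by move=> /negbTE e; rewrite !inE e orbF => /eqP ->; rewrite (negbTE nm).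
move: full h; rewrite cP' cardsU1 cardsU1 !inE (negbTE yz) /=.
by move: yP zP; rewrite !inE !negbK => -> ->; lia.
Qed.

Let Mi := arcn mis.

Lemma mis_irr x : mis x x = false.
Proof. by apply/negP => /mis_side; rewrite eqxx. Qed.

Lemma mis_sum_side b : 2 * (\sum_(z | s z == b) mi z) = Mi.
Proof.
suff e : \sum_(z | s z == b) mi z = \sum_(z | s z != b) mi z.
  by rewrite /Mi /arcn [RHS](bigID (fun z => s z == b)) /= -e mul2n addnn.
under eq_bigr do rewrite card_nbr.
rewrite exchange_big /= [LHS](bigID (fun z => s z == b)) /=.
rewrite big1 ?add0n => [|w /eqP sw].
  apply: eq_bigr => w /negbTE sw; rewrite card_nbr big_mkcond /=.
  apply: eq_bigr => z _; rewrite mis_sym; case: eqP => // sz.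
  case m : (mis w z) => //; have := mis_side m.
  by move: sw sz; case: (s w); case: (s z); case: b.
apply: big1 => z /eqP sz; case m : (mis z w) => //.
by have := mis_side m; rewrite sz sw eqxx.
Qed.

Lemma mis_side_le (A : {set T}) b : (forall z, z \in A -> s z = b) ->
  2 * (\sum_(z in A) mi z) <= Mi.
Proof.
move=> h; rewrite -(mis_sum_side b) leq_mul2l /= big_mkcond [X in _ <= X]big_mkcond.
by apply: leq_sum => z _; case: ifP => // /h ->; rewrite eqxx.
Qed.

(** The pair [x y] may itself be missing and is then counted at both vertices; this is the summand
    2. *)
Lemma mis_two x y : x != y -> 2 * (mi x + mi y) <= Mi + 2.
Proof.
move=> xy; rewrite /Mi /arcn (bigD1 x) //= (bigD1 y) 1?eq_sym //=.
have key z : z \in [:: x; y] ->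
    mi z <= (\sum_(w | (w != x) && (w != y)) (mis w z : nat)) + 1.
  rewrite !inE card_nbr (bigD1 x) //= (bigD1 y) 1?eq_sym //= => zz.
  rewrite (eq_bigr (fun w => mis w z : nat)) => [|w _]; last by rewrite mis_sym.
  rewrite addnA addnC leq_add2l.
  by case/orP: zz => /eqP ->; rewrite mis_irr; case: (mis _ _).
have h1 := key x (mem_head _ _); have h2 : mi y <= _ := key y _.
have {h2} := h2 (mem_last x [:: y]).
have h3 : \sum_(w | (w != x) && (w != y)) (mis w x : nat) + \sum_(w | (w != x) && (w != y)) (mis w y : nat)
    <= \sum_(w | (w != x) && (w != y)) mi w.
  rewrite -big_split /=; apply: leq_sum => w _.
  rewrite card_nbr (bigD1 x) //= (bigD1 y) 1?eq_sym //= addnA leq_addr //.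
move: h1 h3; lia.
Qed.

Lemma deg_le1_bound : (forall x, dg x <= 1) -> arcn q <= D.*2.
Proof.
move=> h; pose M u := odflt u [pick w | q u w].
have qM u w : q u w -> M u = w.
  move=> quw; rewrite /M; case: pickP => [v quv|/(_ w)]; last by rewrite quw.
  by have /card_le1_eqP := h u; apply; rewrite inE.
have hM : matching q M.
  move=> u; case: (pickP (q u)) => [w quw|nq].
    by rewrite (qM _ _ quw) (qM w u) // q_sym.
  have Mu : M u = u by rewrite /M; case: pickP => // w; rewrite nq.
  by rewrite !Mu eqxx.
apply: leq_trans (no_matching hM).
rewrite -sum1_card big_mkcond /=; apply: leq_sum => u _.
rewrite inE; have := h u; case: eqP => [e|_] /=; last by case: (dg u) => [|[]].
have [->|[w]] := set_0Vmem (nbr q u); first by rewrite cards0.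
by rewrite inE => quw; move: (qM _ _ quw) (quw); rewrite e => ->; rewrite q_irr.
Qed.

Definition side_rel b : rel T := fun x y => q x y && (s x == b).

Lemma side_rel_sym b : symmetric (side_rel b).
Proof.
move=> x y; rewrite /side_rel q_sym; case e: (q y x) => //=.
by rewrite (q_side e).
Qed.

Lemma side_rel_irr b : irreflexive (side_rel b).
Proof. by move=> x; rewrite /side_rel q_irr. Qed.

Lemma arcn_sides : arcn q = arcn (side_rel true) + arcn (side_rel false).
Proof.
rewrite /arcn -big_split; apply: eq_bigr => x _ /=.
rewrite !card_nbr -big_split; apply: eq_bigr => y _ /=.
by rewrite /side_rel; case: (q x y); case: (s x).
Qed.

Lemma arcn_side b : arcn q = arcn (side_rel b) + arcn (side_rel (~~ b)).
Proof. by rewrite arcn_sides; case: b => //=; rewrite addnC. Qed.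

Lemma side_nbr b x : s x = b -> nbr (side_rel b) x = nbr q x.
Proof. by move=> sx; apply/setP => y; rewrite !inE /side_rel sx eqxx andbT. Qed.

Definition away x : rel T :=
  fun u v => [&& q u v, s u == s x, u \notin nbr q x & v \notin nbr q x].

(** The degree sum over the neighbourhood counts the arcs leaving its vertices and, reversed, those
    entering them; arcs inside are counted twice. All other arcs on the side are [away]. *)
Lemma star_arcs x :
  arcn (side_rel (s x)) + \sum_(u in nbr q x) #|nbr q u :&: nbr q x|
  = 2 * (\sum_(u in nbr q x) dg u) + arcn (away x).
Proof.
set L := nbr q x; have sL u : u \in L -> s u = s x by rewrite inE => /q_side ->.
have -> : arcn (away x) = \sum_(u | u \notin L) #|nbr (away x) u|.
  rewrite /arcn (bigID (fun u => u \in L)) /= big1 // => u uL.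
  apply/eqP; rewrite cards_eq0; apply/eqP/setP => v.
  by rewrite inE /away uL !andbF inE.
rewrite /arcn (bigID (fun u => u \in L)) /=.
have -> : \sum_(u in L) #|nbr (side_rel (s x)) u| = \sum_(u in L) dg u.
  by apply: eq_bigr => u uL; rewrite side_nbr // sL.
have -> : \sum_(u | u \notin L) #|nbr (side_rel (s x)) u| =
    \sum_(u | u \notin L) #|nbr q u :&: L| + \sum_(u | u \notin L) #|nbr (away x) u|.
  rewrite -big_split; apply: eq_bigr => u uL /=.
  rewrite -(cardsID L); congr addn; apply: eq_card => v; rewrite !inE /side_rel /away.
    case quv: (q u v) => //=; case vL: (q x v); rewrite ?andbF //= andbT.
    by rewrite (q_side quv) (q_side vL) eqxx.
  by rewrite -/L uL /= andbC; case: (q u v); rewrite ?andbF //= inE.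
have -> : \sum_(u | u \notin L) #|nbr q u :&: L| = \sum_(u in L) #|nbr q u :\: L|.
  transitivity (\sum_(u | u \notin L) \sum_(v in L) (q u v : nat)).
    apply: eq_bigr => u _; rewrite -sum1_card big_mkcond [RHS]big_mkcond /=.
    by apply: eq_bigr => v _; rewrite in_setI inE; case: (q u v); case: (v \in L).
  rewrite exchange_big; apply: eq_bigr => v _ /=.
  rewrite -sum1_card big_mkcond [RHS]big_mkcond /=.
  by apply: eq_bigr => u _; rewrite in_setD [u \in nbr q v]inE (q_sym u v); case: (q v u); case: (u \in L).
have : \sum_(u in L) #|nbr q u :&: L| + \sum_(u in L) #|nbr q u :\: L| = \sum_(u in L) dg u.
  by rewrite -big_split; apply: eq_bigr => u _ /=; rewrite cardsID.
lia.
Qed.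

Lemma away_bound x M : matching (away x) M -> #|cov M| <= (D - dg x).*2.
Proof.
move=> hM; have hq : matching q M by apply: sub_matching hM => u v /and4P [].
have aw z : z \in cov M -> [/\ q z (M z), s z = s x & z \notin nbr q x].
  by move=> /(matching_edge hM) /and4P [? /eqP ? ? _].
have := @no_star x (nbr q x) M (subxx _) hq.
have xM : x \notin cov M.
  by apply/negP => xM; have /and4P [h _ _] := matching_edge hM xM; rewrite inE h.
have dM : [disjoint nbr q x & cov M].
  by apply/pred0P => z; apply/negbTE/negP => /= /andP [zx /aw [_ _]]; rewrite zx.
move=> /(_ xM dM) h; have : 2 * dg x + #|cov M| <= D.*2.
  by apply: h => z /aw [_ -> _]; rewrite eqxx.
have := deg_le x; lia.
Qed.

Lemma away_sym x : symmetric (away x).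
Proof.
move=> u v; rewrite /away (q_sym u v); case e: (q v u) => //=.
by rewrite (q_side e) [X in _ && X]andbC.
Qed.

Lemma away_irr x : irreflexive (away x).
Proof. by move=> u; rewrite /away q_irr. Qed.

Lemma away_arcs x d : (forall z, dg z <= d) -> arcn (away x) <= (D - dg x).*2 * d.+1.
Proof.
move=> hd; apply: arcs_le_matching (@away_sym x) (@away_irr x) (@away_bound x) _ => z.
apply: leq_trans (hd z); apply/subset_leq_card/subsetP => v.
by rewrite !inE => /and4P [].
Qed.

Lemma active_deg b y : s y = b -> 0 < dg y -> dg y < #|[set w | (s w == b) && (0 < dg w)]|.
Proof.
move=> sy dy; have -> : (dg y).+1 = #|y |: nbr q y| by rewrite cardsU1 inE q_irr.
apply/subset_leq_card/subsetP => w; rewrite !inE => /orP [/eqP ->|qyw].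
  by rewrite sy eqxx.
rewrite -(q_side qyw) sy eqxx /=; apply/card_gt0P; exists y.
by rewrite inE q_sym.
Qed.

(** By [all_blocked], every non-isolated vertex of the other side forms a missing pair with [x];
    already [y] and its neighbours are more than [dg y] such vertices. *)
Lemma blocked_active x P y : matching q P -> x \notin cov P -> [disjoint nbr q x & cov P] ->
  (forall z, z \in cov P -> s z = s x) -> D.*2 <= 2 * dg x + #|cov P| ->
  s y != s x -> 0 < dg y -> dg y < mi x.
Proof.
move=> hP xP dP sP full sy dy; apply: leq_trans (active_deg (erefl (s y)) dy) _.
apply/subset_leq_card/subsetP => w; rewrite !inE => /andP [/eqP sw /card_gt0P [z]].
by rewrite inE => qwz; apply: (all_blocked hP xP dP sP full qwz); rewrite sw.
Qed.

Lemma full_active x y : dg x = D -> s y != s x -> 0 < dg y -> dg y < mi x.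
Proof.
move=> dx; apply: (@blocked_active x id); first exact: matching_id.
- by rewrite cov_id inE.
- by rewrite cov_id disjoint_sym disjoints_subset sub0set.
- by move=> z; rewrite cov_id inE.
- by rewrite cov_id cards0 dx addn0 mul2n.
Qed.

Lemma other_side_block z b M nu : s z = b -> matching (side_rel (~~ b)) M -> #|cov M| = nu.*2 ->
  2 * dg z + nu.*2 <= D.*2 + mi z.
Proof.
move=> sz hM cM; have hq : matching q M by apply: sub_matching hM => u v /andP [].
have sM w : w \in cov M -> s w != s z.
  by move=> /(matching_edge hM) /andP [_ /eqP ->]; rewrite sz; case: (b).
have zM : z \notin cov M by apply/negP => /sM; rewrite eqxx.
have := blocked hq zM (nbr_disjoint hq zM sM); rewrite cM => h; apply: leq_trans h _.
by rewrite leq_add2l; apply/subset_leq_card/subsetIl.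
Qed.

Lemma two_sides_matching b M M' nu nu' :
  matching (side_rel b) M -> matching (side_rel (~~ b)) M' ->
  #|cov M| = nu.*2 -> #|cov M'| = nu'.*2 -> nu + nu' <= D.
Proof.
move=> hM hM' cM cM'; pose N z := if s z == b then M z else M' z.
have sM z : z \in cov M -> s z = b by move=> /(matching_edge hM) /andP [_ /eqP].
have sM' z : z \in cov M' -> s z = ~~ b by move=> /(matching_edge hM') /andP [_ /eqP].
have side z : s (N z) = s z.
  rewrite /N; case: (eqVneq (s z) b) => sz.
    have [->//|Mz] := eqVneq (M z) z; by rewrite sz; apply: sM; rewrite (cov_partner hM) inE.
  have [->//|Mz] := eqVneq (M' z) z.
  by rewrite [RHS]sM' ?inE //; apply: sM'; rewrite (cov_partner hM') inE.
have hN : matching q N.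
  move=> z; rewrite {1}/N side; rewrite /N; case: (eqVneq (s z) b) => sz.
    by have [h1 h2] := hM z; split=> // /h2 /andP [].
  by have [h1 h2] := hM' z; split=> // /h2 /andP [].
have cN : cov N = cov M :|: cov M'.
  apply/setP => z; rewrite in_setU inE /N; case: (eqVneq (s z) b) => sz.
    have -> : (z \in cov M') = false by apply/negP => /sM'; rewrite sz; case: (b).
    by rewrite inE orbF.
  have -> : (z \in cov M) = false by apply/negP => /sM /eqP; rewrite (negbTE sz).
  by rewrite inE.
have := no_matching hN; rewrite cN cardsU cM cM'.
rewrite (_ : cov M :&: cov M' = set0) ?cards0; first lia.
apply/setP => z; rewrite in_setI in_set0; apply/negbTE/negP => /andP [/sM h1 /sM'].
by rewrite h1; case: (b).
Qed.

(** If [y] has degree [D], every edge has an end in the neighbourhood of [y], since otherwise it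
    would complete the star to [D + 1] edges. The excess provides enough such vertices in [L] to
    make [L] independent, and the neighbourhood of one of them serves as [R]. *)
Lemma bipartite_alternative x b : s x = b -> dg x = D -> 1 < D -> arcn (side_rel (~~ b)) = 0 ->
  2 * (D * D.-1 + 1) < arcn q ->
  exists (L R : {set T}) (b : bool),
    [/\ #|L| = D, #|R| = D, [disjoint L & R], forall z, (z \in L) || (z \in R) -> s z = b /\ exists w, q z w &
      forall u v, q u v -> (u \in L) && (v \in R) || (u \in R) && (v \in L)].
Proof.
move=> sx dx D2 S0 big; set L := nbr q x in dx *.
have allb u v : q u v -> s u = b.
  move=> quv; have := arcn_eq0 S0 u v; rewrite /side_rel quv /=.
  by case: (s u) => //; case: (b).
have touch y u v : dg y = D -> q u v -> (u \in nbr q y) || (v \in nbr q y).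
  move=> dy quv; apply: contraT; rewrite negb_or => /andP [un vn].
  have [P hP] := add_edge q_sym q_irr (matching_id q) (erefl u) (erefl v) quv.
  rewrite cov_id setU0 => cP; have uv := q_neq q_irr quv.
  have yu : y != u by apply: contraNneq vn => ->; rewrite inE.
  have yv : y != v by apply: contraNneq un => ->; rewrite inE q_sym.
  have sy : s y = b.
    have /card_gt0P [w] : 0 < dg y by rewrite dy; lia.
    by rewrite inE => /allb.
  have := @no_star y (nbr q y) P (subxx _) hP; rewrite cP !inE negb_or yu yv => /(_ isT) h.
  have : 2 * dg y + #|[set u; v]| <= D.*2.
    apply: h.
      apply/pred0P => w; apply/negbTE/negP => /= /andP [wy]; rewrite !inE => /orP [] /eqP e.
        by move: un; rewrite -e wy.
      by move: vn; rewrite -e wy.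
    move=> z; rewrite !inE sy => /orP [] /eqP ->; first by rewrite (allb _ _ quv) eqxx.
    by rewrite -(q_side quv) (allb _ _ quv) eqxx.
  by rewrite cards2 uv dy addn2 mul2n => /ltnW; rewrite ltnn.
have aw0 : arcn (away x) = 0.
  apply/eqP; rewrite -leqn0; apply: leq_trans (@away_arcs x D deg_le) _.
  by rewrite dx subnn.
have := star_arcs x; rewrite aw0 addn0 -/L; rewrite (arcn_side b) S0 addn0 -sx in big.
set aL := \sum_(u in L) #|_ :&: L| => eS.
pose F := [set z in L | dg z == D].
have sumF : \sum_(u in L) dg u + (D - #|F|) <= D * D.
  have -> : D * D = \sum_(u in L) D by rewrite sum_nat_const dx.
  have -> : D - #|F| = \sum_(u in L) (dg u != D : nat).
    have FL : F \subset L by apply/subsetP => z; rewrite inE => /andP [].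
    have cF : #|F| + #|L :\: F| = D by rewrite -dx -(cardsID F L) (setIidPr FL).
    rewrite -[in LHS]cF addKn -sum1_card big_mkcond [RHS]big_mkcond /=; apply: eq_bigr => z _.
    by rewrite in_setD inE; case: (z \in L); case: (dg z == D).
  rewrite -big_split; apply: leq_sum => z _ /=.
  by have := deg_le z; case: eqP => /=; lia.
have FL : #|F| <= D by rewrite -dx; apply/subset_leq_card/subsetP => z; rewrite inE => /andP [].
(* Each vertex of [L] outside [F] loses at least one in the degree sum, so the excess bounds the
   arcs inside [L]. *)
have aLF : aL + 3 <= 2 * #|F|.
  have e1 : D * D.-1 + D = D * D by case: (D) D2 => // n _; rewrite mulnS addnC.
  lia.
(* Every vertex of [F] is adjacent to [z] or [z'], which yields at least [2 * #|F| - 2] arcs inside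
   [L], too many for [aLF]. *)
have noL z z' : z \in L -> z' \in L -> q z z' -> False.
  move=> zL zL' qzz; have zz := q_neq q_irr qzz.
  have h1 : #|F :|: [set z; z']| <= #|nbr q z :&: L| + #|nbr q z' :&: L|.
    apply: leq_trans (_ : #|(nbr q z :&: L) :|: (nbr q z' :&: L)| <= _); last exact: leq_card_setU.
    apply/subset_leq_card/subsetP => w; rewrite -setIUl in_setI in_setU.
    case/orP => [|].
      rewrite inE => /andP [wL /eqP dw]; rewrite wL andbT.
      by have := touch w z z' dw qzz; rewrite !inE ![q w _]q_sym.
    rewrite !in_set2 => /orP [] /eqP ->; rewrite ?zL ?zL' andbT in_setU !inE ?qzz //.
    by rewrite q_sym qzz orbT.
  have h2 : #|F :\: [set z; z']| <= \sum_(w in L | (w != z) && (w != z')) #|nbr q w :&: L|.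
    rewrite -sum1_card big_mkcond [X in _ <= X]big_mkcond /=; apply: leq_sum => w _.
    rewrite in_setD in_set2 negb_or; case: (boolP (w \in F)); rewrite ?andbF //.
    rewrite inE andbT => /andP [wL /eqP dw]; rewrite wL /=; case: ifP => // _.
    apply/card_gt0P; case/orP: (touch w z z' dw qzz) => h; [exists z | exists z'];
      by rewrite in_setI h ?zL ?zL'.
  have h3 : aL = #|nbr q z :&: L| + (#|nbr q z' :&: L| +
      \sum_(w in L | (w != z) && (w != z')) #|nbr q w :&: L|).
    rewrite /aL (bigD1 z) //= (bigD1 z') /= ?zL' 1?eq_sym //; congr (_ + (_ + _)).
    by apply: eq_bigl => w; rewrite andbA.
  have := cardsUI F [set z; z']; have := cardsID [set z; z'] F.
  have : #|F :&: [set z; z']| <= 2 by rewrite (leq_trans (subset_leq_card (subsetIr _ _))) // cards2 zz.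
  have c2 : #|[set z; z']| = 2 by rewrite cards2 zz.
  lia.
have /card_gt0P [y] : 0 < #|F| by lia.
rewrite inE => /andP [yL /eqP dy].
have dLR : [disjoint L & nbr q y].
  apply/pred0P => w; apply/negbTE/negP => /= /andP [wL]; rewrite inE => qyw.
  exact: noL yL wL qyw.
exists L, (nbr q y), b; split=> //.
- by move=> z; rewrite !inE => /orP [] h; split; [| exists x | | exists y];
  rewrite 1?q_sym // -(q_side h) // (allb _ _ h).
- move=> u v quv; case uL: (u \in L) => /=.
    have := touch y u v dy quv; rewrite (disjointFr dLR uL) /= => ->; by [].
  have := touch x u v dx quv; rewrite -/L uL /= => vL.
  have := touch y u v dy quv; rewrite (disjointFr dLR vL) orbF => ->; by rewrite vL.
Qed.

(** The weak Chvatal-Hanson bound leaves only the maximum degrees [D - 1] and [D]. If both sides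
    carry edges, those of one side would complete the stars of the other unless pairs are missing,
    and these pairs pay for the edges. The exception arises with edges on one side only. *)
Theorem split_star_bound :
  arcn q <= 2 * (D * D.-1 + 1) + arcn mis \/
  exists (L R : {set T}) (b : bool),
    [/\ #|L| = D, #|R| = D, [disjoint L & R], forall z, (z \in L) || (z \in R) -> s z = b /\ exists w, q z w &
      forall u v, q u v -> (u \in L) && (v \in R) || (u \in R) && (v \in L)].
Proof.
case: (leqP (arcn q) (2 * (D * D.-1 + 1) + arcn mis)) => big; [by left | right].
have [x0 [y0 qxy0]] : exists x y, q x y by apply: arcn_gt0; lia.
have [x _ dmax] := arg_maxnP (fun z => dg z) (erefl (predT x0)).
have {}dmax z : dg z <= dg x by apply: dmax.
have d2 : 1 < dg x.
  rewrite ltnNge; apply/negP => d1; have := @deg_le1_bound (fun z => leq_trans (dmax z) d1).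
  by move: big; have := bound_degree1 D; lia.
have dD := deg_le x; set d := dg x in dmax d2 dD.
have VL : arcn q <= D.*2 * d.+1 by apply: arcs_le_matching.
have dD1 : D <= d.+1.
  rewrite leqNgt; apply/negP => /bound_small_degree h.
  by have := leq_ltn_trans (leq_trans VL h) (leq_ltn_trans (leq_addr _ _) big); rewrite ltnn.
have nbig X : arcn q <= X -> X <= 2 * (D * D.-1 + 1) + arcn mis -> False.
  by move=> h1 h2; have := leq_ltn_trans (leq_trans h1 h2) big; rewrite ltnn.
pose b := s x; have sx : s x = b by [].
have [Mt [nt [hMt cMt mMt]]] := max_matching (side_rel b).
have [Mf [nf [hMf cMf mMf]]] := max_matching (side_rel (~~ b)).
have ntf := two_sides_matching hMt hMf cMt cMf.
have nside b' z : #|nbr (side_rel b') z| <= dg z.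
  by apply/subset_leq_card/subsetP => v; rewrite !inE => /andP [].
have VLt : arcn (side_rel b) <= nt.*2 * d.+1.
  apply: arcs_le_matching (@side_rel_sym b) (@side_rel_irr b) mMt _ => z.
  exact: leq_trans (nside _ _) (dmax z).
pose df := \max_(y | s y == ~~ b) dg y.
have dfP y : s y = ~~ b -> dg y <= df by move=> sy; apply: (leq_bigmax_cond y); rewrite sy.
have VLf : arcn (side_rel (~~ b)) <= nf.*2 * df.+1.
  apply: arcs_le_matching (@side_rel_sym (~~ b)) (@side_rel_irr (~~ b)) mMf _ => z.
  case: (eqVneq (s z) (~~ b)) => sz; first by rewrite (side_nbr sz) dfP.
  rewrite (_ : nbr _ z = set0) ?cards0 //; apply/setP => v.
  by rewrite !inE /side_rel (negbTE sz) andbF.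
have eqS := arcn_side b.
have starS := star_arcs x; rewrite sx in starS.
have awS : arcn (away x) <= (D - d).*2 * d.+1 by apply: away_arcs.
case: (posnP (arcn (side_rel (~~ b)))) => [S0|Spos].
  have sumd : \sum_(u in nbr q x) dg u <= d * d.
    by rewrite -sum_nat_const; apply: leq_sum => z _; apply: dmax.
  move: dD1; rewrite leq_eqVlt => /orP [/eqP De|]; last first.
    rewrite ltnS => Dd; have De : d = D by lia.
    apply: (bipartite_alternative sx) => //; [lia | lia].
  exfalso; rewrite De subSnn in awS.
  apply: (nbig _ (leqnn _)); rewrite eqS S0 addn0 De /=.
  exact: leq_trans (bound_one_side starS sumd awS) (leq_addr _ _).
exfalso.
have nf0 : 0 < nf by case: (nf) VLf => //; lia.
have [y sy dy] : exists2 y, s y = ~~ b & dg y = df.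
  have [u [v]] := arcn_gt0 Spos; rewrite /side_rel => /andP [_ su].
  have : 0 < #|[pred y | s y == ~~ b]| by apply/card_gt0P; exists u.
  move/(eq_bigmax_cond (fun y => dg y)) => [y /eqP sy e]; by exists y.
have dfd : df <= d by rewrite -dy.
have df0 : 0 < df.
  have [u [v]] := arcn_gt0 Spos; rewrite /side_rel => /andP [quv /eqP su].
  by apply: leq_trans (dfP _ su); apply/card_gt0P; exists v; rewrite inE.
have yx : s y != s x by rewrite sy sx; case: (b).
have xy : s x != s y by rewrite eq_sym.
have xny : x != y by apply: contraNneq xy => ->.
have mi2 := mis_two xny.
(* If both sides reach the maximum degree, missing pairs are forced at [x] and at [y], and the two
   families share at most one pair. *)
move: dfd; rewrite leq_eqVlt => /orP [/eqP dfd|dfd].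
  move: dD1; rewrite leq_eqVlt => /orP [/eqP De|]; last first.
    rewrite ltnS => Dd; have De : d = D by lia.
    have m1 : d < mi x by have := full_active De yx; rewrite dy dfd; apply; lia.
    have m2 : d < mi y by have := @full_active y x; apply; rewrite ?dy ?dfd //; lia.
    rewrite De in VL m1 m2.
    exact: nbig _ (leqnn _) (bound_full VL m1 m2 mi2).
  have m1 := other_side_block sx hMf cMf; rewrite -/d in m1.
  have m2 : 2 * dg y + nt.*2 <= D.*2 + mi y.
    by apply: (@other_side_block y (~~ b) Mt nt) => //; rewrite negbK.
  have m3 := @mis_side_le [set x] b; have m4 := @mis_side_le [set y] (~~ b).
  rewrite !big_set1 in m3 m4.
  have {}m3 : 2 * mi x <= Mi by apply: m3 => z; rewrite inE => /eqP ->.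
  have {}m4 : 2 * mi y <= Mi by apply: m4 => z; rewrite inE => /eqP ->.
  rewrite dfd in VLf; rewrite dy dfd in m2; rewrite De in m1 m2 ntf.
  apply: (nbig _ (leqnn _)); rewrite eqS De /=.
  exact: bound_nearly_full d2 VLt VLf ntf m1 m2 m3 m4 mi2.
(* If the second side has smaller degrees, its matching limits the degree of every neighbour [u] of
   [x], up to pairs missing at [u]. *)
have key : \sum_(u in nbr q x) dg u + d * nf <= d * D + \sum_(u in nbr q x) mi u.
  have -> : d * nf = \sum_(u in nbr q x) nf by rewrite sum_nat_const.
  have -> : d * D = \sum_(u in nbr q x) D by rewrite sum_nat_const.
  rewrite -!big_split; apply: leq_sum => u; rewrite inE => qxu /=.
  have su : s u = b by rewrite -(q_side qxu).
  have := other_side_block su hMf cMf; lia.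
have miL : 2 * (mi x + \sum_(u in nbr q x) mi u) <= Mi.
  have := @mis_side_le (x |: nbr q x) b; rewrite big_setU1 /= ?inE ?q_irr //; apply.
  by move=> z; rewrite !inE => /orP [/eqP -> //|/q_side <-].
have gap := bound_gap dfd nf0.
move: dD1; rewrite leq_eqVlt => /orP [/eqP De|]; last first.
  rewrite ltnS => Dd; have De : d = D by apply/eqP; rewrite eqn_leq dD.
  have m1 : df < mi x by have := full_active De yx; rewrite dy; apply.
  have aw0 : arcn (away x) = 0.
    by apply/eqP; rewrite -leqn0; apply: leq_trans awS _; rewrite De subnn.
  rewrite aw0 addn0 in starS; apply: (nbig _ (leqnn _)); rewrite eqS -De in key *.
  exact: bound_star0 (ltnW d2) starS VLf key miL m1 gap.
rewrite De subSnn in awS; rewrite De in key.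
suff aw : arcn (away x) = 0 \/ df < mi x.
  apply: (nbig _ (leqnn _)); rewrite eqS De /=.
  exact: bound_star1 dfd nf0 starS VLf key miL awS aw.
case: (posnP (arcn (away x))) => [aw0|awpos]; [by left | right].
have [u [v auv]] := arcn_gt0 awpos; have /and4P [quv /eqP su ux vx] := auv.
have [P hP] := add_edge q_sym q_irr (matching_id q) (erefl u) (erefl v) quv.
rewrite cov_id setU0 => cP.
rewrite -dy; apply: (blocked_active hP) => //.
- rewrite cP !inE negb_or; apply/andP; split; apply/eqP => e.
    by move: vx; rewrite inE e quv.
  by move: ux; rewrite inE e q_sym quv.
- rewrite cP; apply/pred0P => w; apply/negbTE/negP => /= /andP [wx]; rewrite !inE => /orP [] /eqP e.
    by move: ux; rewrite -e wx.
  by move: vx; rewrite -e wx.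
- by move=> z; rewrite cP !inE => /orP [] /eqP ->; rewrite // -(q_side quv).
- by rewrite cP cards2 (q_neq q_irr quv) -/d De addn2 mul2n.
- by rewrite dy.
Qed.

End SplitStar.

(** * Counting and common neighbourhoods *)

Section Counting.
Variable G : graph.
Implicit Types X Y Z : {set G}.

Lemma card_nbhI (x : G) Y : #|nbh x :&: Y| = \sum_(y in Y) (adj x y : nat).
Proof.
rewrite -sum1_card big_mkcond [RHS]big_mkcond; apply: eq_bigr => y _.
by rewrite in_setI in_nbh; case: (adj x y); case: (y \in Y).
Qed.

Lemma arcsC X Y : arcs X Y = arcs Y X.
Proof.
rewrite /arcs; under eq_bigr do rewrite card_nbhI.
rewrite exchange_big; apply: eq_bigr => y _ /=.
by rewrite card_nbhI; apply: eq_bigr => x _; rewrite adj_sym.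
Qed.

Lemma pattern_pigeonhole X Y : exists2 P : {set G}, P \subset X &
  #|Y| <= 2 ^ #|X| * #|[set y in Y | nbh y :&: X == P]|.
Proof.
have [Y0|Y0] := posnP #|Y|.
  by exists set0; [exact: sub0set | rewrite Y0].
apply: NNPP => no.
have h P : P \in powerset X -> 2 ^ #|X| * #|[set y in Y | nbh y :&: X == P]| <= #|Y|.-1.
  rewrite powersetE => PX; rewrite -ltnS (ltn_predK Y0) ltnNge; apply/negP => le.
  by apply: no; exists P.
have : \sum_(P in powerset X) 2 ^ #|X| * #|[set y in Y | nbh y :&: X == P]| <=
       \sum_(P in powerset X) #|Y|.-1 by apply: leq_sum.
rewrite -big_distrr sum_nat_const card_powerset /= leq_pmul2l ?expn_gt0 //.
have -> : \sum_(P in powerset X) #|[set y in Y | nbh y :&: X == P]| = #|Y|.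
  rewrite -sum1_card (partition_big (fun y => nbh y :&: X) (fun P => P \in powerset X)) /=.
    by apply: eq_bigr => P _; rewrite -sum1_card; apply: eq_bigl => y; rewrite inE.
  by move=> y _; rewrite powersetE subsetIr.
by case: #|Y| Y0 => // m _; rewrite ltnn.
Qed.

(** Restrict [X] to [2 * a * t] vertices. By averaging, at least [n / (2 * a)] vertices of [Z] are
    adjacent to [t] or more of them, and a pigeonhole on traces finds many with a common set. *)
Lemma common_neighbours a t n X Z : 0 < a -> 0 < t -> 2 * a * t <= #|X| -> #|Z| <= n ->
  (forall x, x \in X -> n <= a * #|nbh x :&: Z|) ->
  exists P : {set G}, [/\ P \subset X, #|P| = t &
    n <= 2 * a * 2 ^ (2 * a * t) * #|[set z in Z | P \subset nbh z]|].
Proof.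
move=> a0 t0 cX0 cZ hX0.
have [X' sX cX] := subset_of_card cX0.
have hX x : x \in X' -> n <= a * #|nbh x :&: Z| by move=> xX; apply/hX0/(subsetP sX).
pose Y := [set z in Z | t <= #|nbh z :&: X'|].
have cY : n <= 2 * a * #|Y|.
  have h1 : #|X'| * n <= a * arcs X' Z.
    rewrite /arcs big_distrr -sum_nat_const; apply: leq_sum => x /hX //.
  have h2 : arcs X' Z <= #|X'| * #|Y| + t * n.
    rewrite arcsC /arcs (bigID (fun z => z \in Y)) /=; apply: leq_add.
      rewrite mulnC -sum_nat_const big_mkcond [X in _ <= X]big_mkcond.
      apply: leq_sum => z _; case: (boolP (z \in Y)); rewrite ?andbF //.
      rewrite andbT; case: ifP => // _ _; exact: subset_leq_card (subsetIr _ _).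
    apply: leq_trans (_ : \sum_(z in Z) t <= _); last first.
      by rewrite sum_nat_const mulnC leq_mul2l cZ orbT.
    rewrite big_mkcond [X in _ <= X]big_mkcond; apply: leq_sum => z _.
    by case: (boolP (z \in Z)) => // zZ; rewrite inE zZ /= -ltnNge; case: ifP => // /ltnW.
  rewrite cX in h1 h2; have {h1 h2} : 2 * a * t * n <= a * (2 * a * t * #|Y| + t * n).
    by apply: leq_trans h1 _; rewrite leq_mul2l h2 orbT.
  rewrite (_ : 2 * a * t * n = (a * t) * (n + n)); last by lia.
  rewrite (_ : a * (2 * a * t * #|Y| + t * n) = (a * t) * (2 * a * #|Y| + n)); last by lia.
  by rewrite leq_pmul2l ?muln_gt0 ?a0 // leq_add2r.
have [P PX cP] := pattern_pigeonhole X' Y.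
have [Y0|Ypos] := posnP #|Y|.
  have [P' sP' cP'] : exists2 P' : {set G}, P' \subset X' & #|P'| = t.
    by apply: subset_of_card; rewrite cX; nia.
  by exists P'; split=> //; [exact: subset_trans sX | rewrite Y0 in cY; lia].
have tP : t <= #|P|.
  have : 0 < #|[set y in Y | nbh y :&: X' == P]|.
    by rewrite lt0n; apply/eqP => e; move: cP; rewrite e muln0; lia.
  by case/card_gt0P => y; rewrite !inE => /andP [/andP [_ h]] /eqP <-.
have [P' sP' cP'] := subset_of_card tP.
exists P'; split=> //; first exact: subset_trans sP' (subset_trans PX sX).
apply: leq_trans cY _; rewrite -[X in _ <= X]mulnA leq_mul2l.
apply/orP; right; apply: leq_trans cP _; rewrite cX leq_mul2l.
apply/orP; right; apply/subset_leq_card/subsetP => y; rewrite !inE => /andP [/andP [-> _] /eqP e] /=.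
by apply: subset_trans sP' _; rewrite -e subsetIl.
Qed.

End Counting.

(** The last colour class goes to [A], the other two are embedded greedily. *)
Lemma embed_triple (B G : graph) (A : {set G}) (C : bool -> {set G}) e :
  colorable B 3 ->
  (forall b y, y \in C b -> miss y (C (~~ b)) <= e) ->
  (forall b, #|B| * e.+1 <= #|C b|) -> #|B| <= #|A| ->
  (forall x b, x \in A -> C b \subset nbh x) -> subgraph B G.
Proof.
move=> [h hh] hC cC cA hA.
have [B0|B0] := posnP #|B|.
  have none (v : B) : False by move: (card0_eq B0 v); rewrite inE.
  by exists (fun v : B => False_rect G (none v)) => v; case: (none v).
have /card_gt0P [g0 _] : 0 < #|A| by apply: leq_trans cA.
pose D := [set v | h v == ord_max].
have cD : #|D| <= #|A| by apply: leq_trans cA; apply: max_card.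
have [g gi gA] := inj_of_card g0 cD.
apply: (@greedy_embedding B G (fun v => h v == ord0) C e hC cC D g) => //.
- by move=> u v; rewrite !inE => /eqP hu /eqP hv /hh; rewrite hu hv eqxx.
- move=> u v; rewrite !inE => hu hv /hh; move: hu hv.
  by case: (h u) (h v) => [[|[|[|?]]] ?] [[|[|[|?]]] ?].
- move=> u v uD _ _; rewrite /miss (_ : _ :\: _ = set0) ?cards0 //.
  by apply/eqP; rewrite setD_eq0 hA // gA.
Qed.

(** Gives the size condition of [greedy_embedding] for [e = n %/ K]: a class with a fraction [1 / M]
    of the vertices suffices once [K] is large. *)
Lemma divn_bound n K M N x : 0 < M -> n <= M * x -> 2 * N * M <= K -> 2 * N * M <= n ->
  N * (n %/ K).+1 <= x.
Proof.
move=> M0 h1 h2 h3; have h4 : K * (n %/ K) <= n by rewrite mulnC leq_divM.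
have h5 : 2 * N * M * (n %/ K) <= n by apply: leq_trans h4; rewrite leq_mul2r h2 orbT.
rewrite -(leq_pmul2l M0) -(leq_pmul2l (isT : 0 < 2)); apply: leq_trans (_ : n + n <= _); last lia.
by rewrite mulnS; lia.
Qed.

Definition three_parts (G : graph) (U : {set G}) (V : bool -> {set G}) : Prop :=
  [/\ forall b, [disjoint U & V b], [disjoint V true & V false] &
      forall x, x \notin U -> (x \in V true) || (x \in V false)].

Definition inner (G : graph) (U : {set G}) (V : bool -> {set G}) : rel G :=
  fun x y => [&& x \notin U, y \notin U, adj x y & (x \in V true) == (y \in V true)].

Section Parts.
Variables (G : graph) (U : {set G}) (V : bool -> {set G}).
Hypothesis parts : three_parts U V.

Lemma parts_class x : x \notin U -> x \in V (x \in V true).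
Proof. by case: parts => _ _ h /h; case: (boolP (x \in V true)). Qed.

Lemma parts_notU b x : x \in V b -> x \notin U.
Proof. by case: parts => h _ _ xV; apply/negP => xU; have := disjointFr (h b) xU; rewrite xV. Qed.

Lemma parts_notV b x : x \in V b -> x \in V (~~ b) = false.
Proof. by case: parts => _ h _; case: b => /= xV; [rewrite (disjointFr h xV) | rewrite (disjointFl h xV)]. Qed.

Lemma parts_side b x : x \in V b -> (x \in V true) = b.
Proof. by case: b => //; apply: (@parts_notV false). Qed.

Lemma parts_sum (F : G -> nat) :
  \sum_x F x = \sum_(x in U) F x + \sum_(x in V true) F x + \sum_(x in V false) F x.
Proof.
rewrite [\sum_(x in U) _]big_mkcond [\sum_(x in V true) _]big_mkcond [\sum_(x in V false) _]big_mkcond.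
rewrite -!big_split /=; apply: eq_bigr => x _.
case: (boolP (x \in U)) => xU.
  have n b : x \in V b = false by case: parts => h _ _; rewrite (disjointFr (h b) xU).
  by rewrite !n !addn0.
have := parts_class xU; case: (boolP (x \in V true)) => [xV _|xV ->] //.
by rewrite (@parts_notV true) // addn0.
Qed.

Lemma parts_card (X : {set G}) : #|X| = #|X :&: U| + #|X :&: V true| + #|X :&: V false|.
Proof.
have := parts_sum (fun x => x \in X : nat).
have h (A : {set G}) : \sum_(x in A) (x \in X : nat) = #|X :&: A|.
  rewrite -sum1_card big_mkcond [RHS]big_mkcond; apply: eq_bigr => x _.
  by rewrite in_setI; case: (x \in X); case: (x \in A).
rewrite !h => <-; rewrite -sum1_card big_mkcond; apply: eq_bigr => x _.
by case: (x \in X).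
Qed.

Lemma inner_sym : symmetric (inner U V).
Proof.
by move=> x y; rewrite /inner adj_sym eq_sym; case: (x \notin U); case: (y \notin U).
Qed.

Lemma inner_irr : irreflexive (inner U V).
Proof. by move=> x; rewrite /inner adj_irr !andbF. Qed.

Lemma nbr_inner b x : x \in V b -> nbr (inner U V) x = nbh x :&: V b.
Proof.
move=> xV; apply/setP => y; rewrite !inE /inner (parts_notU xV) (parts_side xV) /=.
case: (boolP (y \in U)) => yU /=.
  by case: parts => h _ _; rewrite (disjointFr (h b) yU) andbF.
congr andb; have := parts_class yU; case: (b) => /=; first by rewrite eq_sym eqb_id.
case: (boolP (y \in V true)) => [/(@parts_notV true) //|_ ->] //.
Qed.

Lemma arcn_inner : arcn (inner U V) = arcs (V true) (V true) + arcs (V false) (V false).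
Proof.
rewrite /arcn parts_sum big1 ?add0n => [|x xU].
  by congr addn; apply: eq_bigr => x xV; rewrite (nbr_inner xV).
apply/eqP; rewrite cards_eq0; apply/eqP/setP => y; by rewrite !inE /inner xU.
Qed.

Lemma parts_degree_sum : \sum_(x : G) #|nbh x| =
  arcs U U + 2 * (arcs U (V true) + arcs U (V false)) + 2 * arcs (V true) (V false) + arcn (inner U V).
Proof.
have h (A : {set G}) : \sum_(x in A) #|nbh x| = arcs A U + arcs A (V true) + arcs A (V false).
  by rewrite /arcs -!big_split; apply: eq_bigr => x _ /=; rewrite parts_card.
rewrite parts_sum !h arcn_inner (arcsC (V true) U) (arcsC (V false) U) (arcsC (V false) (V true)).
lia.
Qed.

End Parts.

Lemma arcs_miss (G : graph) (X Y : {set G}) :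
  arcs X Y + \sum_(x in X) miss x Y = #|X| * #|Y|.
Proof.
rewrite /arcs -big_split -sum_nat_const; apply: eq_bigr => x _ /=.
by rewrite setIC /miss cardsID.
Qed.

Lemma arcs_le (G : graph) (X Y : {set G}) : arcs X Y <= #|X| * #|Y|.
Proof. by rewrite -(arcs_miss X Y) leq_addr. Qed.

Lemma arcn_touching (T : finType) (q : rel T) (S : {set T}) :
  symmetric q -> (forall x y, q x y -> (x \in S) || (y \in S)) ->
  arcn q <= 2 * \sum_(x in S) #|nbr q x|.
Proof.
move=> qs h; have cn x : #|nbr q x| = \sum_y (q x y : nat).
  by rewrite -sum1_card big_mkcond; apply: eq_bigr => y _; rewrite inE; case: (q x y).
have e : \sum_x \sum_(y in S) (q x y : nat) = \sum_(x in S) #|nbr q x|.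
  by rewrite exchange_big; apply: eq_bigr => y _ /=; rewrite cn; apply: eq_bigr => x _; rewrite qs.
rewrite mul2n -addnn -{1}e /arcn [\sum_(x in S) _]big_mkcond -big_split /=.
apply: leq_sum => x _; case: (boolP (x \in S)) => xS; first exact: leq_addl.
rewrite addn0 cn [X in _ <= X]big_mkcond; apply: leq_sum => y _.
case: ifP => // yS; case qxy: (q x y) => //; have := h _ _ qxy.
by rewrite (negbTE xS) yS.
Qed.

(** * The structure of extremal graphs *)

Section NearBipartite.
Variables (B : graph) (c0 N : nat).
Hypothesis B3 : colorable B 3.
Hypothesis cB : #|B| <= N.
Hypothesis B0 : 0 < N.

Lemma big_bipartite t : 0 < t -> exists n1, forall n (G : graph), n1 <= n -> #|G| = n ->
  (forall x : G, n <= 2 * #|nbh x| + c0) ->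
  exists P : bool -> {set G}, [/\ #|P true| = t, #|P false| = t &
    forall x y, x \in P true -> y \in P false -> adj x y].
Proof.
move=> t0; pose q := 2 * 4 * 2 ^ (2 * 4 * t); exists (2 * c0 + 2 * 4 * t + q * t) => n G ln cG dG.
have [||||X [_ cX hX]] := @common_neighbours G 4 t n [set: G] [set: G] _ t0.
- by [].
- by rewrite cardsT cG; lia.
- by rewrite cardsT cG.
- by move=> x _; rewrite setIT; have := dG x; lia.
have [|Y sY cY] := @subset_of_card G [set z in [set: G] | X \subset nbh z] t.
  rewrite -(leq_pmul2l (_ : 0 < q)); last by rewrite !muln_gt0 expn_gt0.
  by apply: leq_trans hX; lia.
exists (fun b => if b then X else Y); split=> // x y xX /(subsetP sY).
by rewrite !inE /= => /subsetP/(_ x xX); rewrite inE adj_sym.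
Qed.

Section Classify.
Variables (n t kap : nat) (G : graph) (P : bool -> {set G}).
Hypothesis cG : #|G| = n.
Hypothesis noB : ~ subgraph B G.
Hypothesis dG : forall x : G, n <= 2 * #|nbh x| + c0.
Hypothesis cP : forall b, #|P b| = t.
Hypothesis hP : forall x y, x \in P true -> y \in P false -> adj x y.
Hypothesis t_big : t = 2 * kap.+1 * N * N + N.

Let a b (x : G) := #|nbh x :&: P b|.

Lemma complete_pair b x y : x \in P b -> y \in P (~~ b) -> adj x y.
Proof. by case: b => /= h1 h2; [apply: hP | rewrite adj_sym; apply: hP]. Qed.

Lemma a_le b x : a b x <= t.
Proof. by rewrite -(cP b) subset_leq_card ?subsetIr. Qed.

Let D0 := [set x | [forall b, N <= a b x]].

(** Otherwise more than [N] of these vertices share their trace on the complete pair, and together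
    with this trace they contain a complete tripartite graph with large parts. *)
Lemma few_both : #|D0| <= 2 ^ (2 * t) * N.
Proof.
pose X := P true :|: P false.
have cX : #|X| <= 2 * t by apply: leq_trans (leq_card_setU _ _) _; rewrite !cP; lia.
have [Q QX cQ] := pattern_pigeonhole X D0.
apply: leq_trans cQ _; apply: leq_mul; first by rewrite leq_exp2l.
rewrite leqNgt; apply/negP => big; apply: noB.
set A := [set y in D0 | nbh y :&: X == Q] in big.
have AQ x : x \in A -> nbh x :&: X = Q by rewrite inE => /andP [_ /eqP].
have sub b : P b \subset X by case: b; rewrite /X ?subsetUl ?subsetUr.
have /card_gt0P [x0 x0A] : 0 < #|A| by lia.
apply: (@embed_triple B G A (fun b => Q :&: P b) 0 B3); last 2 first.
- exact: leq_trans cB (ltnW big).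
- move=> x b xA; rewrite -(AQ _ xA); apply: subset_trans (subsetIl _ _) (subsetIl _ _).
- move=> b y; rewrite inE => /andP [_ yP]; rewrite leqn0 cards_eq0; apply/eqP/setP => z.
  rewrite !inE; apply/negbTE; rewrite negb_and negbK.
  case: (boolP (z \in P (~~ b))) => [zP|_]; last by rewrite andbF orbT.
  by rewrite (complete_pair yP zP).
- move=> b; rewrite muln1; apply: leq_trans cB _; move: x0A; rewrite inE => /andP [+ /eqP <-].
  rewrite inE => /forallP/(_ b); rewrite /a -setIA.
  by rewrite (setIidPr (sub b)).
Qed.

Let bad := [set x in ~: D0 | a true x + a false x + kap * N < t].

Lemma degree_count : t * (n - c0) <= \sum_x (a true x + a false x).
Proof.
have h b : \sum_x a b x = \sum_(x in P b) #|nbh x|.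
  have := arcsC [set: G] (P b); rewrite /arcs => e.
  transitivity (\sum_(x in [set: G]) #|nbh x :&: P b|); first by apply: eq_bigl => x; rewrite inE.
  by rewrite e; apply: eq_bigr => x _; rewrite setIT.
have h2 b : t * (n - c0) <= 2 * \sum_(x in P b) #|nbh x|.
  rewrite -(cP b) -sum_nat_const big_distrr; apply: leq_sum => x _ /=.
  by have := dG x; lia.
by rewrite big_split /= !h; have := h2 true; have := h2 false; lia.
Qed.

(** A vertex outside [D0] sees at most [t + N] vertices of the pair, while the minimum degree gives
    about [t * n] arcs from the pair; few vertices can fall short of [t - kap * N]. *)
Lemma few_bad : #|bad| * (kap.+1 * N) <= n * N + 2 * t * #|D0| + t * c0.
Proof.
have h : \sum_x (a true x + a false x) + #|bad| * (kap.+1 * N) <= 2 * t * #|D0| + n * (t + N).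
  have -> : #|bad| * (kap.+1 * N) = \sum_(x in bad) kap.+1 * N by rewrite sum_nat_const.
  have -> : 2 * t * #|D0| = \sum_(x in D0) 2 * t by rewrite sum_nat_const mulnC.
  have -> : n * (t + N) = \sum_(x : G) (t + N) by rewrite sum_nat_const cG.
  rewrite [\sum_(i in bad) _]big_mkcond [\sum_(i in D0) _]big_mkcond -!big_split /=.
  apply: leq_sum => x _; have h1 := a_le true x; have h2 := a_le false x.
  have h3 := mulSn kap N.
  case: (boolP (x \in D0)) => xD.
    rewrite (_ : x \in bad = false); last by rewrite inE in_setC xD.
    lia.
  case: (boolP (x \in bad)) => xb.
    by move: xb; rewrite inE => /andP [_]; lia.
  move: xD; rewrite inE => /forallPn [b]; rewrite -ltnNge; case: (b); lia.
have := degree_count; have := leq_mul2l t n (n - c0 + c0); move: h.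
have -> : n * (t + N) = t * n + n * N by lia.
have : t * n <= t * (n - c0) + t * c0 by rewrite -mulnDr leq_mul2l; lia.
lia.
Qed.

Let V b := [set x in ~: (D0 :|: bad) | a b x < N].

Lemma V_other b x : x \in V b -> t <= a (~~ b) x + kap.+1 * N.
Proof.
rewrite !inE negb_or => /andP [/andP [nD nb] ab].
move: nb; rewrite nD /= -leqNgt mulSn; case: b ab => /=; lia.
Qed.

Lemma sides_disjoint : [disjoint V true & V false].
Proof.
apply/pred0P => x; apply/negbTE/negP => /= /andP [xt xf].
have := V_other xt; move: xf; rewrite inE => /andP [_] /=; have := t_big; nia.
Qed.

Lemma V_cover : ~: (V true :|: V false) \subset D0 :|: bad.
Proof.
apply/subsetP => x; rewrite in_setC => h; apply: contraT => nx.
have nD : x \notin D0 by apply: contra nx => xD; rewrite in_setU xD.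
have inV b : a b x < N -> x \in V b by move=> ab; rewrite inE in_setC nx.
move: nD; rewrite inE => /forallPn [b]; rewrite -ltnNge => /inV xV; move: h.
by rewrite in_setU; case: b xV => ->; rewrite ?orbT.
Qed.

(** Otherwise [common_neighbours] yields a complete pair [Q], [R] inside [V b]; both see almost all
    of [P (~~ b)], which provides a third part. *)
Lemma few_dense K b : 0 < K -> 2 * K * 2 ^ (2 * K * N) * N <= n ->
  #|[set x in V b | n <= K * #|nbh x :&: V b|]| < 2 * K * N.
Proof.
move=> K0 nb; rewrite ltnNge; apply/negP => big; apply: noB.
have [||Q [sQ cQ hQ]] := @common_neighbours G K N n _ (V b) K0 B0 big.
- by rewrite -cG max_card.
- by move=> x; rewrite inE => /andP [].
have [|R sR cR] := @subset_of_card G [set z in V b | Q \subset nbh z] N.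
  rewrite -(leq_pmul2l (_ : 0 < 2 * K * 2 ^ (2 * K * N))).
    exact: leq_trans hQ.
  by rewrite !muln_gt0 K0 expn_gt0.
have QV x : x \in Q -> x \in V b by move=> /(subsetP sQ); rewrite inE => /andP [].
have RV x : x \in R -> x \in V b by move=> /(subsetP sR); rewrite inE => /andP [].
have QR x y : x \in Q -> y \in R -> adj x y.
  by move=> xQ /(subsetP sR); rewrite !inE => /andP [_ /subsetP/(_ x xQ)]; rewrite inE adj_sym.
pose A := P (~~ b) :\: \bigcup_(x in Q :|: R) (P (~~ b) :\: nbh x).
have Aadj x y : x \in Q :|: R -> y \in A -> adj x y.
  move=> xQR; rewrite inE => /andP [h yP]; apply: contraNT h => nxy.
  by apply/bigcupP; exists x => //; rewrite !inE nxy.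
apply: (@embed_triple B G A (fun c => if c then Q else R) 0 B3).
- move=> c y yc; rewrite leqn0 cards_eq0; apply/eqP/setP => z.
  rewrite !inE; apply/negbTE; rewrite negb_and negbK.
  case: c yc => /= yc; case: (boolP (z \in _)) => h; rewrite ?orbT //.
    by rewrite (QR y z).
  by rewrite adj_sym (QR z y).
- by move=> c; rewrite muln1; apply: leq_trans cB _; case: c; rewrite ?cQ ?cR.
- apply: leq_trans cB _.
  have h1 : #|\bigcup_(x in Q :|: R) (P (~~ b) :\: nbh x)| <= \sum_(x in Q :|: R) kap.+1 * N.
    apply: leq_trans (_ : _ <= \sum_(x in Q :|: R) #|P (~~ b) :\: nbh x|) _.
      elim/big_rec2: _ => [|u E F _ EF]; first by rewrite cards0.
      by apply: leq_trans (leq_card_setU _ _) _; rewrite leq_add2l.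
    apply: leq_sum => x xQR; have xV : x \in V b.
      by move: xQR; rewrite inE => /orP [/QV|/RV].
    have := V_other xV; have := cardsID (nbh x) (P (~~ b)); rewrite cP /a setIC; lia.
  rewrite sum_nat_const in h1.
  have h2 : #|Q :|: R| <= N + N by apply: leq_trans (leq_card_setU _ _) _; rewrite cQ cR.
  have h3 : #|Q :|: R| * (kap.+1 * N) <= (N + N) * (kap.+1 * N) by rewrite leq_mul2r h2 orbT.
  have e3 : (N + N) * (kap.+1 * N) = 2 * kap.+1 * N * N by lia.
  have := cardsID (\bigcup_(x in Q :|: R) (P (~~ b) :\: nbh x)) (P (~~ b)); rewrite cP -/A.
  have := subset_leq_card (subsetIr (P (~~ b)) (\bigcup_(x in Q :|: R) (P (~~ b) :\: nbh x))).
  lia.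
- move=> x c xA; apply/subsetP => y yc; rewrite inE adj_sym; apply: Aadj => //.
  by rewrite inE; case: c yc => ->; rewrite ?orbT.
Qed.

End Classify.

Theorem near_bipartite K : 0 < K -> exists n1, forall n (G : graph), n1 <= n -> #|G| = n ->
  ~ subgraph B G -> (forall x : G, n <= 2 * #|nbh x| + c0) ->
  exists W : bool -> {set G}, [/\ [disjoint W true & W false],
    K * #|~: (W true :|: W false)| <= n &
    forall b y, y \in W b -> K * #|nbh y :&: W b| <= n].
Proof.
(* [t] is such that [2 * N] vertices, each missing at most [kap.+1 * N] vertices of one side of the
   complete pair, keep [N] common neighbours there; [kap] brings [bad] down to about
   [n / (4 * K)]. *)
move=> K0; pose kap := 4 * K; pose t := 2 * kap.+1 * N * N + N.
have [|n0 hn0] := @big_bipartite t; first by rewrite /t addn_gt0 B0 orbT.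
pose d := 2 ^ (2 * t) * N.
pose c1 := 2 * t * d + t * c0.
exists (n0 + 2 * K * 2 ^ (2 * K * N) * N + 4 * (K * d + 4 * K * K * N + c1)) => n G ln cG noB dG.
have [|P [cPt cPf hP]] := hn0 n G _ cG dG; first by lia.
have cP b : #|P b| = t by case: b.
pose a b (x : G) := #|nbh x :&: P b|.
pose D0 := [set x | [forall b, N <= a b x]].
pose bad := [set x in ~: D0 | a true x + a false x + kap * N < t].
pose V b := [set x in ~: (D0 :|: bad) | a b x < N].
pose X b := [set x in V b | n <= K * #|nbh x :&: V b|].
have h1 : #|D0| <= d :=
  few_both cG noB cP hP (erefl t).
have h2 : #|bad| * (kap.+1 * N) <= n * N + 2 * t * #|D0| + t * c0 :=
  few_bad cG dG cP (erefl t).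
have h3 b : #|X b| < 2 * K * N.
  have hn : 2 * K * 2 ^ (2 * K * N) * N <= n by lia.
  exact: (@few_dense n t kap G P cG noB cP (erefl t) K b K0 hn).
have h4 : [disjoint V true & V false] :=
  sides_disjoint P cG (erefl t).
exists (fun b => V b :\: X b); split.
- by apply: disjointW h4; apply: subsetDl.
- have sub : ~: (V true :\: X true :|: (V false :\: X false)) \subset
      (D0 :|: bad) :|: (X true :|: X false).
    apply/subsetP => x; rewrite in_setC in_setU !in_setD => h.
    rewrite [x \in (_ :|: _) :|: _]in_setU; case: (boolP (x \in D0 :|: bad)) => //= nx.
    rewrite in_setU.
    have : x \in V true :|: V false.
      apply: contraT => nv; move/negP: nx; case; apply: (subsetP (V_cover t kap P)).
      by rewrite in_setC.
    move: h; rewrite !in_setU; case: (x \in X true); case: (x \in X false) => //=.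
    by case: (x \in V true); case: (x \in V false).
  have h5 : #|~: (V true :\: X true :|: (V false :\: X false))| <= d + #|bad| + 4 * K * N.
    apply: leq_trans (subset_leq_card sub) _.
    apply: leq_trans (leq_card_setU _ _) _; apply: leq_add.
      by apply: leq_trans (leq_card_setU _ _) _; rewrite leq_add2r.
    by apply: leq_trans (leq_card_setU _ _) _; have := h3 true; have := h3 false; lia.
  apply: leq_trans (leq_mul (leqnn K) h5) _.
  have h6 : #|bad| * kap.+1 <= n + c1.
    rewrite -(leq_pmul2r B0) -mulnA; apply: leq_trans h2 _; rewrite mulnDl -addnA leq_add2l.
    have : 2 * t * #|D0| <= 2 * t * d by rewrite leq_mul2l h1 orbT.
    have : c1 <= c1 * N by rewrite leq_pmulr.
    rewrite /c1; lia.
  have h7 : 4 * (K * #|bad|) <= n + c1 by apply: leq_trans h6; rewrite /kap; lia.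
  have -> : K * (d + #|bad| + 4 * K * N) = K * d + K * #|bad| + 4 * K * K * N by lia.
  lia.
- move=> b y; rewrite in_setD => /andP [yX yV]; move: yX; rewrite inE yV /= -ltnNge => lt.
  apply: leq_trans (ltnW lt); rewrite leq_mul2l; apply/orP; right.
  by apply/subset_leq_card/setIS/subsetDl.
Qed.

End NearBipartite.

(* [C] are the classes of a nearly complete bipartite graph; [s] tells in which
   class the edge at a vertex matched by [M] lies. *)
Definition matching_embeds (B : graph) (m : nat) : Prop :=
  forall (G : graph) (C : bool -> {set G}) e (s : G -> bool) (M : G -> G),
  (forall b y, y \in C b -> miss y (C (~~ b)) <= e) ->
  (forall b, #|B| * e.+1 <= #|C b|) ->
  matching (fun x y => adj x y && (s x == s y)) M ->
  (forall x, x \in cov M -> miss x (C (~~ s x)) <= e) ->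
  2 * m <= #|cov M| -> subgraph B G.

(** Besides [U], a vertex [d] is nearly complete to [C false] and has many neighbours that behave
    like members of [C true]. Through [frequent_bound] this limits the number of mixed vertices. *)
Definition center_embeds (B : graph) (g : nat) : Prop :=
  forall (G : graph) (C : bool -> {set G}) e (U : {set G}) (d : G) (L : {set G}),
  (forall b y, y \in C b -> miss y (C (~~ b)) <= e) ->
  (forall b, #|B| * e.+1 <= #|C b|) ->
  #|U| = g -> (forall u b, u \in U -> miss u (C b) <= e) ->
  d \notin U -> miss d (C false) <= e ->
  L \subset nbh d -> [disjoint L & U] -> (forall z, z \in L -> miss z (C false) <= e) ->
  #|B| <= #|L| -> subgraph B G.

Lemma miss_sub (G : graph) (x : G) (X Y : {set G}) : X \subset Y -> miss x X <= miss x Y.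
Proof. by move=> s; apply/subset_leq_card/setSD. Qed.

Lemma miss_card (G : graph) (x : G) (X : {set G}) : #|nbh x :&: X| + miss x X = #|X|.
Proof. by rewrite setIC /miss cardsID. Qed.

Section Structure.
Variables (B : graph) (c0 c1 N m g : nat).
Hypothesis B3 : colorable B 3.
Hypothesis cB : #|B| <= N.
Hypothesis N0 : 0 < N.
Hypothesis hM : matching_embeds B m.
Hypothesis hE : center_embeds B g.

Definition typical (G : graph) (n K : nat) (W : bool -> {set G}) : Prop :=
  [/\ [disjoint W true & W false], K * #|~: (W true :|: W false)| <= n,
      forall b y, y \in W b -> K * #|nbh y :&: W b| <= n,
      forall b y, y \in W b -> K * miss y (W (~~ b)) <= n &
      forall b, n <= 3 * #|W b|].

Lemma card_split2 (G : graph) (W : bool -> {set G}) (X : {set G}) b :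
  #|X| <= #|X :&: W b| + #|X :&: W (~~ b)| + #|~: (W true :|: W false)|.
Proof.
apply: leq_trans (_ : #|(X :&: W b) :|: (X :&: W (~~ b)) :|: ~: (W true :|: W false)| <= _).
  apply/subset_leq_card/subsetP => x xX; rewrite !inE xX /=.
  by case: (b); case: (x \in W true); case: (x \in W false).
apply: leq_trans (leq_card_setU _ _) _; rewrite leq_add2r.
exact: leq_card_setU.
Qed.

(** With degree about [n / 2] and few neighbours in its own class, a vertex sees almost [n / 2]
    vertices of the other class. Used for both classes, this bounds [miss] and the class sizes. *)
Lemma typical_exists K : 0 < K -> exists n1, forall n (G : graph), n1 <= n -> #|G| = n ->
  ~ subgraph B G -> (forall x : G, n <= 2 * #|nbh x| + c0) ->
  exists W, @typical G n K W.
Proof.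
move=> K0; have [|n1 h1] := @near_bipartite B c0 N B3 cB N0 (16 * K); first by lia.
exists (n1 + 16 * K * c0 + 16 * c0 + 1) => n G ln cG noB dG.
have [|W [dW zW iW]] := h1 n G _ cG noB dG; first by lia.
exists W; set z := #|~: _| in zW.
have z16 : 16 * z <= n by apply: leq_trans zW; rewrite -mulnA leq_mul2l leq_pmull.
have deg b y : y \in W b -> n <= 2 * (#|nbh y :&: W b| + #|nbh y :&: W (~~ b)| + z) + c0.
  by move=> _; apply: leq_trans (dG y) _; have := card_split2 W (nbh y) b; rewrite -/z; lia.
have i16 b y : y \in W b -> 16 * #|nbh y :&: W b| <= n.
  by move=> /iW; apply: leq_trans; rewrite -mulnA leq_mul2l leq_pmull.
have cW : #|W true| + #|W false| + z = n.
  by rewrite -cG -(cardsC (W true :|: W false)) cardsU disjoint_setI0 // cards0 subn0.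
have big b y : y \in W b -> n <= 3 * #|nbh y :&: W (~~ b)|.
  move=> yW; have := deg _ _ yW; have := i16 _ _ yW; lia.
have ne b : exists y, y \in W b.
  have h b' : 0 < #|W b'| -> 0 < #|W (~~ b')|.
    move=> /card_gt0P [y yW]; have := big _ _ yW.
    have := subset_leq_card (subsetIr (nbh y) (W (~~ b'))); lia.
  have pos : 0 < #|W true| /\ 0 < #|W false|.
    have [t0|t0] := posnP #|W true|; last by split=> //; exact: (h true t0).
    by have f0 : 0 < #|W false| by [lia]; have := h false f0; rewrite /= t0.
  by apply/card_gt0P; case: (b); case: pos.
split=> //.
- by apply: leq_trans zW; rewrite -mulnA leq_pmull.
- by move=> b y /iW; apply: leq_trans; rewrite -mulnA leq_pmull.
- move=> b y yW; have [y' yW'] := ne (~~ b).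
  have h3 := miss_card y (W (~~ b)).
  have h4 := deg _ _ yW; have h5 := deg _ _ yW'; rewrite negbK in h5.
  have h6 : #|nbh y' :&: W b| <= #|W b| by apply: subset_leq_card (subsetIr _ _).
  have h7 : #|W b| + #|W (~~ b)| + z = n by case: (b) => /=; lia.
  have h8 := iW _ _ yW; have h9 := iW _ _ yW'.
  have h10 : miss y (W (~~ b)) <= c0 + #|nbh y :&: W b| + #|nbh y' :&: W (~~ b)| + 2 * z by lia.
  have : K * miss y (W (~~ b)) <= K * (c0 + #|nbh y :&: W b| + #|nbh y' :&: W (~~ b)| + 2 * z).
    by rewrite leq_mul2l h10 orbT.
  rewrite !mulnDr; move: zW h8 h9; rewrite -!mulnA muln0; move: ln; rewrite -!mulnA.
  by move: (K * _) (K * _) (K * _) (K * c0) => u v w c0' *; lia.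
- move=> b; have [y yW] := ne (~~ b); have := big _ _ yW; rewrite negbK => h.
  apply: leq_trans h _; rewrite leq_mul2l; exact: subset_leq_card (subsetIr _ _).
Qed.

Section Typical.
Variables (n K a : nat) (G : graph) (W : bool -> {set G}).
Hypothesis cG : #|G| = n.
Hypothesis noB : ~ subgraph B G.
Hypothesis dG : forall x : G, n <= 2 * #|nbh x| + c0.
Hypothesis hW : typical n K W.
Hypothesis a0 : 0 < a.

Definition mixed : {set G} := [set x | [forall b, n <= a * #|nbh x :&: W b|]].

Lemma mixedP x b : x \in mixed -> n <= a * #|nbh x :&: W b|.
Proof. by rewrite inE => /forallP. Qed.

(** Applying [common_neighbours] once for each class would give [N] mixed vertices with linear
    common neighbourhoods in both classes, and [embed_triple] applies. *)
Lemma few_mixed : 2 * N * (2 * a * 2 ^ (2 * a * (2 * a * N))) <= K ->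
  2 * N * (2 * a * 2 ^ (2 * a * (2 * a * N))) <= n ->
  #|mixed| < 2 * a * (2 * a * N).
Proof.
set Q := 2 * a * (2 * a * N); set E := 2 * a * _ => hK hn.
rewrite ltnNge; apply/negP => big; apply: noB.
have [dW zW iW mW sW] := hW.
have aN : 0 < 2 * a * N by rewrite !muln_gt0 a0.
have [||P1 [sP1 cP1 h1]] := @common_neighbours G a (2 * a * N) n mixed (W true) a0 aN big.
- by rewrite -cG max_card.
- by move=> x; apply: mixedP.
have [|||P2 [sP2 cP2 h2]] := @common_neighbours G a N n P1 (W false) a0 N0.
- by rewrite cP1.
- by rewrite -cG max_card.
- by move=> x /(subsetP sP1); apply: mixedP.
pose C b := [set z in W b | P2 \subset nbh z].
have CW b : C b \subset W b by apply/subsetP => z; rewrite inE => /andP [].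
have E0 : 0 < E by rewrite !muln_gt0 a0 expn_gt0.
have K0 : 0 < K by apply: leq_trans hK; rewrite !muln_gt0 N0 a0 expn_gt0.
have cC b : n <= E * #|C b|.
  case: b.
    apply: leq_trans h1 _; rewrite leq_mul2l; apply/orP; right.
    apply/subset_leq_card/subsetP => z; rewrite !inE => /andP [-> h] /=.
    exact: subset_trans sP2 h.
  apply: leq_trans h2 _; rewrite leq_mul2r; apply/orP; right.
  rewrite leq_mul2l; apply/orP; right; rewrite leq_exp2l // leq_mul2l; apply/orP; right.
  by rewrite leq_pmull // muln_gt0.
apply: (@embed_triple B G P2 C (n %/ K) B3).
- move=> b y /(subsetP (CW b)) yW; rewrite leq_divRL // mulnC.
  by apply: leq_trans (mW _ _ yW); rewrite leq_mul2l miss_sub ?orbT.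
- move=> b; apply: leq_trans (_ : N * (n %/ K).+1 <= _); first by rewrite leq_mul2r cB orbT.
  exact: divn_bound E0 (cC b) hK hn.
- by rewrite cP2.
- move=> x b xP; apply/subsetP => y; rewrite !inE => /andP [_ /subsetP/(_ x xP)].
  by rewrite inE adj_sym.
Qed.

Let D := mixed.

Definition classes (b : bool) : {set G} := [set x in ~: D | a * #|nbh x :&: W b| < n].
Let V := classes.

Hypothesis aK : a < K.
Hypothesis a10 : 10 <= a.
Hypothesis n0 : 10 * c0 < n.

Lemma outside_small : a * #|~: (W true :|: W false)| <= n.
Proof. by have [_ zW _ _ _] := hW; apply: leq_trans zW; rewrite leq_mul2r ltnW ?orbT. Qed.

Lemma W_sub_V b : W b \subset V b.
Proof.
apply/subsetP => x xW; have [_ _ iW _ _] := hW; have := iW _ _ xW => h.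
have lt : a * #|nbh x :&: W b| < n.
  have [->|pos] := posnP #|nbh x :&: W b|; first by rewrite muln0; lia.
  by apply: leq_trans h; rewrite ltn_pmul2r.
by rewrite inE lt andbT inE; apply/negP => /(mixedP b); rewrite leqNgt lt.
Qed.

Lemma V_disjoint : [disjoint V true & V false].
Proof.
apply/pred0P => x; apply/negbTE/negP => /= /andP [].
rewrite !inE => /andP [_ h1] /andP [_ h2].
have := dG x; have := card_split2 W (nbh x) true; have := outside_small => /=.
have h3 : 10 * #|nbh x :&: W true| < n by apply: leq_ltn_trans h1; rewrite leq_mul2r a10 orbT.
have h4 : 10 * #|nbh x :&: W false| < n by apply: leq_ltn_trans h2; rewrite leq_mul2r a10 orbT.
move=> h5; have : 10 * #|~: (W true :|: W false)| <= n.
  by apply: leq_trans h5; rewrite leq_mul2r a10 orbT.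
lia.
Qed.

Lemma D_V_disjoint b : [disjoint D & V b].
Proof.
apply/pred0P => x; apply/negbTE/negP => /= /andP [xD].
by rewrite inE in_setC xD.
Qed.

Lemma DV_cover x : x \notin D -> (x \in V true) || (x \in V false).
Proof.
move=> xD; have := xD; rewrite [x \in D]inE => /forallPn [b]; rewrite -ltnNge => h.
by case: b h => h; apply/orP; [left | right]; rewrite inE in_setC xD.
Qed.

Lemma card_DV : #|D| + #|V true| + #|V false| = n.
Proof.
rewrite -cG -cardsT (_ : [set: G] = D :|: (V true :|: V false)); last first.
  apply/setP => x; rewrite !in_setU in_setT; case: (boolP (x \in D)) => //= xD.
  by rewrite DV_cover.
rewrite cardsU disjoint_setI0 ?cards0 ?subn0.
  by rewrite cardsU disjoint_setI0 ?V_disjoint // cards0 subn0 addnA.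
apply/pred0P => x; apply/negbTE/negP => /= /andP [xD]; rewrite in_setU => /orP [] xV.
  by rewrite (disjointFr (D_V_disjoint true) xD) in xV.
by rewrite (disjointFr (D_V_disjoint false) xD) in xV.
Qed.

Lemma inner_degree b x : x \in V b -> a * #|nbh x :&: V b| <= 2 * n.
Proof.
rewrite inE => /andP [_ /ltnW h].
apply: leq_trans (_ : a * (#|nbh x :&: W b| + #|~: (W true :|: W false)|) <= _); last first.
  by rewrite mulnDr; have := outside_small; lia.
rewrite leq_mul2l; apply/orP; right; apply: leq_trans (leq_card_setU _ _).
apply/subset_leq_card/subsetP => y; rewrite in_setI in_setU => /andP [xy yV].
rewrite in_setI xy in_setC in_setU /=; case: (boolP (y \in W b)) => //= yW.
apply/negP => h'; have {h'} yW' : y \in W (~~ b) by move: h' yW; case: (b) => /orP [] ->.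
have := V_disjoint; have := subsetP (W_sub_V (~~ b)) _ yW' => yV' dV.
by case: (b) yV yV' => h1 h2; [have := disjointFr dV h1 | have := disjointFr dV h2]; rewrite ?h1 ?h2.
Qed.

Lemma cross_degree b x : x \in V b ->
  a * n <= 2 * (a * #|nbh x :&: V (~~ b)|) + 4 * n + a * (2 * #|D| + c0).
Proof.
move=> xV; have h1 := inner_degree xV.
have h2 : #|nbh x| <= #|nbh x :&: V b| + #|nbh x :&: V (~~ b)| + #|D|.
  have h := card_split2 V (nbh x) b; apply: leq_trans h _; rewrite leq_add2l.
  apply/subset_leq_card/subsetP => y; rewrite in_setC in_setU; apply: contraR.
  exact: DV_cover.
have h3 : a * n <= a * (2 * (#|nbh x :&: V b| + #|nbh x :&: V (~~ b)| + #|D|) + c0).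
  by rewrite leq_mul2l; apply/orP; right; apply: leq_trans (dG x) _; rewrite leq_add2r leq_mul2l h2 orbT.
have e u v w t : a * (2 * (u + v + w) + t) = 2 * (a * u) + 2 * (a * v) + (a * (2 * w + t)) by lia.
by move: h3 h1; rewrite e; move: (a * _) (a * _) (a * _) (a * n) => u v w s; lia.
Qed.

Lemma V_miss b x : x \in V b -> a * miss x (V (~~ b)) <= 4 * n + a * (2 * #|D| + c0).
Proof.
move=> xV; have [_ _ _ _ sW] := hW.
have /card_gt0P [y yW] : 0 < #|W (~~ b)| by have := sW (~~ b); lia.
have yV := subsetP (W_sub_V _) _ yW.
have h1 := cross_degree xV; have h2 := cross_degree yV; rewrite negbK in h2.
have h3 := miss_card x (V (~~ b)).
have h4 : #|nbh y :&: V b| <= #|V b| by apply: subset_leq_card (subsetIr _ _).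
have h5 : #|V b| + #|V (~~ b)| <= n by have := card_DV; case: (b) => /=; lia.
have h6 : a * (#|nbh y :&: V b| + #|nbh x :&: V (~~ b)| + miss x (V (~~ b))) <= a * n.
  by rewrite leq_mul2l; apply/orP; right; lia.
move: h6 h1 h2; rewrite !mulnDr.
by move: (a * _) (a * _) (a * _) (a * _) (a * _) (a * n) => u v w t s r; lia.
Qed.

Lemma mixed_parts : three_parts D V.
Proof. by split; [exact: D_V_disjoint | exact: V_disjoint | exact: DV_cover]. Qed.

Let q := inner D V.

Hypothesis a30 : 30 * N <= a.
Hypothesis nN : 6 * N <= n.
Hypothesis nD : a * (2 * #|D| + c0) <= n.

Lemma V_miss5 b x : x \in V b -> a * miss x (V (~~ b)) <= 5 * n.
Proof. by move=> /V_miss; lia. Qed.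

(** A maximum inner matching has at most [m] edges by [matching_embeds]; its vertices meet all inner
    edges, and each has inner degree at most [2 * n / a]. *)
Lemma inner_bound : a * arcn q <= 8 * m * n.
Proof.
have [dW zW iW mW sW] := hW; have [M [nu [hMq cM mM]]] := max_matching q.
have parts := mixed_parts; have qs := @inner_sym _ D V; have qi := @inner_irr _ D V.
have covn : #|cov M| <= 2 * m.
  rewrite leqNgt; apply/negP => big; apply: noB.
  apply: (hM (C := W) (e := (5 * n) %/ a) (s := fun x => x \in V true) (M := M)).
  - move=> b y yW; rewrite leq_divRL // mulnC; apply: leq_trans (_ : n <= _); last lia.
    by apply: leq_trans (mW _ _ yW); rewrite leq_mul2r ltnW ?orbT.
  - move=> b; apply: leq_trans (_ : N * ((5 * n) %/ a).+1 <= _); first by rewrite leq_mul2r cB orbT.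
    by apply: (@divn_bound (5 * n) a 15 N) => //; have := sW b; lia.
  - by apply: sub_matching hMq => x y /and4P [_ _ -> ->].
  - move=> x /(matching_edge hMq) /and4P [xD _ _ _].
    rewrite leq_divRL // mulnC; apply: leq_trans (V_miss5 (parts_class parts xD)).
    by rewrite leq_mul2l miss_sub ?orbT // W_sub_V.
  - exact: ltnW.
have touch x y : q x y -> (x \in cov M) || (y \in cov M).
  move=> qxy; apply: contraT; rewrite negb_or !inE !negbK => /andP [/eqP Mx /eqP My].
  have [M' hM' cM'] := add_edge qs qi hMq Mx My qxy; have := mM _ hM'.
  rewrite cM' cardsU1 cardsU1 !inE Mx My eqxx /= (negbTE (q_neq qi qxy)) cM /=; lia.
have h1 := arcn_touching qs touch.
have h2 : a * \sum_(x in cov M) #|nbr q x| <= #|cov M| * (2 * n).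
  rewrite big_distrr -sum_nat_const; apply: leq_sum => x /(matching_edge hMq) /and4P [xD _ _ _] /=.
  by have xV := parts_class parts xD; rewrite (nbr_inner parts xV); apply: inner_degree.
have h3 : #|cov M| * (2 * n) <= 2 * m * (2 * n) by rewrite leq_mul2r covn orbT.
have h4 : a * arcn q <= a * (2 * \sum_(x in cov M) #|nbr q x|) by rewrite leq_mul2l h1 orbT.
rewrite mulnCA in h4; move: h2 h4; move: (a * _) (a * _) => u v h2 h4.
by apply: leq_trans h4 _; lia.
Qed.

Variable F : nat.
Hypothesis F0 : 0 < F.

Definition frequent (b : bool) (Q : {set G}) : bool :=
  (Q \subset D) && (n <= F * #|[set y in W b | Q \subset nbh y]|).

Lemma frequent0 b : 3 <= F -> frequent b set0.
Proof.
move=> F3; rewrite /frequent sub0set /=; have [_ _ _ _ sW] := hW.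
apply: leq_trans (sW b) _; apply: leq_mul => //.
by apply/subset_leq_card/subsetP => y yW; rewrite inE yW sub0set.
Qed.

(** A vertex of [W b] with more than [p] mixed neighbours has an infrequent trace; there are at most
    [2 ^ #|D|] of these, each joined to fewer than [n / F] vertices of [W b]. *)
Lemma rare_degrees b p : (forall Q, frequent b Q -> #|Q| <= p) ->
  F * #|[set y in V b | p < #|nbh y :&: D|]| <= 2 ^ #|D| * n + F * #|~: (W true :|: W false)|.
Proof.
move=> hp; set R := [set y in V b | _].
have sub : R \subset (\bigcup_(Q in [set Q in powerset D | ~~ frequent b Q]) [set y in W b | Q \subset nbh y])
    :|: ~: (W true :|: W false).
  apply/subsetP => y; rewrite inE => /andP [yV lt]; rewrite in_setU.
  case: (boolP (y \in W b)) => yW; last first.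
    apply/orP; right; rewrite in_setC in_setU.
    have nW : y \notin W (~~ b).
      apply/negP => /(subsetP (W_sub_V _)); by rewrite (parts_notV mixed_parts yV).
    by case: (b) yW nW => /= /negbTE -> /negbTE ->.
  apply/orP; left; apply/bigcupP; exists (nbh y :&: D); last by rewrite inE yW subsetIl.
  rewrite inE powersetE subsetIr /=; apply/negP => /hp; rewrite leqNgt => /negP; apply.
  exact: lt.
apply: leq_trans (_ : F * (\sum_(Q in [set Q in powerset D | ~~ frequent b Q])
    #|[set y in W b | Q \subset nbh y]| + #|~: (W true :|: W false)|) <= _).
  rewrite leq_mul2l; apply/orP; right; apply: leq_trans (subset_leq_card sub) _.
  apply: leq_trans (leq_card_setU _ _) _; rewrite leq_add2r.
  elim/big_rec2: _ => [|u E T' _ ET]; first by rewrite cards0.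
  by apply: leq_trans (leq_card_setU _ _) _; rewrite leq_add2l.
rewrite mulnDr leq_add2r big_distrr /=.
apply: leq_trans (_ : \sum_(Q in [set Q in powerset D | ~~ frequent b Q]) n <= _).
  apply: leq_sum => Q; rewrite inE powersetE /frequent => /andP [-> /=].
  by rewrite -ltnNge => /ltnW.
rewrite sum_nat_const leq_mul2r; apply/orP; right; rewrite -card_powerset.
by apply/subset_leq_card/subsetP => Q; rewrite inE => /andP [].
Qed.

(** Otherwise [g] common vertices form [U] and a further vertex of [Q] is the centre: it is complete
    to the common neighbourhood of [Q] and, being mixed, has many neighbours in the other class. *)
Lemma frequent_bound Q Q' b : 2 * N * F <= K -> 2 * N * F <= n -> a * N <= n ->
  frequent b Q -> frequent (~~ b) Q' -> g <= #|Q :&: Q'| -> #|Q| <= g.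
Proof.
move=> FK Fn aNn /andP [QD fQ] /andP [QD' fQ'] gQ; rewrite leqNgt; apply/negP => big.
have [dW zW iW mW sW] := hW.
have [U sU cU] := subset_of_card gQ.
have UQ : U \subset Q := subset_trans sU (subsetIl _ _).
have /subsetPn [d dQ dU] : ~~ (Q \subset U).
  by apply: contraL big => /subset_leq_card; rewrite cU -leqNgt.
have dD := subsetP QD _ dQ.
pose C (c : bool) := if c then [set y in W (~~ b) | Q' \subset nbh y] else [set y in W b | Q \subset nbh y].
have CW c : C c \subset W (c (+) b).
  by apply/subsetP => y; rewrite /C; case: c; rewrite inE => /andP []; case: (b).
have K0 : 0 < K by apply: leq_trans FK; rewrite !muln_gt0 N0 F0.
have WD b' x : x \in W b' -> x \notin D.
  by move=> /(subsetP (W_sub_V b')); apply: (parts_notU mixed_parts).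
apply: noB; apply: (hE (C := C) (e := n %/ K) (U := U) (d := d) (L := nbh d :&: W (~~ b))) => //.
- move=> c y /(subsetP (CW c)) yW; rewrite leq_divRL // mulnC.
  apply: leq_trans (mW _ _ yW); rewrite leq_mul2l miss_sub ?orbT //.
  by apply: subset_trans (CW _) _; rewrite addNb.
- move=> c; apply: leq_trans (_ : N * (n %/ K).+1 <= _); first by rewrite leq_mul2r cB orbT.
  by apply: (divn_bound F0 _ FK Fn); case: c.
- move=> u c uU; rewrite /miss (_ : _ :\: _ = set0) ?cards0 //.
  apply/eqP; rewrite setD_eq0; apply/subsetP => y; have := subsetP sU _ uU.
  rewrite in_setI => /andP [uQ uQ']; rewrite /C; case: c; rewrite !inE => /andP [_ /subsetP s'].
    by have := s' _ uQ'; rewrite inE adj_sym.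
  by have := s' _ uQ; rewrite inE adj_sym.
- rewrite /miss (_ : _ :\: _ = set0) ?cards0 //.
  apply/eqP; rewrite setD_eq0; apply/subsetP => y; rewrite /C !inE => /andP [_ /subsetP/(_ _ dQ)].
  by rewrite inE adj_sym.
- exact: subsetIl.
- apply/pred0P => x; apply/negbTE/negP => /= /andP []; rewrite in_setI => /andP [_ /WD xD] xU.
  by move: xD; rewrite (subsetP QD) // (subsetP UQ).
- move=> z; rewrite in_setI => /andP [_ zV]; rewrite leq_divRL // mulnC.
  by apply: leq_trans (mW _ _ zV); rewrite leq_mul2l negbK miss_sub ?orbT //.
- apply: leq_trans cB _; rewrite -(leq_pmul2l a0); apply: leq_trans aNn _.
  exact: mixedP.
Qed.

Lemma max_frequent b : 3 <= F -> exists Q, frequent b Q /\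
  forall Q', frequent b Q' -> #|Q'| <= #|Q|.
Proof.
move=> F3; have [Q fQ hQ] := arg_maxnP (fun Q : {set G} => #|Q|) (frequent0 b F3).
by exists Q; split.
Qed.

Let k := #|D|.
Let v b := #|V b|.
Let z := #|~: (W true :|: W false)|.

Lemma arcs_D_le b p : (forall Q, frequent b Q -> #|Q| <= p) ->
  32 * k * 2 ^ k <= F -> 32 * k <= K ->
  exists2 r, arcs D (V b) <= p * v b + r & 16 * r <= n.
Proof.
move=> hp kF kK; set R := [set y in V b | p < #|nbh y :&: D|].
have hR : F * #|R| <= 2 ^ k * n + F * z := rare_degrees hp.
exists (k * #|R|).
  rewrite arcsC /arcs (bigID (fun y => y \in R)) /= addnC; apply: leq_add.
    rewrite mulnC -sum_nat_const big_mkcond [X in _ <= X]big_mkcond; apply: leq_sum => y _.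
    by case: (boolP (y \in V b)) => //= yV; rewrite inE yV /= -leqNgt; case: ifP.
  rewrite mulnC -sum_nat_const big_mkcond [X in _ <= X]big_mkcond; apply: leq_sum => y _.
  case: (boolP (y \in R)); rewrite ?andbF // andbT; case: ifP => // _ _.
  exact: subset_leq_card (subsetIr _ _).
have [_ zW _ _ _] := hW; rewrite -/z in zW.
have h1 : F * (32 * k * #|R|) <= F * (n + 32 * k * z).
  rewrite mulnCA mulnDr; apply: leq_trans (_ : 32 * k * (2 ^ k * n + F * z) <= _).
    by rewrite leq_mul2l hR orbT.
  rewrite mulnDr (mulnCA _ F) leq_add2r mulnA leq_mul2r kF orbT //.
rewrite leq_pmul2l // in h1.
have h2 : 32 * k * z <= n by apply: leq_trans zW; rewrite leq_mul2r kK orbT.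
have e : 32 * k * #|R| = 2 * (16 * (k * #|R|)) by lia.
by rewrite e in h1; lia.
Qed.

Variable E : nat.
Hypothesis F3 : 3 <= F.
Hypothesis kF : 32 * k * 2 ^ k <= F.
Hypothesis kK : 32 * k <= K.
Hypothesis am : 64 * m < a.
Hypothesis amE : 16 * m * E <= a.
Hypothesis NFK : 2 * N * F <= K.
Hypothesis NFn : 2 * N * F <= n.
Hypothesis aNn : a * N <= n.
Hypothesis nk : g * g + 2 * k * k + 2 * k + c1 < n.
Hypothesis nE : E * c1 <= n.
Hypothesis dense : n * n + 2 * g * n <= 2 * (\sum_(x : G) #|nbh x|) + c1.

Lemma inner_small : 8 * arcn q <= n.
Proof.
have h := inner_bound; have [m0|m0] := posnP m.
  have : a * arcn q <= 0 by apply: leq_trans h _; rewrite m0 muln0.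
  by rewrite leqn0 muln_eq0 => /orP [|] /eqP; lia.
rewrite -(leq_pmul2l (_ : 0 < 8 * m)) ?muln_gt0 ?m0 //.
apply: leq_trans h; rewrite mulnA leq_mul2r; apply/orP; right; lia.
Qed.

(** Up to lower order terms the number of edges is at most [(vt + pf) * (vf + pt)], with [pt] and
    [pf] the sizes of [Qt] and [Qf]. If [pt + pf < k + g], the factors add up to less than [n + g],
    against [dense]. *)
Lemma frequent_total (Qt Qf : {set G}) :
  (forall Q, frequent true Q -> #|Q| <= #|Qt|) -> (forall Q, frequent false Q -> #|Q| <= #|Qf|) ->
  k + g <= #|Qt| + #|Qf|.
Proof.
move=> ht hf; rewrite leqNgt; apply/negP => lt.
have [r1 h1 r1n] := arcs_D_le ht kF kK; have [r2 h2 r2n] := arcs_D_le hf kF kK.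
have h3 := parts_degree_sum mixed_parts; have h4 := arcs_le D D; have h5 := arcs_le (V true) (V false).
have h6 := inner_small; have h7 := card_DV; rewrite -/k -/(v true) -/(v false) in h5 h7 h4.
move: dense h1 h2; rewrite h3 -/q -/D -/V.
move: #|Qt| #|Qf| lt (v true) (v false) (arcs D D) (arcs D _) (arcs D _) (arcs _ _) (arcn q) h4 h5 h6 h7.
move=> pt pf lt vt vf x1 x2 x3 x4 I h4 h5 h6 h7 hd h1 h2.
pose S := vt + vf + pt + pf.
have s1 : S.+1 * S.+1 <= (n + g) * (n + g) by apply: leq_mul; rewrite /S; lia.
have s2 : 4 * ((vt + pf) * (vf + pt)) <= S * S.
  rewrite (_ : S = (vt + pf) + (vf + pt)); last by rewrite /S; lia.
  by rewrite mulnn; exact: nat_AGM2.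
have s3 : (vt + pf) * (vf + pt) = vt * vf + pt * vt + pf * vf + pf * pt by lia.
have s4 : S.+1 * S.+1 = S * S + 2 * S + 1 by lia.
have s5 : (n + g) * (n + g) = n * n + 2 * g * n + g * g by lia.
have s6 : vt + vf <= S by rewrite /S -addnA leq_addr.
have s7 : 2 * k * k = 2 * (k * k) by lia.
rewrite s3 in s2; rewrite s4 s5 in s1; have nk' := nk; rewrite s7 in nk'.
move: (S * S) (vt * vf) (pt * vt) (pf * vf) (pf * pt) (n * n) (2 * g * n) (g * g) (k * k) s1 s2 nk' hd h1 h2 h4 h5 => *.
lia.
Qed.

(** Among [k] mixed vertices two largest frequent sets share at least [g], so [frequent_bound]
    limits both to [g]; with [frequent_total] this leaves only [k = g]. *)
Lemma card_mixed : k = g.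
Proof.
have [Qt [ft mt]] := max_frequent true F3; have [Qf [ff mf]] := max_frequent false F3.
have tot := frequent_total mt mf.
have sub b Q : frequent b Q -> Q \subset D by case/andP.
have cI : g <= #|Qt :&: Qf|.
  have := cardsUI Qt Qf; have : #|Qt :|: Qf| <= k.
    by apply: subset_leq_card; rewrite subUset (sub _ _ ft) (sub _ _ ff).
  lia.
have h1 := frequent_bound NFK NFn aNn ft ff cI.
have h2 : #|Qf| <= g.
  by apply: (frequent_bound NFK NFn aNn ff ft); rewrite setIC.
have := subset_leq_card (sub _ _ ft); have := subset_leq_card (sub _ _ ff); rewrite -/k; lia.
Qed.

(** With exactly [g] mixed vertices the leading terms of the count cancel, and pairs missing at [u]
    must be compensated by inner edges or by [c1]. *)
Lemma mixed_miss u b : u \in D -> E * miss u (V b) <= n.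
Proof.
move=> uD; have h3 := parts_degree_sum mixed_parts; have h5 := arcs_le (V true) (V false).
have mt := arcs_miss D (V true); have mf := arcs_miss D (V false); have h4 := arcs_le D D.
have h7 := card_DV; have kg := card_mixed.
rewrite -/k -/(v true) -/(v false) in h5 h7 mt mf h4.
have le c : miss u (V c) <= \sum_(x in D) miss x (V c) by rewrite (bigD1 u) //= leq_addr.
have {}le : miss u (V b) <= \sum_(x in D) miss x (V true) + \sum_(x in D) miss x (V false).
  by case: (b) (le b) => h; apply: leq_trans h _; rewrite ?leq_addr ?leq_addl.
have h6 : 2 * (E * arcn q) <= n.
  have h := inner_bound; have [m0|m0] := posnP m.
    have : a * arcn q <= 0 by apply: leq_trans h _; rewrite m0 muln0.
    by rewrite leqn0 muln_eq0 => /orP [|] /eqP; lia.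
  rewrite -(leq_pmul2l (_ : 0 < 8 * m)) ?muln_gt0 ?m0 //.
  apply: leq_trans h; rewrite (_ : 8 * m * _ = 16 * m * E * arcn q); last by lia.
  by rewrite leq_mul2r amE orbT.
have main : 4 * miss u (V b) <= 2 * arcn q + c1.
  move: dense le; rewrite h3 -/q -/D -/V kg in h7 *; rewrite kg in mt mf h4.
  move: mt mf h4 h5 h7; move: (\sum_(x in D) _) (\sum_(x in D) _) (v true) (v false) (arcs D D) (arcs D _) (arcs D _) (arcs _ _) (miss _ _).
  move=> mt mf vt vf x1 x2 x3 x4 mu e1 e2 h4 h5 h7 hd le.
  have s2 : 4 * ((vt + g) * (vf + g)) <= (n + g) * (n + g).
    rewrite (_ : n + g = (vt + g) + (vf + g)); last by lia.
    by rewrite mulnn; exact: nat_AGM2.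
  have s3 : (vt + g) * (vf + g) = vt * vf + g * vt + g * vf + g * g by lia.
  have s5 : (n + g) * (n + g) = n * n + 2 * g * n + g * g by lia.
  rewrite s3 s5 in s2.
  move: (vt * vf) (g * vt) (g * vf) (n * n) (2 * g * n) (g * g) s2 hd e1 e2 h4 h5 => *.
  lia.
have : E * (4 * miss u (V b)) <= E * (2 * arcn q + c1) by rewrite leq_mul2l main orbT.
rewrite mulnDr (mulnCA E 4) (mulnCA E 2); move: nE h6; move: (E * _) (E * _) (E * _) => x y t; lia.
Qed.

End Typical.

Theorem structure E : exists n1, forall n (G : graph), n1 <= n -> #|G| = n ->
  ~ subgraph B G -> (forall x : G, n <= 2 * #|nbh x| + c0) ->
  n * n + 2 * g * n <= 2 * (\sum_(x : G) #|nbh x|) + c1 ->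
  exists (U : {set G}) (V : bool -> {set G}), [/\ three_parts U V, #|U| = g,
    forall b x, x \in V b -> E * miss x (V (~~ b)) <= n,
    forall u b, u \in U -> E * miss u (V b) <= n & forall b, n <= 3 * #|V b|].
Proof.
(* Order of choice: the threshold [a] for mixed vertices determines the bound [q] on their number,
   this determines the frequency [F], and [K] dominates them all. *)
pose a := 30 * N + 64 * m + 16 * m * E + 5 * E + 10.
pose q := 2 * a * (2 * a * N).
pose F := 3 + 32 * q * 2 ^ q.
pose Q := 2 * N * (2 * a * 2 ^ q).
pose K := a + 1 + Q + 2 * N * F + 32 * q.
have a0 : 0 < a by rewrite /a; lia.
have [|n1 h1] := @typical_exists K; first by rewrite /K; lia.
exists (n1 + Q + 10 * c0 + 6 * N + a * (2 * q + c0) + 2 * N * F + a * N + g * g + 2 * q * q + 2 * q + c1 + E * c1 + 1).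
move=> n G ln cG noB dG dense; have [|W hW] := h1 n G _ cG noB dG; first by lia.
have cD : #|mixed n a W| < q by apply: (few_mixed cG noB hW a0); rewrite -/q -/Q; rewrite /K; lia.
have cD' := ltnW cD.
have aK : a < K by rewrite /K; lia.
have a10 : 10 <= a by rewrite /a; lia.
have n0 : 10 * c0 < n by lia.
have nD : a * (2 * #|mixed n a W| + c0) <= n.
  apply: leq_trans (_ : a * (2 * q + c0) <= _); last by lia.
  by rewrite leq_mul2l; apply/orP; right; lia.
have parts := mixed_parts cG dG hW a0 aK a10 n0.
have kF : 32 * #|mixed n a W| * 2 ^ #|mixed n a W| <= F.
  apply: leq_trans (_ : 32 * q * 2 ^ q <= _); last by rewrite /F leq_addl.
  by apply: leq_mul; [rewrite leq_mul2l cD' | rewrite leq_exp2l].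
have kK : 32 * #|mixed n a W| <= K by rewrite /K; lia.
have F0 : 0 < F by [].
have nk : g * g + 2 * #|mixed n a W| * #|mixed n a W| + 2 * #|mixed n a W| + c1 < n.
  have : 2 * #|mixed n a W| * #|mixed n a W| <= 2 * q * q by apply: leq_mul => //; rewrite leq_mul2l cD'.
  lia.
exists (mixed n a W), (classes n a W).
have aN : 30 * N <= a by rewrite /a; lia.
have nN : 6 * N <= n by lia.
have am : 64 * m < a by rewrite /a; lia.
have amE : 16 * m * E <= a by rewrite /a; lia.
have NFK : 2 * N * F <= K by rewrite /K; lia.
have NFn : 2 * N * F <= n by lia.
have aNn : a * N <= n by lia.
have nE : E * c1 <= n by lia.
split=> //.
- exact: (card_mixed cG noB dG hW a0 aK a10 n0 aN nN nD F0 (isT : 2 < F) kF kK am amE NFK NFn aNn nk nE dense).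
- move=> b x xV; have := V_miss5 cG dG hW a0 aK a10 n0 aN nN nD xV; move: (miss _ _) => mu h.
  have : 5 * (E * mu) <= 5 * n by apply: leq_trans h; rewrite mulnA leq_mul2r; apply/orP; right; rewrite /a; lia.
  lia.
- move=> u b uD.
  exact: (mixed_miss cG noB dG hW a0 aK a10 n0 aN nN nD F0 (isT : 2 < F) kF kK am amE NFK NFn aNn nk nE dense b uD).
- move=> b; have [_ _ _ _ sW] := hW; apply: leq_trans (sW b) _; rewrite leq_mul2l.
  exact/subset_leq_card/(W_sub_V cG hW a0 aK a10 n0).
Qed.

End Structure.

(** * Edge counts, progressive induction and Turan graphs *)

Lemma sum_sig (T : finType) (S : {set T}) (F : T -> nat) :
  \sum_(x : {x : T | x \in S}) F (val x) = \sum_(x in S) F x.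
Proof.
have e : S = val @: [set: {x : T | x \in S}].
  apply/setP => x; apply/idP/imsetP => [xS|[y _ ->]]; last exact: valP.
  by exists (exist _ x xS).
rewrite [in RHS]e big_imset /=; last by move=> x y _ _; apply: val_inj.
by apply: eq_bigl => x; rewrite inE.
Qed.

Lemma edges_induced (G : graph) (S : {set G}) : (#|edges (induced S)|).*2 = arcs S S.
Proof.
rewrite card_edges /arcs -sum_sig; apply: eq_bigr => x _.
rewrite -(card_imset _ val_inj); apply: eq_card => y; rewrite in_setI in_nbh.
apply/imsetP/andP => [[z + ->]|[a yS]]; first by rewrite inE; split=> //; exact: valP.
by exists (exist _ y yS); rewrite ?inE.
Qed.

Lemma edges_remove (G : graph) (x : G) :
  #|edges G| = #|edges (induced [set~ x])| + #|nbh x|.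
Proof.
apply: double_inj; rewrite doubleD card_edges edges_induced.
have h (A : {set G}) : #|A| = #|A :&: [set~ x]| + (x \in A).
  by rewrite (cardsD1 x) addnC; congr addn; apply: eq_card => y; rewrite !inE andbC.
rewrite /arcs (bigD1 x) //= [X in _ + X](eq_bigl (fun y => y \in [set~ x])); last first.
  by move=> y; rewrite !inE.
rewrite [X in _ + X](eq_bigr (fun y => #|nbh y :&: [set~ x]| + (adj y x : nat))); last first.
  by move=> y _; rewrite {1}h in_nbh.
rewrite big_split /= addnC -addnA; congr addn; rewrite -addnn addnC; congr addn.
rewrite -sum1_card big_mkcond [RHS]big_mkcond; apply: eq_bigr => y _.
rewrite in_nbh !inE adj_sym; case: eqP => [->|_] /=; first by rewrite adj_irr.
by case: (adj x y).
Qed.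

Lemma induced_subgraph (G : graph) (S : {set G}) : subgraph (induced S) G.
Proof. by exists val => //; apply: val_inj. Qed.

Lemma edges_le_square (G : graph) : #|edges G| <= #|G| * #|G|.
Proof.
apply: leq_trans (_ : (#|edges G|).*2 <= _); first by lia.
rewrite card_edges; apply: leq_trans (_ : \sum_(x : G) #|G| <= _).
  by apply: leq_sum => x _; apply: max_card.
by rewrite sum_nat_const.
Qed.

(* Simonovits' progressive induction: an excess over [t] shrinks by one with
   each step at which the minimum degree is too small. *)
Lemma progressive_induction (B : graph) (t : nat -> nat) (n1 : nat) :
  (forall n (G : graph), n1 <= n -> #|G| = n -> ~ subgraph B G ->
     (forall x : G, t n <= t n.-1 + #|nbh x|) -> #|edges G| <= t n) ->
  exists n0, forall n (G : graph), n0 <= n -> #|G| = n -> ~ subgraph B G -> #|edges G| <= t n.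
Proof.
move=> h.
have claim j (G : graph) : #|G| = n1 + j -> ~ subgraph B G ->
    #|edges G| <= t (n1 + j) + (n1 * n1 - j).
  elim: j G => [|j IH] G cG noB.
    have := edges_le_square G; move: cG; rewrite addn0 subn0 => -> le.
    exact: leq_trans le (leq_addl _ _).
  case: (classic (forall x : G, t (n1 + j.+1) <= t (n1 + j.+1).-1 + #|nbh x|)) => [dG|ndG].
    by apply: leq_trans (h _ _ _ cG noB dG) _; rewrite ?leq_addr.
  have [x] := not_all_ex_not _ _ ndG; move/negP; rewrite -ltnNge addnS /= => dx.
  have cI : #|induced [set~ x]| = n1 + j.
    by rewrite card_sig (eq_card (B := [set~ x])) // cardsC1 cG addnS.
  have := IH _ cI (fun s => noB (subgraph_trans s (induced_subgraph _))).
  rewrite (edges_remove x) => le; apply: leq_trans (leq_add le (leqnn _)) _; lia.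
exists (n1 + n1 * n1) => n G ln cG noB.
have e : n = n1 + (n - n1) by lia.
have := claim (n - n1) G; rewrite -e => /(_ cG noB).
by rewrite (_ : n1 * n1 - (n - n1) = 0) ?addn0 //; lia.
Qed.

Section Join.
Variables G K : graph.

Lemma card_join : #|join G K| = #|G| + #|K|.
Proof. by rewrite card_sum. Qed.

Lemma edges_join : #|edges (join G K)| = #|edges G| + #|edges K| + #|G| * #|K|.
Proof.
apply: double_inj; rewrite !doubleD !card_edges big_sumType /=.
have hl (x : G) : #|nbh (inl x : join G K)| = #|nbh x| + #|K|.
  rewrite -!sum1_card !(big_mkcond (fun y => y \in _)) big_sumType /=.
  by congr addn; apply: eq_bigr => y _; rewrite !inE.
have hr (x : K) : #|nbh (inr x : join G K)| = #|nbh x| + #|G|.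
  rewrite addnC -!sum1_card !(big_mkcond (fun y => y \in _)) big_sumType /=.
  by congr addn; apply: eq_bigr => y _; rewrite !inE.
rewrite (eq_bigr _ (fun x _ => hl x)) [X in _ + X](eq_bigr _ (fun x _ => hr x)) !big_split /=.
by rewrite !sum_nat_const (mulnC #|K|) addnACA addnn.
Qed.

End Join.

(** The floor of [m * m / 4], the size of the balanced complete bipartite graph. *)
Definition tn (m : nat) : nat := m./2 * (m - m./2).

Lemma mul_le_tn x y m : x + y = m -> x * y <= tn m.
Proof.
move=> e; have := (nat_AGM2 x y).1; rewrite -mulnn e /tn.
have := odd_double_half m; move: (m./2) => h; case: (odd m) => /= <- le.
  rewrite (_ : true + h.*2 - h = h.+1); last by lia.
  have : 4 * (x * y) < 4 * (h * h.+1).+1 by apply: leq_ltn_trans le _; lia.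
  lia.
rewrite (_ : false + h.*2 - h = h); last by lia.
have : 4 * (x * y) <= 4 * (h * h) by apply: leq_trans le _; lia.
lia.
Qed.

Lemma tn_lower m : m * m <= 4 * tn m + 1.
Proof.
rewrite /tn; have := odd_double_half m; move: (m./2) => h; case: (odd m) => /= <-.
  by rewrite (_ : true + h.*2 - h = h.+1); lia.
by rewrite (_ : false + h.*2 - h = h); lia.
Qed.

Lemma tnS m : tn m.+1 = tn m + m.+1./2.
Proof.
rewrite /tn; have := odd_double_half m; rewrite [m.+1./2]/= uphalf_half.
move: (m./2) => h; case: (odd m) => /= <-.
  by rewrite (_ : true + h.*2 - h = h.+1) 1?(_ : (true + h.*2).+1 - (true + h) = h.+1); lia.
by rewrite (_ : false + h.*2 - h = h) 1?(_ : (false + h.*2).+1 - (false + h) = h.+1); lia.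
Qed.

Definition odds (m : nat) : {set 'I_m} := [set i : 'I_m | odd i].

Lemma card_odds m : #|odds m| = m./2.
Proof.
rewrite -sum1_card big_mkcond /=.
rewrite (eq_bigr (fun i : 'I_m => odd i : nat)); last by move=> i _; rewrite inE; case: odd.
rewrite -(big_mkord xpredT (fun i => odd i : nat)).
elim: m => [|m IH]; first by rewrite big_geq.
by rewrite big_nat_recr //= IH uphalf_half addnC.
Qed.

Section TuranPlus.
Variables (m : nat) (q : rel 'I_m).
Hypothesis q_sym : symmetric q.
Hypothesis q_irr : irreflexive q.
Hypothesis q_even : forall x y, q x y -> ~~ odd x && ~~ odd y.

Definition turan_plus_rel : rel 'I_m := fun x y => turan_rel 2 x y || q x y.

Lemma turan_plus_sym : symmetric turan_plus_rel.
Proof. by move=> x y; rewrite /turan_plus_rel turan_sym q_sym. Qed.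

Lemma turan_plus_irr : irreflexive turan_plus_rel.
Proof. by move=> x; rewrite /turan_plus_rel turan_irr q_irr. Qed.

Definition turan_plus := Graph turan_plus_sym turan_plus_irr.

Lemma turan2E (x y : 'I_m) : turan_rel 2 x y = (odd x != odd y).
Proof. by rewrite /turan_rel !modn2; case: (odd x); case: (odd y). Qed.

Lemma edges_turan_plus : (#|edges turan_plus|).*2 = (tn m).*2 + arcn q.
Proof.
rewrite card_edges.
have h (x : 'I_m) : #|nbh (x : turan_plus)| = (if odd x then m - m./2 else m./2) + #|nbr q x|.
  have e : nbh (x : turan_plus) = (if odd x then ~: odds m else odds m) :|: nbr q x.
    apply/setP => y; rewrite in_nbh in_setU [y \in nbr q x]inE /adj /= /turan_plus_rel turan2E.
    by case: (odd x); rewrite !inE; case: (odd y).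
  rewrite e cardsU (_ : _ :&: _ = set0) ?cards0 ?subn0.
    have := cardsC (odds m); rewrite card_ord card_odds => e2.
    have e3 : #|~: odds m| = m - m./2.
      by apply: (@addnI m./2); rewrite e2 subnKC //; lia.
    by case: (odd x); rewrite ?card_odds ?e3.
  apply/setP => y; rewrite in_setI in_set0 [y \in nbr q x]inE; apply/negbTE/negP.
  by move=> /andP [h /q_even /andP [/negbTE ox /negbTE oy]]; move: h; rewrite ox inE oy.
rewrite (eq_bigr _ (fun x _ => h x)) big_split /= -/(arcn q); congr addn.
rewrite (bigID (fun x : 'I_m => odd x)) /=.
rewrite (eq_bigr (fun=> m - m./2)); last by move=> i ->.
rewrite [X in _ + X](eq_bigr (fun=> m./2)); last by move=> i /negbTE ->.
have c1 : #|[pred x : 'I_m | odd x]| = m./2 by rewrite -card_odds cardsE.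
have c2 : #|[pred x : 'I_m | ~~ odd x]| = m - m./2.
  have := cardC [pred x : 'I_m | odd x]; rewrite card_ord c1 => e2.
  by apply: (@addnI m./2); rewrite subnKC; [exact: e2 | lia].
by rewrite !sum_nat_const c1 c2 /tn; lia.
Qed.

Lemma differs_turan_plus C : arcn q <= C -> differs_by C turan_plus (turan 2 m).
Proof.
move=> le; exists id; first by exists id.
have sub : [set e : {set turan_plus} | (e \in edges turan_plus) != (id @: e \in edges (turan 2 m))]
    \subset [set [set p.1; p.2] | p in [set p : 'I_m * 'I_m | q p.1 p.2]].
  apply/subsetP => e; rewrite inE imset_id => ne.
  have : e \in edges turan_plus /\ e \notin edges (turan 2 m).
    have imp : e \in edges (turan 2 m) -> e \in edges turan_plus.
      rewrite !inE => /existsP [x /existsP [y /andP [a ee]]].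
      apply/existsP; exists x; apply/existsP; exists y; rewrite ee andbT.
      by rewrite /adj /= /turan_plus_rel (a : turan_rel 2 x y).
    case e1: (e \in edges turan_plus) ne; case e2: (e \in edges (turan 2 m)) => // _.
    by move: (imp e2); rewrite e1.
  rewrite !inE => -[/existsP [x /existsP [y /andP [a ee]]] n2].
  apply/imsetP; exists (x, y); last exact/eqP.
  rewrite inE /=; move: a; rewrite /adj /= /turan_plus_rel => /orP [a|//].
  by case/negP: n2; apply/existsP; exists x; apply/existsP; exists y; rewrite ee andbT; exact: a.
apply: leq_trans (subset_leq_card sub) _; apply: leq_trans (leq_imset_card _ _) _.
apply: leq_trans le; rewrite -sum1_card (eq_bigl (fun p => true && q p.1 p.2)); last first.
  by move=> p; rewrite inE.
rewrite -(pair_big_dep xpredT (fun x y => q x y) (fun _ _ => 1)) /=.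
by apply: leq_sum => x _; rewrite sum1_card; apply/subset_leq_card/subsetP => y; rewrite !inE.
Qed.

End TuranPlus.

Definition crossing (G : graph) (U : {set G}) (V : bool -> {set G}) : rel G :=
  fun x y => [&& x \notin U, y \notin U, ~~ adj x y & (x \in V true) != (y \in V true)].

Section Count.
Variables (G : graph) (n g : nat) (U : {set G}) (V : bool -> {set G}).
Hypothesis parts : three_parts U V.
Hypothesis cG : #|G| = n.
Hypothesis cU : #|U| = g.

Lemma nbr_crossing b x : x \in V b -> nbr (crossing U V) x = V (~~ b) :\: nbh x.
Proof.
move=> xV; apply/setP => y; rewrite !inE /crossing (parts_notU parts xV) (parts_side parts xV) /=.
rewrite andbCA; congr andb; case: (boolP (y \in U)) => yU /=.
  by case: parts => h _ _; rewrite (disjointFr (h (~~ b)) yU).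
have := parts_class parts yU; case yV: (y \in V true) => yV'.
  by case: (b) => /=; rewrite ?yV // (@parts_notV _ _ _ parts true) ?yV.
by case: (b) => /=; rewrite ?yV ?yV'.
Qed.

Lemma crossing_sym : symmetric (crossing U V).
Proof.
move=> x y; rewrite /crossing adj_sym; case: (x \notin U); case: (y \notin U) => //=.
by congr andb; rewrite eq_sym.
Qed.

Lemma arcn_crossing :
  2 * arcs (V true) (V false) + arcn (crossing U V) = 2 * (#|V true| * #|V false|).
Proof.
rewrite /arcn (parts_sum parts) big1 ?add0n => [|x xU]; last first.
  by apply/eqP; rewrite cards_eq0; apply/eqP/setP => y; rewrite !inE /crossing xU.
rewrite (eq_bigr (fun x => miss x (V false))); last by move=> x xV; rewrite (nbr_crossing xV).
rewrite [X in _ + (_ + X)](eq_bigr (fun x => miss x (V true))); last by move=> x xV; rewrite (nbr_crossing xV).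
have := arcs_miss (V true) (V false); have := arcs_miss (V false) (V true).
rewrite (arcsC (V false)) mulnC; lia.
Qed.

Lemma card_parts : g + #|V true| + #|V false| = n.
Proof.
rewrite -cG -cU -cardsT (parts_card parts [set: G]) !setTI //.
Qed.

(** All missing pairs are kept on the left, since they have to pay for the inner edges on the
    right. *)
Lemma edges_upper :
  2 * #|edges G| + 2 * (\sum_(u in U) miss u (V true) + \sum_(u in U) miss u (V false)) + arcn (crossing U V)
  <= arcs U U + 2 * (g * (n - g)) + 2 * tn (n - g) + arcn (inner U V).
Proof.
have h1 := parts_degree_sum parts; rewrite -card_edges in h1.
have h2 := arcs_miss U (V true); have h3 := arcs_miss U (V false); rewrite cU in h2 h3.
have h4 := arcn_crossing; have h5 := card_parts.
have h6 : #|V true| * #|V false| <= tn (n - g) by apply: mul_le_tn; rewrite -h5 -addnA addKn.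
have e0 : n - g = #|V true| + #|V false| by rewrite -h5 -addnA addKn.
have h7 : g * (n - g) = g * #|V true| + g * #|V false| by rewrite -mulnDr e0.
rewrite h7; move: h1 h2 h3 h4 h6.
move: (arcs _ _) (arcs _ _) (arcs _ _) (arcs _ _) (arcn _) (arcn _) (\sum_(_ in _) _) (\sum_(_ in _) _).
move: (tn _) (#|V true| * #|V false|) (g * #|V true|) (g * #|V false|) #|edges G|; lia.
Qed.

End Count.

Definition target (cst g n : nat) : nat := cst + g * (n - g) + tn (n - g).

(* The upper bound still to be proved once the structure of an extremal graph
   is known. *)
Definition final_bound (B : graph) (cst g : nat) : Prop :=
  exists E, forall n (G : graph) (U : {set G}) (V : bool -> {set G}), E <= n -> #|G| = n -> ~ subgraph B G ->
    three_parts U V -> #|U| = g ->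
    (forall b x, x \in V b -> E * miss x (V (~~ b)) <= n) ->
    (forall u b, u \in U -> E * miss u (V b) <= n) ->
    (forall b, n <= 3 * #|V b|) -> #|edges G| <= target cst g n.

Lemma host_conditions (B G : graph) n E (U : {set G}) (V : bool -> {set G}) :
  6 * #|B| <= E -> 0 < E -> E <= n -> 
  (forall b x, x \in V b -> E * miss x (V (~~ b)) <= n) ->
  (forall u b, u \in U -> E * miss u (V b) <= n) ->
  (forall b, n <= 3 * #|V b|) ->
  [/\ forall b y, y \in V b -> miss y (V (~~ b)) <= n %/ E,
      forall b, #|B| * (n %/ E).+1 <= #|V b| &
      forall u b, u \in U -> miss u (V b) <= n %/ E].
Proof.
move=> BE E0 En hV hU sV; split.
- by move=> b y yV; rewrite leq_divRL // mulnC; apply: hV.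
- by move=> b; apply: (@divn_bound n E 3 #|B|) => //; lia.
- by move=> u b uU; rewrite leq_divRL // mulnC; apply: hU.
Qed.

(** * A criterion for matching-good families *)

Section Criterion.
Variables (H B : graph) (f : H -> B) (c : H -> H -> seq B) (k : H -> bool).
Hypothesis fc : ballooning_by f c.
Hypothesis kH : two_coloring k.
Hypothesis oe : exists xy, xy \in oedges k.

Lemma B_pos : 0 < #|B|.
Proof. by have [[x y] _] := oe; apply/card_gt0P; exists (f x). Qed.

Lemma ballooning_matching_embeds : matching_embeds B #|oedges k|.
Proof. by move=> G C e s M hC cC hM hs; apply: (embed_by_matching fc kH B_pos hC cC hM hs). Qed.

Lemma extremal_bound cst g : center_embeds B g -> final_bound B cst g ->
  exists n0, forall n (G : graph), n0 <= n -> #|G| = n -> ~ subgraph B G ->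
    #|edges G| <= target cst g n.
Proof.
move=> hE [E hF].
(* [target] grows by [g + (n - g)./2] at [n], whence [n <= 2 * #|nbh x| + 1], the 1 being for
   parity. More than [target] edges give the density hypothesis up to [3 * g * g + 1]: the square
   comes from rewriting [n] as [(n - g) + g], the 1 from [tn_lower]. *)
have [n1 h1] := @structure B 1 (3 * g * g + 1) #|B| #|oedges k| g
  (ballooning_colorable3 fc kH) (leqnn _) B_pos ballooning_matching_embeds hE E.
apply: (@progressive_induction B (target cst g) (n1 + E + g + 1)) => n G ln cG noB dG.
case: (leqP #|edges G| (target cst g n)) => // big.
have tS : target cst g n = target cst g n.-1 + g + (n - g)./2.
  rewrite /target; have -> : n - g = (n.-1 - g).+1 by lia.
  by rewrite tnS mulnS; lia.
have [|x||U [V [parts cU hV hU sV]]] := h1 n G _ cG noB.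
- lia.
- have := dG x; rewrite tS; have := odd_double_half (n - g); move: (_./2) (nbh x) => ? ?.
  by case: (odd _) => /=; lia.
- have t4 := tn_lower (n - g).
  have e1 : n * n = (n - g) * (n - g) + 2 * g * (n - g) + g * g.
    have {1 2}-> : n = (n - g) + g by lia.
    by lia.
  have e2 : 2 * g * n = 2 * g * (n - g) + 2 * g * g.
    have {1}-> : n = (n - g) + g by lia.
    by lia.
  rewrite -card_edges e1 e2; move: big; rewrite /target; move: (tn _) t4 #|edges G| => t t4 ed big.
  have e3 : 2 * g * (n - g) = 2 * (g * (n - g)) by lia.
  have e4 : 3 * g * g = 3 * (g * g) by lia.
  have e5 : 2 * g * g = 2 * (g * g) by lia.
  rewrite e3 e4 e5; lia.
- suff : #|edges G| <= target cst g n by rewrite leqNgt big.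
  by apply: (hF n G U V) => //; lia.
Qed.

Variable g : nat.
Hypothesis gF : gammaF (single B) = g.+1.

(** [H1] joined to a Turan graph with [qs] edges added inside one class has exactly [target] edges,
    so apart from the upper bound only the freeness of this join is asked for. *)
Theorem matching_good_criterion (H1 : graph) (qs n2 : nat) :
  center_embeds B g -> final_bound B (#|edges H1| + qs) g ->
  EX g (Bfam (single B)) H1 ->
  (forall n, n2 <= n -> exists (q : rel 'I_n) (qsym : symmetric q) (qirr : irreflexive q),
     [/\ forall x y, q x y -> ~~ odd x && ~~ odd y, arcn q = qs.*2 &
         ~ subgraph B (join H1 (turan_plus qsym qirr))]) ->
  matching_good (single B).
Proof.
move=> hE hF exH lower; split.
  by rewrite (par_ballooning fc kH oe); split=> //; apply: matching_member fc kH oe.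
have [n0 ub] := extremal_bound hE hF.
exists qs.*2, (n0 + n2 + g + 1) => n ln.
have [|q [qsym [qirr [qe cq noB]]]] := lower (n - g); first by lia.
pose H2 := turan_plus qsym qirr.
have [cH1 freeH1 maxH1] := exH.
have cJ : #|join H1 H2| = n by rewrite card_join cH1 card_ord; lia.
have eJ : #|edges (join H1 H2)| = target (#|edges H1| + qs) g n.
  rewrite edges_join cH1 card_ord /target -/H2.
  have := edges_turan_plus qsym qirr qe; rewrite cq -/H2; lia.
exists (join H1 H2), H1, H2; split.
- split=> //.
    move=> K iK sK; apply: noB; apply: subgraph_trans sK.
    exact/iso_subgraph/iso_sym.
  move=> G' cG' fG'; rewrite eJ; apply: ub => //; first by lia.
  by apply: fG'; apply: iso_refl.
- exact: iso_refl.
- by rewrite gF subSS subn0.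
- rewrite (par_ballooning fc kH oe) gF (_ : n - g.+1 + 1 = n - g); last by lia.
  by apply: differs_turan_plus; rewrite cq.
Qed.

End Criterion.

(** * First case: an optimal independent set misses an edge *)

Section EdgeCase.
Variables (H B : graph) (f : H -> B) (c : H -> H -> seq B) (k : H -> bool).
Hypothesis fc : ballooning_by f c.
Hypothesis kH : two_coloring k.
Hypothesis oe : exists xy, xy \in oedges k.
Variables (g : nat) (W : {set H}).
Hypothesis iW : independent W.
Hypothesis cW : cost k W = g.+1.
Hypothesis minW : forall X, independent X -> g.+1 <= cost k X.
Hypothesis mW : exists xy, xy \in missed k W.

Lemma edge_embeds (G : graph) (C : bool -> {set G}) e (U : {set G}) p q :
  (forall b y, y \in C b -> miss y (C (~~ b)) <= e) ->
  (forall b, #|B| * e.+1 <= #|C b|) ->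
  #|U| = g -> (forall u b, u \in U -> miss u (C b) <= e) ->
  adj p q -> p \notin U -> q \notin U ->
  miss p (C false) <= e -> miss q (C false) <= e -> subgraph B G.
Proof.
move=> hC cC cU hU apq pU qU mp mq.
apply: (embed_by_edge fc kH (B_pos f oe) hC cC hU iW _ _ apq) => //.
  by rewrite cU -cW.
by have [xy] := mW; rewrite inE => /andP [? /andP [? ?]]; exists xy.
Qed.

Lemma edge_center_embeds : center_embeds B g.
Proof.
move=> G C e U d L hC cC cU hU dU md Ld LU mL cL.
have /card_gt0P [z zL] : 0 < #|L| by apply: leq_trans cL; apply: (B_pos f oe).
have adz : adj d z by have := subsetP Ld _ zL; rewrite inE.
apply: (edge_embeds hC cC cU hU adz) => //; last exact: mL.
by rewrite (disjointFr LU zL).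
Qed.

Lemma gammaF_edge_case : gammaF (single B) = g.+1.
Proof. exact: (gammaF_ballooning fc kH oe minW iW cW). Qed.

Lemma extremal_Bfree : exists H1, EX g (Bfam (single B)) H1.
Proof.
pose P m := decide (exists K : graph, [/\ #|K| = g, free (Bfam (single B)) K & #|edges K| = m]).
have exP : exists m, P m.
  exists #|edges (edgeless g)|; apply/decideP; exists (edgeless g); split=> //.
    by rewrite card_ord.
  by have := edgeless_Bfree fc kH oe minW iW cW; rewrite subSS subn0.
have ubP m : P m -> m <= g * g by move=> /decideP [K [<- _ <-]]; apply: edges_le_square.
case: (ex_maxnP exP ubP) => m /decideP [K [cK fK <-]] best; exists K; split=> // K' cK' fK'.
by apply: best; apply/decideP; exists K'.
Qed.

Lemma edge_final_bound H1 : EX g (Bfam (single B)) H1 -> final_bound B (#|edges H1| + 0) g.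
Proof.
move=> [cH1 fH1 maxH1]; exists (6 * #|B| + 1) => n G U V En cG noB parts cU hV hU sV.
have [|| hC cC hU'] := host_conditions (B := B) _ _ En hV hU sV; try by lia.
have no_inner : arcn (inner U V) = 0.
  apply/eqP; rewrite -leqn0 leqNgt; apply/negP => /arcn_gt0 [x [y]] /and4P [xU yU axy /eqP sxy].
  apply: noB; pose b := x \in V true.
  have xV := parts_class parts xU; have yV := parts_class parts yU; rewrite -sxy in yV.
  (* The classes are renamed so that [x] and [y] lie in the class [true]. *)
  apply: (@edge_embeds G (fun a => V (a == b)) (n %/ (6 * #|B| + 1)) U x y) => //.
  - by move=> a z zV; have := hC _ _ zV; case: (a); case: (b).
  - by move=> u a uU; apply: hU'.
  - by have := hC _ _ xV; rewrite -/b; case: (b).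
  - by have := hC _ _ yV; rewrite -/b; case: (b).
have UB : arcs U U <= 2 * #|edges H1|.
  rewrite -edges_induced mul2n leq_double; apply: maxH1.
    by rewrite card_sig (eq_card (B := U)).
  move=> K BK sK; move: BK; rewrite /Bfam gammaF_edge_case; case: ifP => _.
    move=> iK; have [j ji _] := subgraph_trans (iso_subgraph (iso_sym iK)) sK.
    by have := leq_card j ji; rewrite card_ord card_sig (eq_card (B := U)) // cU ltnn.
  move=> [M [S [dM cS ltS iK]]]; apply: noB.
  apply: (embed_Bfam fc kH oe hC cC hU' dM cS).
  exact: subgraph_trans (iso_subgraph (iso_sym iK)) sK.
have := edges_upper parts cG cU; rewrite no_inner /target; lia.
Qed.

(** By [Bfam_of_embedding], a copy of [B] would put some [M[S]] with [#|S| <= g] into [H1]. This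
    contradicts the value of [betaF] if it equals [gammaF], and the freeness of [H1] otherwise. *)
Lemma edge_lower H1 n : EX g (Bfam (single B)) H1 ->
  exists (q : rel 'I_n) (qsym : symmetric q) (qirr : irreflexive q),
     [/\ forall x y, q x y -> ~~ odd x && ~~ odd y, arcn q = 0.*2 &
         ~ subgraph B (join H1 (turan_plus qsym qirr))].
Proof.
move=> [cH1 fH1 _]; exists (fun _ _ => false).
have qs : symmetric (fun _ _ : 'I_n => false) by [].
have qi : irreflexive (fun _ _ : 'I_n => false) by [].
exists qs, qi; split=> //.
  by rewrite /arcn big1 // => x _; apply/eqP; rewrite cards_eq0; apply/eqP/setP => y; rewrite !inE.
set G := join _ _; pose U : {set G} := [set x | if x is inl _ then true else false].
move=> sB; have [|M [S [dM cS leS sS]]] := @Bfam_of_embedding H B f c k fc kH oe G U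
    (fun x => if x is inr i then odd i else true) _ sB.
- move=> [x|x] [y|y]; rewrite !inE // => _ _.
  by rewrite /adj /= /turan_plus_rel turan2E orbF.
have cU : #|U| = g.
  rewrite -cH1 -(card_imset (mem H1) (@inl_inj H1 (turan_plus qs qi))).
  apply: eq_card => x; rewrite inE; apply/idP/imsetP => [|[y _ ->] //].
  by case: x => [y|y] // _; exists y.
have UH : subgraph (induced U) H1.
  have hU (x : induced U) : exists y, val x = inl y.
    by have := valP x; rewrite inE; case: (val x) => // y _; exists y.
  pose j (x : induced U) : H1 := sval (sig_eqW (hU x)).
  have jP x : val x = inl (j x) := svalP (sig_eqW (hU x)).
  exists j => [x y e|x y a]; first by apply: val_inj; rewrite !jP e.
  by have : adj (val x) (val y) := a; rewrite !jP.
rewrite cU in leS.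
move: (fH1 (induced S)); rewrite /Bfam gammaF_edge_case; case: ifP => [/eqP e _|_ h].
  by have := betaF_le dM cS; rewrite e ltnNge leS.
apply: h; last exact: subgraph_trans sS UH.
by exists M, S; split=> //; apply: iso_refl.
Qed.

Theorem edge_case : matching_good (single B).
Proof.
have [H1 exH] := extremal_Bfree.
apply: (matching_good_criterion fc kH oe gammaF_edge_case edge_center_embeds (edge_final_bound exH) exH (n2 := 0)).
by move=> n _; apply: edge_lower.
Qed.

End EdgeCase.

(** * Second case: a colour class is optimal *)

Lemma edges_complete g : (#|edges (complete g)|).*2 = g * g.-1.
Proof.
rewrite card_edges (eq_bigr (fun=> g.-1)); first by rewrite sum_nat_const card_ord.
move=> x _; have e : nbh (x : complete g) = [set~ (x : 'I_g)].
  by apply/setP => y; rewrite in_nbh !inE eq_sym.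
by rewrite e cardsC1 card_ord.
Qed.

Lemma arcs_self_le (G : graph) (U : {set G}) : arcs U U <= #|U| * #|U|.-1.
Proof.
rewrite /arcs -sum_nat_const; apply: leq_sum => x xU; rewrite (cardsD1 x U) xU /=.
by apply/subset_leq_card/subsetP => y; rewrite !inE => /andP [a ->]; rewrite eq_sym (adj_neq a).
Qed.

Lemma arcn_pairs (T : finType) (q : rel T) : arcn q = #|[set p : T * T | q p.1 p.2]|.
Proof.
rewrite -sum1_card (eq_bigl (fun p => true && q p.1 p.2)); last by move=> p; rewrite inE.
rewrite -(pair_big_dep xpredT (fun x y => q x y) (fun _ _ => 1)) /=.
by apply: eq_bigr => x _; rewrite sum1_card cardsE.
Qed.

Section LowerGraph.
Variables (D m : nat) (P : 'I_D -> 'I_D -> bool).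
Hypothesis Dm : 4 * D <= m.

Lemma left_proof (a : 'I_D) : 4 * a < m. Proof. by have := ltn_ord a; lia. Qed.
Lemma right_proof (a : 'I_D) : 4 * a + 2 < m. Proof. by have := ltn_ord a; lia. Qed.

(** The residues 0 and 2 modulo 4 keep the two sides of the block disjoint and both within the even
    class of the Turan graph. *)
Definition lefts (a : 'I_D) : 'I_m := Ordinal (left_proof a).
Definition rights (a : 'I_D) : 'I_m := Ordinal (right_proof a).

Lemma lefts_inj : injective lefts.
Proof. by move=> a b [e]; apply: val_inj; move: e => /=; lia. Qed.

Lemma rights_inj : injective rights.
Proof. by move=> a b [e]; apply: val_inj; move: e => /=; lia. Qed.

Lemma left_right a b : lefts a != rights b.
Proof. by rewrite -val_eqE /=; apply/eqP; lia. Qed.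

Definition block_rel : rel 'I_m := fun x y =>
  [exists a, exists b, P a b && (((x == lefts a) && (y == rights b)) || ((y == lefts a) && (x == rights b)))].

Lemma block_relP x y : reflect
  (exists a b, P a b /\ ((x = lefts a /\ y = rights b) \/ (y = lefts a /\ x = rights b))) (block_rel x y).
Proof.
apply: (iffP existsP) => [[a /existsP [b /andP [p /orP [] /andP [/eqP e1 /eqP e2]]]]|[a [b [p e]]]].
- by exists a, b; split=> //; left.
- by exists a, b; split=> //; right.
exists a; apply/existsP; exists b; rewrite p /=.
by case: e => [] [-> ->]; rewrite !eqxx ?orbT.
Qed.

Lemma block_sym : symmetric block_rel.
Proof.
by move=> x y; apply/block_relP/block_relP => -[a [b [p [] e]]]; exists a, b; split; auto.
Qed.

Lemma block_irr : irreflexive block_rel.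
Proof.
move=> x; apply/block_relP => -[a [b [_ [] [-> /eqP]]]]; exact/negP/left_right.
Qed.

Lemma block_even x y : block_rel x y -> ~~ odd x && ~~ odd y.
Proof.
have o1 a : ~~ odd (lefts a) by rewrite /= oddM.
have o2 a : ~~ odd (rights a) by rewrite /= oddD oddM.
by case/block_relP => a [b [_ [] [-> ->]]]; rewrite o1 o2.
Qed.

Lemma block_arcs : arcn block_rel = (#|[set p : 'I_D * 'I_D | P p.1 p.2]|).*2.
Proof.
set S := [set _ | _].
rewrite arcn_pairs.
pose F (p : 'I_D * 'I_D) := (lefts p.1, rights p.2).
pose F' (p : 'I_D * 'I_D) := (rights p.2, lefts p.1).
have Fi : injective F.
  move=> [a b] [a' b'] e; congr pair; first exact/lefts_inj/(congr1 fst e).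
  exact/rights_inj/(congr1 snd e).
have Fi' : injective F'.
  move=> [a b] [a' b'] e; congr pair; first exact/lefts_inj/(congr1 snd e).
  exact/rights_inj/(congr1 fst e).
rewrite -addnn -{1}(card_imset S Fi) -(card_imset S Fi') -cardsUI (_ : _ :&: _ = set0).
  rewrite cards0 addn0; apply: eq_card => -[x y]; rewrite !inE /=.
  apply/block_relP/orP => [[a [b [p [] [-> ->]]]]|[] /imsetP [[a b]]].
  - by left; apply/imsetP; exists (a, b); rewrite ?inE.
  - by right; apply/imsetP; exists (a, b); rewrite ?inE.
  - by rewrite inE => p [-> ->]; exists a, b; split; [|left].
  - by rewrite inE => p [-> ->]; exists a, b; split; [|right].
apply/setP => p; rewrite in_setI in_set0; apply/negbTE/negP => /andP [].
move=> /imsetP [[a b] _ ->] /imsetP [[a' b'] _ /(congr1 fst) /eqP].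
by apply/negP/left_right.
Qed.

End LowerGraph.

Section StarCase.
Variables (H B : graph) (f : H -> B) (c : H -> H -> seq B) (k : H -> bool).
Hypothesis fc : ballooning_by f c.
Hypothesis kH : two_coloring k.
Hypothesis oe : exists xy, xy \in oedges k.
Variables (g D : nat) (a0 : H).
Hypothesis ka0 : k a0.
Hypothesis dega0 : #|nbh a0| = D.+1.
Hypothesis D0 : 0 < D.
Let A := [set x | k x].
Hypothesis cA : #|A| = g.+1.
Hypothesis minc : forall X, g.+1 <= cost k X.

Lemma class_independent : independent A.
Proof. by move=> x y; rewrite !inE => kx ky; apply/negP => /kH; rewrite kx ky. Qed.

Lemma class_cost : cost k A = g.+1.
Proof.
rewrite /cost cA (_ : missed k A = set0) ?cards0 ?addn0 //.
by apply/setP => -[x y]; rewrite !inE /oriented; case: (k x); rewrite ?andbF.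
Qed.

Lemma gammaF_star : gammaF (single B) = g.+1.
Proof. exact: (gammaF_ballooning fc kH oe (fun X _ => minc X) class_independent class_cost). Qed.

Lemma betaF_star : betaF (single B) = g.+1.
Proof.
exact: (betaF_ballooning fc kH oe class_independent class_cost minc).
Qed.

(** Here [betaF] equals [gammaF], so only the complete graph on [g + 1] vertices is forbidden. *)
Lemma complete_extremal : EX g (Bfam (single B)) (complete g).
Proof.
split; first by rewrite card_ord.
  move=> K; rewrite /Bfam betaF_star gammaF_star eqxx => iK sK.
  have [j ji _] := subgraph_trans (iso_subgraph (iso_sym iK)) sK.
  by have := leq_card j ji; rewrite !card_ord ltnn.
move=> G' cG' _; rewrite -leq_double edges_complete card_edges -cG' -cardsT.
have := arcs_self_le [set: G']; rewrite /arcs; apply: leq_trans.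
by rewrite [X in _ <= X](eq_bigl xpredT) => [|x]; [apply: leq_sum => x _; rewrite setIT | rewrite inE].
Qed.

Let W := A :\ a0.

Lemma card_W : #|W| = g.
Proof. by apply/eqP; rewrite -eqSS -cA (cardsD1 a0 A) inE ka0. Qed.

Lemma star_center_embeds : center_embeds B g.
Proof.
move=> G C e U d L hC cC cU hU dU md Ld LU mL cL.
have BP := B_pos f oe.
have cWU : #|W| = #|U| by rewrite card_W.
have cov0 : cov (@id G) = set0 := cov_id G.
apply: (@embed_star_at_vertex H B f c k fc kH BP G C e U hC cC hU (fun _ => true) id _ _ a0 ka0 cWU _ d L) => //.
- exact: matching_id.
- by move=> x; rewrite cov0 inE.
- by rewrite cov0 disjoints_subset sub0set.
- by rewrite cov0 inE.
- by rewrite cov0 disjoint_sym disjoints_subset sub0set.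
- rewrite cov0 cards0 addn0 leq_mul2l /=; apply: leq_trans cL.
  apply: leq_trans (max_card _) _; exact: (leq_card f (balloon_inj fc)).
Qed.

Definition block_alternative (G : graph) (U : {set G}) (V : bool -> {set G}) : Prop :=
  exists (L R : {set G}) (b : bool),
    [/\ #|L| = D, #|R| = D, [disjoint L & R], (L \subset V b) && (R \subset V b) &
      forall u v, inner U V u v -> (u \in L) && (v \in R) || (u \in R) && (v \in L)].

Section Host.
Variables (G : graph) (n E : nat) (U : {set G}) (V : bool -> {set G}).
Hypothesis noB : ~ subgraph B G.
Hypothesis parts : three_parts U V.
Hypothesis cU : #|U| = g.
Variable e : nat.
Hypothesis hC : forall b y, y \in V b -> miss y (V (~~ b)) <= e.
Hypothesis cC : forall b, #|B| * e.+1 <= #|V b|.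
Hypothesis hU : forall u b, u \in U -> miss u (V b) <= e.

Lemma inner_matching M : matching (inner U V) M -> #|cov M| <= D.*2.
Proof.
move=> hM; rewrite leqNgt; apply/negP => big; apply: noB.
have cWU : #|W| = #|U| by rewrite card_W.
have covU x : x \in cov M -> x \notin U by move=> /(matching_edge hM) /and4P [].
apply: (@embed_matching_at_vertex H B f c k fc kH (B_pos f oe) G V e U hC cC hU
   (fun x => x \in V true) M _ _ a0 cWU).
- by apply: sub_matching hM => x y /and4P [_ _ -> ->].
- by move=> x /covU xU; apply: hC (parts_class parts xU).
- by apply/pred0P => x; apply/negbTE/negP => /= /andP [/covU /negbTE ->].
- by rewrite dega0; move: big; rewrite (card_cov hM); lia.
Qed.

Lemma inner_star x (J : {set G}) M :
  J \subset nbr (inner U V) x -> matching (inner U V) M -> x \notin cov M -> [disjoint J & cov M] ->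
  (forall z, z \in cov M -> (z \in V true) != (x \in V true) ->
     ~~ (crossing U V x z && crossing U V x (M z))) ->
  2 * #|J| + #|cov M| <= D.*2.
Proof.
move=> Jx hM xM JM unb.
(* For empty [J] the vertex [x] may lie in [U]; then the matching alone gives the bound. *)
have [J0|/set0Pn [j0 j0J]] := eqVneq J set0; first by rewrite J0 cards0 inner_matching.
rewrite leqNgt; apply/negP => big; apply: noB.
have /and4P [xU _ _ _] : inner U V x j0 by have := subsetP Jx _ j0J; rewrite inE.
have JP z : z \in J -> [/\ z \notin U, adj x z & (z \in V true) = (x \in V true)].
  by move=> /(subsetP Jx); rewrite inE => /and4P [_ ? ? /eqP].
have cWU : #|W| = #|U| by rewrite card_W.
have MP z : z \in cov M -> [/\ z \notin U, M z \notin U, adj z (M z) & (z \in V true) = (M z \in V true)].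
  by move=> /(matching_edge hM) /and4P [? ? ? /eqP].
pose sx := x \in V true.
have xV : x \in V sx := parts_class parts xU.
(* Renaming of the classes that puts [x] into the class [true]. *)
pose C b := V (b == sx).
have Cne b : C (~~ b) = V (~~ (b == sx)) by rewrite /C; case: (b); case: (sx).
apply: (@embed_star_at_vertex H B f c k fc kH (B_pos f oe) G C e U _ _ _
   (fun z => (z \in V true) == sx) M _ _ a0 ka0 cWU _ x J) => //.
- by move=> b y yC; rewrite Cne; apply: hC.
- by move=> b; apply: cC.
- by move=> u b; apply: hU.
- by apply: sub_matching hM => u v /and4P [_ _ -> /eqP ->]; rewrite eqxx.
- move=> z zM; have [zU _ _ _] := MP _ zM; have zV := parts_class parts zU.
  by rewrite Cne; have := hC zV; case: (z \in V true); case: (sx).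
- by apply/pred0P => z; apply/negbTE/negP => /= /andP [/MP [/negbTE ->]].
- by have := hC xV; rewrite /C; case: (sx).
- by apply/subsetP => z /JP [_ + _]; rewrite inE.
- by apply/pred0P => z; apply/negbTE/negP => /= /andP [/JP [/negbTE ->]].
- move=> z /JP [zU _ sz]; have zV := parts_class parts zU; have := hC zV.
  by rewrite sz -/sx /C; case: (sx).
- move=> z zM /negbT sz; have [zU MzU _ szM] := MP _ zM.
  have := unb _ zM sz; rewrite /crossing xU zU MzU -szM /= -/sx eq_sym sz !andbT.
  by rewrite negb_and !negbK.
- by rewrite dega0; move: big; rewrite (card_cov hM); lia.
Qed.

Lemma inner_arcs_bound :
  arcn (inner U V) <= 2 * (D * D.-1 + 1) + arcn (crossing U V) \/ block_alternative U V.
Proof.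
have q_side x y : inner U V x y -> (x \in V true) = (y \in V true) by move=> /and4P [_ _ _ /eqP].
have m_side x y : crossing U V x y -> (x \in V true) != (y \in V true) by move=> /and4P [].
have [|[L [R [b [cL cR dLR sLR hLR]]]]] := split_star_bound (@inner_sym _ U V) (@inner_irr _ U V) q_side
  (@crossing_sym _ U V) m_side inner_matching inner_star.
  by left.
right; exists L, R, b; split=> //; apply/andP; split; apply/subsetP => z zL.
  by have [|<- [w /and4P [zU _ _ _]]] := sLR z; [rewrite zL | exact: (parts_class parts)].
by have [|<- [w /and4P [zU _ _ _]]] := sLR z; [rewrite zL orbT | exact: (parts_class parts)].
Qed.

End Host.

(** The inequality left for the exceptional outcome of [split_star_bound]; here pairs missing inside
    [U] and at [U] can pay as well. *)
Definition block_bound (qs : nat) : Prop :=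
  forall (G : graph) (e : nat) (U : {set G}) (V : bool -> {set G}),
    ~ subgraph B G -> three_parts U V -> #|U| = g ->
    (forall b y, y \in V b -> miss y (V (~~ b)) <= e) ->
    (forall b, #|B| * e.+1 <= #|V b|) ->
    (forall u b, u \in U -> miss u (V b) <= e) ->
    block_alternative U V ->
    arcs U U + arcn (inner U V) <= g * g.-1 + 2 * qs + arcn (crossing U V) +
      2 * (\sum_(u in U) miss u (V true) + \sum_(u in U) miss u (V false)).

Lemma star_final_bound qs : D * D.-1 + 1 <= qs -> block_bound qs ->
  final_bound B (#|edges (complete g)| + qs) g.
Proof.
move=> hqs alt; exists (6 * #|B| + 1) => n G U V En cG noB parts cU hV hU sV.
have [|| hC cC hU'] := host_conditions (B := B) _ _ En hV hU sV; try by lia.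
have eu := edges_upper parts cG cU; have eg := edges_complete g.
have sU := arcs_self_le U; rewrite cU in sU.
suff : arcs U U + arcn (inner U V) <= g * g.-1 + 2 * qs + arcn (crossing U V) +
      2 * (\sum_(u in U) miss u (V true) + \sum_(u in U) miss u (V false)).
  by rewrite /target; lia.
have [bd|bd] := inner_arcs_bound noB parts cU hC cC hU'; last exact: (alt G _ U V noB parts cU hC cC hU' bd).
by lia.
Qed.

(** Without the complete part and [X] the host is bipartite by parity, so at most [g + #|X|]
    vertices of the copy meet all its odd cycles. *)
Lemma cover_cost n (q : rel 'I_n) (qs : symmetric q) (qi : irreflexive q)
    (j : B -> join (complete g) (turan_plus qs qi)) (X : {set 'I_n}) :
  injective j -> (forall v w, adj v w -> adj (j v) (j w)) ->
  (forall x y, q x y -> (x \in X) || (y \in X)) ->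
  cost k [set x | match j (f x) with inl _ => true | inr i => i \in X end] <= g + #|X|.
Proof.
move=> ji ja qX.
pose Z := [set v | match j v with inl _ => true | inr i => i \in X end].
have -> : [set x | match j (f x) with inl _ => true | inr i => i \in X end] = [set x | f x \in Z].
  by apply/setP => x; rewrite !inE.
apply: leq_trans (hitting_cost fc oe (col := fun v => match j v with inl _ => true | inr i => odd i end) _) _.
  move=> v w; rewrite !inE => + + /ja; case: (j v) => // x; case: (j w) => // y xX yX /=.
  by rewrite /adj /= /turan_plus_rel turan2E => /orP [//|/qX]; rewrite (negbTE xX) (negbTE yX).
rewrite -(card_imset Z ji) -[X in X + _]card_ord -cardsT.
rewrite -(card_imset [set: 'I_g] (@inl_inj 'I_g 'I_n)) -(card_imset X (@inr_inj 'I_g 'I_n)).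
apply: leq_trans (leq_card_setU _ _); apply/subset_leq_card/subsetP => y /imsetP [v vZ ->].
move: vZ; rewrite !inE; case: (j v) => x xX; apply/orP.
  by left; rewrite imset_f ?inE.
by right; rewrite imset_f.
Qed.

Theorem star_matching_good (P : 'I_D -> 'I_D -> bool) :
  D * D.-1 + 1 <= #|[set p | P p.1 p.2]| -> block_bound #|[set p | P p.1 p.2]| ->
  (forall m (Dm : 4 * D <= m), ~ subgraph B (join (complete g)
     (turan_plus (@block_sym D m P Dm) (@block_irr D m P Dm)))) ->
  matching_good (single B).
Proof.
move=> hqs alt lower.
apply: (matching_good_criterion fc kH oe gammaF_star star_center_embeds (star_final_bound hqs alt)
  complete_extremal (n2 := 4 * D)) => n Dn.
exists (block_rel P Dn), (@block_sym D n P Dn), (@block_irr D n P Dn); split; last exact: lower.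
- exact: block_even.
- exact: block_arcs.
Qed.

End StarCase.

Section BlockCover.
Variables (D m : nat) (P : 'I_D -> 'I_D -> bool).
Hypothesis Dm : 4 * D <= m.

Lemma lefts_cover x y : block_rel P Dm x y ->
  (x \in lefts Dm @: setT) || (y \in lefts Dm @: setT).
Proof. by case/block_relP => a [b [_ [] [-> ->]]]; rewrite (imset_f _ (in_setT a)) ?orbT. Qed.

Lemma rights_cover x y : block_rel P Dm x y ->
  (x \in rights Dm @: setT) || (y \in rights Dm @: setT).
Proof. by case/block_relP => a [b [_ [] [-> ->]]]; rewrite (imset_f _ (in_setT b)) ?orbT. Qed.

Lemma card_lefts : #|lefts Dm @: setT| = D.
Proof. by rewrite card_imset ?cardsT ?card_ord //; apply: lefts_inj. Qed.

Lemma card_rights : #|rights Dm @: setT| = D.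
Proof. by rewrite card_imset ?cardsT ?card_ord //; apply: rights_inj. Qed.

End BlockCover.

(** * Trees *)

Section Forest.
Variable H : graph.
Hypothesis acyclic : forall s : seq H, 2 < size s -> ~ ucycle (@adj H) s.

(** Take an end of a longest path inside [S]: its neighbours in [S] lie on the path, and any but the
    next vertex would close a cycle. *)
Lemma forest_leaf (S : {set H}) : S != set0 -> exists2 x, x \in S & #|nbh x :&: S| <= 1.
Proof.
case/set0Pn => x0 x0S.
pose P m := decide (exists x p, [/\ path (@adj H) x p, uniq (x :: p), all (mem S) (x :: p) & size p = m]).
have exP : exists m, P m by exists 0; apply/decideP; exists x0, [::]; rewrite /= x0S.
have ubP m : P m -> m <= #|H|.
  by move=> /decideP [x [p [_ u _ <-]]]; rewrite -(card_uniqP _) ?max_card //; case/andP: u.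
case: (ex_maxnP exP ubP) => m /decideP [x [p [xp u aS sp]]] best.
have xS : x \in S by case/andP: aS.
exists x => //.
have np y : y \in nbh x :&: S -> y \in p.
  rewrite in_setI in_nbh => /andP [axy yS]; apply: contraT => yp.
  have : P m.+1.
    apply/decideP; exists y, (x :: p); split; last by rewrite /= sp.
    - by rewrite /= adj_sym axy.
    - by rewrite cons_uniq u inE (negbTE yp) orbF eq_sym (adj_neq axy).
    - by rewrite /= yS.
  by move/best; rewrite ltnn.
case: p => [|h p] in xp u aS sp np *.
  by rewrite (_ : _ :&: _ = set0) ?cards0 //; apply/setP => y; rewrite in_set0; apply/negP => /np.
rewrite -(cards1 h); apply/subset_leq_card/subsetP => y yN; rewrite inE; have := np y yN.
rewrite inE => /orP [//|yp]; exfalso.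
move: xp u; case/splitPr: yp => p1 p2; rewrite -cat_rcons -cat_cons => xp u.
apply: (acyclic (s := x :: h :: rcons p1 y)); first by rewrite /= size_rcons.
rewrite /ucycle; move: xp u; rewrite cat_path -cat_cons cat_uniq => /andP [xp _] /andP [u _].
rewrite u andbT /cycle rcons_path xp /= last_rcons adj_sym.
by move: yN; rewrite in_setI in_nbh => /andP [].
Qed.

Lemma forest_arcs (S : {set H}) : arcs S S <= 2 * #|S|.-1.
Proof.
move: {2}#|S| (leqnn #|S|) => n; elim: n S => [|n IH] S cS.
  by rewrite /arcs big1 // => x xS; move: cS; rewrite (cardsD1 x) xS.
have [->|/forest_leaf [x xS dx]] := eqVneq S set0; first by rewrite /arcs big_set0.
have e : #|S| = #|S :\ x|.+1 by rewrite (cardsD1 x) xS.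
have := IH (S :\ x); rewrite e ltnS in cS => /(_ cS) h.
have h2 : arcs S S = 2 * #|nbh x :&: S| + arcs (S :\ x) (S :\ x).
  rewrite /arcs (big_setD1 x xS) /= mul2n -addnn -addnA; congr addn.
  have -> : #|nbh x :&: S| = \sum_(y in S :\ x) (adj x y : nat).
    by rewrite card_nbhI (big_setD1 x xS) /= adj_irr.
  rewrite -big_split /=; apply: eq_bigr => y _.
  rewrite (cardsD1 x (nbh y :&: S)) in_setI in_nbh xS andbT adj_sym; congr addn.
  by apply: eq_card => z; rewrite !inE; case: (z == x); rewrite ?andbF.
have [z|/set0Pn [z zS]] := eqVneq (S :\ x) set0.
  have S1 : #|nbh x :&: S| = 0.
    apply/eqP; rewrite cards_eq0; apply/eqP/setP => y; rewrite in_setI in_nbh in_set0.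
    apply/negbTE/negP => /andP [a yS]; have : y \in S :\ x by rewrite !inE yS eq_sym (adj_neq a).
    by rewrite z inE.
  by rewrite h2 S1 z /arcs big_set0.
have p1 : 0 < #|S :\ x| by apply/card_gt0P; exists z.
by rewrite e h2; lia.
Qed.

Lemma forest_coloring : exists k : H -> bool, two_coloring k.
Proof.
suff h n (S : {set H}) : #|S| <= n -> exists k : H -> bool, {in S &, forall x y, adj x y -> k x != k y}.
  by have [k hk] := h #|[set: H]| [set: H] (leqnn _); exists k => x y; apply: hk; rewrite inE.
elim: n S => [|n IH] S cS.
  exists xpredT => x y xS; move: cS; rewrite leqn0 cards_eq0 => /eqP S0; by move: xS; rewrite S0 inE.
have [->|/forest_leaf [x xS dx]] := eqVneq S set0; first by exists xpredT => x y; rewrite inE.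
have [|k hk] := IH (S :\ x); first by move: cS; rewrite (cardsD1 x) xS.
pose b := if [pick y in nbh x :&: S] is Some y then ~~ k y else true.
have hb y : y \in S -> adj x y -> b != k y.
  move=> yS a; have yN : y \in nbh x :&: S by rewrite in_setI in_nbh a.
  rewrite /b; case: pickP => [z zN|/(_ y)]; last by rewrite yN.
  have -> : z = y by move/card_le1_eqP: dx; apply.
  by case: (k y).
exists (fun y => if y == x then b else k y) => u v uS vS a.
case: (eqVneq u x) => [e|ux]; case: (eqVneq v x) => [e'|vx].
- by move: a; rewrite e e' adj_irr.
- by subst u; apply: hb.
- by subst v; rewrite eq_sym; apply: hb => //; rewrite adj_sym.
- by apply: hk => //; rewrite !inE ?ux ?vx.
Qed.

(* Count the edges between [S] and its neighbourhood twice: from [S] there are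
   at least [(D + 1) |S|], and a forest leaves room for [|S| + |N(S)| - 1]. *)
Lemma forest_expansion (S N : {set H}) D : S != set0 -> [disjoint S & N] ->
  (forall x, x \in S -> nbh x \subset N) -> (forall x, x \in S -> D.+1 <= #|nbh x|) ->
  D * #|S| + 1 <= #|N|.
Proof.
move=> S0 dSN sN dS; have cS : 0 < #|S| by rewrite card_gt0.
have := forest_arcs (S :|: N); rewrite cardsU (disjoint_setI0 dSN) cards0 subn0.
have h1 : \sum_(x in S) #|nbh x| + arcs N S <= arcs (S :|: N) (S :|: N).
  rewrite [X in _ <= X](eq_bigl [predU S & N]) => [|z]; last by rewrite !inE.
  rewrite bigU //=; apply: leq_add; apply: leq_sum => x xS.
    by rewrite (setIidPl _) // (subset_trans (sN x xS)) // subsetUr.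
  by apply/subset_leq_card/setIS/subsetUl.
have h2 : arcs N S = \sum_(x in S) #|nbh x|.
  by rewrite arcsC; apply: eq_bigr => x xS; rewrite (setIidPl _) // sN.
have h3 : D.+1 * #|S| <= \sum_(x in S) #|nbh x|.
  by rewrite mulnC -sum_nat_const; apply: leq_sum.
rewrite h2 in h1; rewrite mulSn in h3; lia.
Qed.

End Forest.

Section Tree.
Variables (H B : graph) (f : H -> B) (c : H -> H -> seq B).
Hypothesis fc : ballooning_by f c.
Hypothesis tree : is_tree H.
Hypothesis H2 : 1 < #|H|.

Lemma tree_degree (x : H) : 0 < #|nbh x|.
Proof.
have [y yx] : exists y, y != x.
  by apply/existsP; rewrite -[[exists _, _]]negbK negb_exists; apply: contraTN H2 => /forallP h;
     rewrite -leqNgt -(card1 x); apply/subset_leq_card/subsetP => y _; have := h y; rewrite negbK inE.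
case: tree => _ /(_ x y) /connectP [[|z p] /= hp e] _; first by rewrite e eqxx in yx.
by apply/card_gt0P; exists z; rewrite in_nbh; case/andP: hp.
Qed.

Lemma tree_oedges k : two_coloring k -> exists xy, xy \in oedges (H := H) k.
Proof.
move=> kH; case: tree => /card_gt0P [x _] _ _; have /card_gt0P [y] := tree_degree x.
rewrite in_nbh => /(orient kH) /orP [] o; [exists (x, y) | exists (y, x)]; by rewrite inE.
Qed.

Section Stars.
Variables (k : H -> bool) (D : nat).
Hypothesis kH : two_coloring k.
Let A := [set x | k x].
Hypothesis dA : forall x, x \in A -> D.+1 <= #|nbh x|.

(** With [S] the part of [A] outside [X], each vertex of its neighbourhood [N] is in [X] or gives a
    missed edge. The cost is thus at least [#|A| - #|S| + #|N|], and [forest_expansion] bounds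
    [#|N|]. *)
Lemma tree_cost (X : {set H}) : ~~ (A \subset X) -> 0 < D -> #|A| + D <= cost k X.
Proof.
move=> nAX D0; pose S := A :\: X; pose N := \bigcup_(x in S) nbh x.
have S0 : S != set0 by rewrite setD_eq0.
have SA x : x \in S -> x \in A by rewrite in_setD => /andP [].
have NA y : y \in N -> y \notin A.
  by case/bigcupP => x /SA; rewrite in_nbh !inE => kx /kH; rewrite kx; case: (k y).
have dSN : [disjoint S & N].
  by apply/pred0P => y; apply/negbTE/negP => /= /andP [/SA + /NA /negP].
have [_ _ acyclic] := tree.
have ex : D * #|S| + 1 <= #|N|.
  apply: (forest_expansion acyclic S0 dSN) => x xS; last exact/dA/SA.
  by apply/subsetP => y xy; apply/bigcupP; exists x.
have cS : 0 < #|S| by rewrite card_gt0.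
have h1 : #|A :&: X| + #|N :&: X| <= #|X|.
  rewrite -cardsUI (_ : (A :&: X) :&: (N :&: X) = set0) ?cards0 ?addn0.
    by rewrite subset_leq_card // subUset !subsetIr.
  by apply/setP => y; rewrite !in_setI in_set0; case: (boolP (y \in N)) => [/NA /negbTE ->|]; rewrite ?andbF.
have h2 : #|N :\: X| <= #|missed k X|.
  apply: leq_trans (leq_imset_card snd _).
  apply/subset_leq_card/subsetP => y /setDP [/bigcupP [x xS xy] yX].
  apply/imsetP; exists (x, y) => //; move: (xS); rewrite in_setD => /andP [xX xA].
  move: xy xA; rewrite in_nbh inE => a kx; rewrite !inE /= xX yX !andbT /oriented a kx.
  by have := kH a; rewrite kx; case: (k y).
have e1 := cardsID X A; have e2 := cardsID X N; rewrite -/S in e1.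
have e3 : D + #|S| <= D * #|S| + 1 by clear -D0 cS; nia.
rewrite /cost; lia.
Qed.

End Stars.

Lemma tree_blocks_bound g D : block_bound B g D (D * D).
Proof.
move=> G e U V _ _ cU _ _ _ [L [R [b [cL cR _ _ hLR]]]].
have sU := arcs_self_le U; rewrite cU in sU.
suff : arcn (inner U V) <= 2 * (D * D) by lia.
rewrite arcn_pairs; apply: leq_trans (_ : #|setX L R :|: setX R L| <= _).
  by apply/subset_leq_card/subsetP => -[x y]; rewrite !inE => /hLR.
by apply: leq_trans (leq_card_setU _ _) _; rewrite !cardsX cL cR; lia.
Qed.

Theorem tree_matching_good : matching_good (single B).
Proof.
have [_ _ acyclic] := tree; have [k kH] := forest_coloring acyclic.
have oe := tree_oedges kH.
pose ind (W : {set H}) := decide (independent W).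
have i0 : ind set0 by apply/decideP => x y; rewrite inE.
have [W /decideP iW best] := arg_minnP (cost k) i0.
have {}best X : independent X -> cost k W <= cost k X by move=> iX; apply/best/decideP.
have cost0 X : 0 < cost k X.
  have [[x y] xy] := oe; rewrite /cost; have [->|] := eqVneq X set0; last by rewrite -card_gt0; lia.
  by rewrite cards0 add0n; apply/card_gt0P; exists (x, y); rewrite !inE /= andbT; rewrite inE in xy.
case: (excluded_middle_informative (exists W', [/\ independent W', cost k W' = cost k W & missed k W' != set0])).
  move=> [W' [iW' cW' /set0Pn mW']].
  apply: (@edge_case H B f c k fc kH oe (cost k W).-1 W' iW' _ _ mW'); rewrite prednK //.
move=> opt; have {}opt X : independent X -> cost k X <= cost k W -> missed k X = set0.
  move=> iX le; apply/eqP; apply: contraT => mX; case: opt; exists X; split=> //.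
  by apply/eqP; rewrite eqn_leq le best.
have mW := opt W iW (leqnn _).
have cW : cost k W = #|W| by rewrite /cost mW cards0 addn0.
(* [W] is independent and no edge misses it, so it is a colour class of a new proper colouring. *)
pose k' x := x \in W.
have k'H : two_coloring k'.
  move=> x y a; rewrite /k'; have := iW x y; rewrite a.
  have : (x \in W) || (y \in W).
    apply: contraT; rewrite negb_or => /andP [xW yW].
    case/orP: (orient kH a) => o.
      have : (x, y) \in missed k W by rewrite !inE /= o xW yW.
      by rewrite mW inE.
    have : (y, x) \in missed k W by rewrite !inE /= o xW yW.
    by rewrite mW inE.
  by case: (x \in W); case: (y \in W) => // _ /(_ isT isT).
have eW : [set x | k' x] = W by apply/setP => x; rewrite inE.
(* Dropping a vertex of degree at most 1 from [W] would not raise the cost; by [opt] no edge would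
   then be missed, and the cost would even fall. *)
have deg2 x : x \in W -> 1 < #|nbh x|.
  move=> xW; rewrite ltnNge; apply/negP => d1.
  have iX : independent (W :\ x) by move=> u v /setD1P [_ uW] /setD1P [_ vW]; apply: iW.
  have cX : #|W| = #|W :\ x|.+1 by rewrite (cardsD1 x W) xW.
  have mX : #|missed k (W :\ x)| <= 1.
    apply: leq_trans d1; pose F y := if k x then (x, y) else (y, x).
    rewrite -(card_imset (nbh x) (f := F)) => [|y y']; last by rewrite /F; case: (k x) => -[].
    apply/subset_leq_card/subsetP => -[u v] uv.
    have o : oriented k u v by move: uv; rewrite !inE => /and3P [].
    have [uX vX] : u \notin W :\ x /\ v \notin W :\ x by move: uv; rewrite inE => /and3P [].
    have uvW : (u \in W) || (v \in W).
      have : (u, v) \notin missed k W by rewrite mW inE.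
      by rewrite !inE /= o -negb_or negbK.
    case/and3P: o => a ku kv; apply/imsetP; move: uX vX; rewrite !in_setD1 !negb_and !negbK.
    case/orP: uvW => ->; rewrite orbF => /eqP e; first by subst u; exists v; rewrite ?in_nbh /F ?ku.
    by move=> /eqP e'; subst v; exists u; rewrite ?in_nbh 1?adj_sym /F ?(negbTE kv).
  have lX : cost k (W :\ x) <= cost k W by rewrite cW /cost cX; lia.
  by have := best _ iX; rewrite cW /cost (opt _ iX lX) cards0 cX; lia.
have W0 : 0 < #|W| by rewrite -cW.
have /card_gt0P [x0 x0W] := W0.
have [a0 a0W amin] := arg_minnP (fun x => #|nbh x|) x0W.
pose D := #|nbh a0|.-1; have dD : #|nbh a0| = D.+1 by have := deg2 _ a0W; rewrite /D; lia.
have D0 : 0 < D by have := deg2 _ a0W; rewrite dD.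
have expand (X : {set H}) : ~~ (W \subset X) -> #|W| + D <= cost k' X.
  move=> nX; have := @tree_cost k' D k'H; rewrite eW; apply=> // x xW.
  by rewrite -dD; apply: amin.
have cP : #|[set p : 'I_D * 'I_D | true]| = D * D.
  by rewrite cardsE card_prod card_ord.
apply: (@star_matching_good H B f c k' fc k'H (tree_oedges k'H) #|W|.-1 D a0 a0W dD D0 _ _ (fun _ _ => true)).
- by rewrite eW prednK.
- move=> X; rewrite prednK //; case: (boolP (W \subset X)) => WX.
    by apply: leq_trans (subset_leq_card WX) (leq_addr _ _).
  exact: leq_trans (leq_addr _ _) (expand X WX).
- by rewrite cP; clear -D0; nia.
- by rewrite cP; apply: tree_blocks_bound.
move=> m Dm [j ji ja].
(* Either side of the block covers the added edges, so [W] lands in the complete part together with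
   that side. The sides being disjoint, [W] would fit into [#|W| - 1] vertices. *)
have cl := cover_cost fc (tree_oedges k'H) ji ja (@lefts_cover _ _ _ Dm).
have cr := cover_cost fc (tree_oedges k'H) ji ja (@rights_cover _ _ _ Dm).
rewrite card_lefts in cl; rewrite card_rights in cr.
have sub (Z : {set H}) : cost k' Z <= #|W|.-1 + D -> W \subset Z.
  by move=> le; apply: contraT => /expand; lia.
have {cl}/subsetP hl := sub _ cl; have {cr}/subsetP hr := sub _ cr.
have : #|[set j (f x) | x in W]| <= #|(inl : _ -> 'I_(#|W|.-1) + 'I_m) @: setT|.
  apply/subset_leq_card/subsetP => y /imsetP [x xW ->].
  have := hl x xW; have := hr x xW; rewrite !inE; case: (j (f x)) => i.
    by move=> _ _; rewrite imset_f ?inE.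
  move=> /imsetP [a _ ->] /imsetP [b _ /eqP].
  by rewrite eq_sym (negbTE (left_right _ _ _)).
rewrite !card_imset; last 2 first.
- exact: inl_inj.
- by move=> x y /ji /(balloon_inj fc).
by rewrite cardsT card_ord; lia.
Qed.

End Tree.

(** * Complete bipartite graphs *)

(** When [H] itself is embedded, the base edge of each cycle is its irregularity: the inner path has
    an odd number of vertices and starts and ends in [C false]. *)
Lemma embed_fixed_copy (H B G : graph) (f : H -> B) (c : H -> H -> seq B) (k : H -> bool)
    (C : bool -> {set G}) e (sg : H -> G) (x0 : H) :
  ballooning_by f c -> two_coloring k ->
  (forall b y, y \in C b -> miss y (C (~~ b)) <= e) ->
  (forall b, #|B| * e.+1 <= #|C b|) ->
  injective sg -> (forall x y, adj x y -> adj (sg x) (sg y)) ->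
  (forall x, miss (sg x) (C false) <= e) -> subgraph B G.
Proof.
move=> fc kH hC cC sgi sga sgm.
have [h hf hc] := balloon_slots k fc (true, None) (fun x => (true, Some (sg x)))
  (fun x y i => (odd i, None)).
pose R v w := match (h v).2, (h w).2 with
  | Some a, Some b => adj a b
  | Some _, None => ~~ (h w).1
  | None, Some _ => ~~ (h v).1
  | None, None => (h v).1 != (h w).1 end : bool.
have hR v w : adj v w -> R v w.
  apply: (balloon_adj_ind fc kH (R := R)) => {v w}.
  - by move=> v w; rewrite /R; case: (h v).2; case: (h w).2 => //= *; rewrite 1?adj_sym 1?eq_sym.
  - by move=> x y /oriented_adj a; rewrite /R !hf /=; apply: sga.
  - move=> x y o; have [_ l3] := balloon_size fc (oriented_adj o).
    by rewrite /R hf hc //=; lia.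
  - by move=> x y i o il; rewrite /R !hc //=; [case: (odd i) | apply: ltnW].
  - move=> x y o; have [ol l3] := balloon_size fc (oriented_adj o).
    by rewrite /R hf hc //=; [move: ol l3; case: (size _) => //= n -> | lia].
pose F := [set v | isSome (h v).2].
have FP v : v \in F -> exists2 x, v = f x & (h v).2 = Some (sg x).
  case: (balloon_cover fc kH v) => [[x ->]|[x [y [i [o il ->]]]]]; rewrite inE.
    by rewrite hf; exists x.
  by rewrite hc.
have nF v : v \notin F -> (h v).2 = None by rewrite inE; case: (h v).2.
apply: (@greedy_embedding B G (fun v => (h v).1) C e hC cC F (fun v => odflt (sg x0) (h v).2)).
- by move=> u v /FP [x -> ->] /FP [y -> ->] /= /sgi ->.
- by move=> u v /FP [x _ e1] /FP [y _ e2] /hR; rewrite /R e1 e2.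
- by move=> u v /nF e1 /nF e2 /hR; rewrite /R e1 e2.
- move=> u v /FP [x _ e1] /nF e2 /hR; rewrite /R e1 e2 /= => /negbTE ->; exact: sgm.
Qed.

Lemma missing_neighbour_le (G : graph) (U Y : {set G}) :
  #|[set y in Y | ~~ (U \subset nbh y)]| <= \sum_(u in U) miss u Y.
Proof.
have -> : \sum_(u in U) miss u Y = \sum_(u in U) \sum_(y in Y) (~~ adj u y : nat).
  apply: eq_bigr => u _; rewrite /miss -sum1_card big_mkcond [RHS]big_mkcond /=.
  by apply: eq_bigr => y _; rewrite in_setD in_nbh; case: (adj u y); case: (y \in Y).
rewrite exchange_big /= -sum1_card big_mkcond [X in _ <= X]big_mkcond /=; apply: leq_sum => y _.
rewrite inE; case: (y \in Y) => //=; case: ifP => // /subsetPn [u uU uy].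
by rewrite (bigD1 u uU) /=; move: uy; rewrite in_nbh adj_sym => ->.
Qed.

Section Closed.
Variables (G : graph) (U : {set G}).

(** The number of arcs of the complement of [G] inside [X]. *)
Definition nonarcs (X : {set G}) : nat := \sum_(x in X) #|X :\: nbh x :\ x|.

Lemma nonarcs_card (X : {set G}) : arcs X X + nonarcs X = #|X| * #|X|.-1.
Proof.
rewrite /arcs /nonarcs -big_split /= -sum_nat_const; apply: eq_bigr => x xX.
rewrite (cardsD1 x X) xX add1n /= -(cardsID (nbh x) (X :\ x)); congr addn; apply: eq_card => y; rewrite !inE.
  by case: (boolP (adj x y)) => [/adj_neq|]; rewrite ?andbF ?andbT // eq_sym => ->.
by rewrite andbCA.
Qed.

Lemma nonarcs_sub (X Y : {set G}) : X \subset Y -> nonarcs X <= nonarcs Y.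
Proof.
move=> XY; rewrite /nonarcs [X in _ <= X](big_setID X) /= (setIidPr XY).
apply: leq_trans (leq_addr _ _); apply: leq_sum => x _.
by apply/subset_leq_card/setSD/setSD.
Qed.

Lemma nonarcs_add (X : {set G}) x v : x \in X -> v \notin X -> ~~ adj x v -> nonarcs X + 2 <= nonarcs (v |: X).
Proof.
move=> xX vX nxv; have xv : x != v by apply: contraNneq vX => <-.
rewrite /nonarcs big_setU1 //= addnC.
have h1 : 0 < #|(v |: X) :\: nbh v :\ v|.
  by apply/card_gt0P; exists x; rewrite !inE xv adj_sym nxv xX orbT.
rewrite (big_setD1 x xX) [X in _ <= _ + X](big_setD1 x xX) /=.
have h2 : #|X :\: nbh x :\ x| < #|(v |: X) :\: nbh x :\ x|.
  rewrite (cardsD1 v ((v |: X) :\: nbh x :\ x)) !inE eqxx nxv eq_sym xv /= ltnS.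
  apply/subset_leq_card/subsetP => y; rewrite !inE => /and3P [-> -> yX]; rewrite yX orbT !andbT.
  by apply: contraNneq vX => <-.
have : \sum_(i in X :\ x) #|X :\: nbh i :\ i| <= \sum_(i in X :\ x) #|(v |: X) :\: nbh i :\ i|.
  by apply: leq_sum => i _; apply/subset_leq_card/setSD/setSD/subsetUr.
lia.
Qed.

Definition nonadj_closed (X : {set G}) : Prop := forall x v, x \in X -> v \in U -> v \notin X -> adj x v.

(* The set [X] is a component of the complement of [G] on [U], taken as
   a maximal set having as many non-edges as a tree on it. *)
Lemma closed_component u : u \in U ->
  exists X : {set G}, [/\ u \in X, X \subset U, nonadj_closed X & 2 * #|X| <= nonarcs U + 2].
Proof.
move=> uU; pose P (X : {set G}) := [&& u \in X, X \subset U & 2 * #|X| <= nonarcs X + 2].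
have P0 : P [set u] by rewrite /P inE eqxx sub1set uU cards1 /= addn2.
have [X /and3P [uX XU cX] best] := arg_maxnP (fun X : {set G} => #|X|) P0.
exists X; split=> //; last by apply: leq_trans cX _; rewrite leq_add2r nonarcs_sub.
move=> x v xX vU vX; apply: contraT => nxv.
have := best (v |: X); rewrite cardsU1 vX add1n /= ltnn; apply; apply/and3P; split.
- by rewrite inE uX orbT.
- by rewrite subUset sub1set vU.
- by rewrite cardsU1 vX; have := nonarcs_add xX vX nxv; lia.
Qed.

(** Components of the complement are added until the size exceeds [w]; the last one overshoots by at
    most its own size, which [closed_component] bounds. *)
Lemma closed_of_size w : exists J : {set G},
  [/\ J \subset U, nonadj_closed J, J = U \/ w < #|J| & 2 * #|J| <= 2 * w + nonarcs U + 2].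
Proof.
elim: w => [|w [J [JU cJ [JJ|lJ] bJ]]].
- have [->|/set0Pn [u /closed_component [X [uX XU cX bX]]]] := eqVneq U set0.
    exists set0; split; rewrite ?sub0set ?cards0 //; last by left.
    by move=> x v; rewrite inE.
  by exists X; split; [ | | right; apply/card_gt0P; exists u | lia].
- by exists J; split; [ | | left | lia].
case: (ltnP w.+1 #|J|) => hw; first by exists J; split; [ | | right | lia].
have [JJ|nJ] := eqVneq J U; first by exists J; split; [ | | left | lia].
have /subsetPn [u uU uJ] : ~~ (U \subset J) by apply: contra nJ => h; rewrite eqEsubset JU.
have [X [uX XU cX bX]] := closed_component uU.
have h1 : #|J| < #|J :|: X|.
  by apply: proper_card; apply/properP; split; [apply: subsetUl | exists u; rewrite // inE uX orbT].
have h2 : #|J :|: X| <= #|J| + #|X| by apply: leq_card_setU.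
exists (J :|: X); split; [by rewrite subUset JU | | by right; lia | by lia].
move=> x v; rewrite !inE negb_or => /orP [] xX vU /andP [vJ vX]; [exact: cJ | exact: cX].
Qed.

End Closed.

Section CompleteBipartite.
Variables (H B : graph) (f : H -> B) (c : H -> H -> seq B) (k : H -> bool).
Hypothesis fc : ballooning_by f c.
Hypothesis adjE : forall x y : H, adj x y = (k x != k y).
Variables g D : nat.
Hypothesis g0 : 0 < g.
Hypothesis gD : g <= D.
Let A := [set x | k x].
Hypothesis cA : #|A| = g.+1.
Hypothesis cA' : #|~: A| = D.+1.

Lemma complete_coloring : two_coloring k.
Proof. by move=> x y; rewrite adjE. Qed.

Lemma complete_class : exists a, k a.
Proof.
have /card_gt0P [a] : 0 < #|A| by rewrite cA.
by rewrite inE; exists a.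
Qed.

Lemma complete_nbh a : k a -> nbh a = ~: A.
Proof. by move=> ka; apply/setP => y; rewrite in_nbh adjE ka !inE; case: (k y). Qed.

Lemma complete_oedges : exists xy, xy \in oedges k.
Proof.
have [a ka] := complete_class.
have /card_gt0P [b] : 0 < #|~: A| by rewrite cA'.
by rewrite !inE => kb; exists (a, b); rewrite inE /oriented /= adjE ka kb.
Qed.

Lemma complete_cost (X : {set H}) : cost k X = #|X| + #|A :\: X| * #|~: A :\: X|.
Proof.
rewrite /cost -cardsX; congr addn; apply: eq_card => -[x y].
by rewrite !inE /oriented /= adjE; case: (k x); case: (k y); rewrite ?andbF //= !andbT.
Qed.

Lemma complete_split (X : {set H}) : #|X| + #|A :\: X| + #|~: A :\: X| = g.+1 + D.+1.
Proof.
rewrite -cA -cA' -(cardsID X A) -(cardsID X (~: A)).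
have := cardsID A X; rewrite setDE ![X :&: _]setIC; lia.
Qed.

Lemma complete_min_cost (X : {set H}) : g.+1 <= cost k X.
Proof.
rewrite complete_cost; have := complete_split X.
have : #|A :\: X| <= g.+1 by rewrite -cA; apply/subset_leq_card/subsetDl.
have : #|~: A :\: X| <= D.+1 by rewrite -cA'; apply/subset_leq_card/subsetDl.
move: #|A :\: X| #|~: A :\: X| => p [|q]; first by lia.
by rewrite mulnS => *; apply: leq_trans (leq_trans _ (leq_addr (p * q) (#|X| + p))) _; lia.
Qed.

(** With [p] and [q] vertices of the classes outside [X], both positive, the cost is
    [g + D + 2 - p - q + p * q], which exceeds [g + D]. *)
Lemma complete_cheap (X : {set H}) : cost k X <= g + D -> (A \subset X) || (~: A \subset X).
Proof.
rewrite complete_cost -!setD_eq0 -!cards_eq0; have := complete_split X; clear.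
move: #|A :\: X| #|~: A :\: X| => [|p] [|q] //=; rewrite !mulSn !mulnS; lia.
Qed.

(** [K_{D,D}] minus a matching of size [D - 1], the diagonal without its entry 0. *)
Definition skew (a b : 'I_D) : bool := ~~ ((a == b) && (0 < a)).

Lemma card_skew : #|[set p | skew p.1 p.2]| = D * D.-1 + 1.
Proof.
have D0 : 0 < D by apply: leq_trans gD.
have e1 : #|[set p : 'I_D * 'I_D | (p.1 == p.2) && (0 < p.1)]| = D.-1.
  pose F (a : 'I_D) := (a, a); have Fi : injective F by move=> a b [].
  have e2 : #|[set a : 'I_D | 0 < a]| = D.-1.
    have := cardsC [set Ordinal D0]; rewrite cards1 card_ord.
    rewrite (_ : ~: _ = [set a : 'I_D | 0 < a]); first lia.
    by apply/setP => a; rewrite !inE -val_eqE /= lt0n.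
  rewrite -[RHS]e2 -(card_imset _ Fi); apply: eq_card => -[a b]; rewrite inE /=.
  apply/andP/imsetP => [[/eqP <- p]|[a' + [-> ->]]]; last by rewrite inE.
  by exists a; rewrite ?inE.
have := cardsC [set p : 'I_D * 'I_D | (p.1 == p.2) && (0 < p.1)].
rewrite e1 card_prod card_ord (_ : ~: _ = [set p | skew p.1 p.2]); last by apply/setP => p; rewrite !inE.
move: #|[set p | skew p.1 p.2]| => N; case: (D) D0 => // n _; rewrite [n.+1 * n.+1]mulnS /=; lia.
Qed.

Lemma skew_sym a b : skew a b = skew b a.
Proof. by rewrite /skew eq_sym; case: (eqVneq b a) => [->|]. Qed.

Lemma skew_room (S S' : {set 'I_D}) :
  (forall a b, a \in S -> b \in S' -> skew a b) -> #|S| + #|S'| <= D + 1.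
Proof.
move=> h; have D0 : 0 < D by apply: leq_trans gD.
have h1 : #|S :&: S'| <= 1.
  rewrite -(cards1 (Ordinal D0)); apply/subset_leq_card/subsetP => a; rewrite in_setI => /andP [aS aS'].
  by have := h a a aS aS'; rewrite /skew eqxx /= -leqNgt leqn0 inE -val_eqE.
have h2 : #|S :|: S'| <= D by rewrite -[X in _ <= X]card_ord; apply: max_card.
by have := cardsUI S S'; lia.
Qed.

Section Lower.
Variables (m : nat) (Dm : 4 * D <= m).
Let host := join (complete g) (turan_plus (@block_sym D m skew Dm) (@block_irr D m skew Dm)).
Variable j : B -> host.
Hypothesis ji : injective j.
Hypothesis ja : forall v w, adj v w -> adj (j v) (j w).

Let F (x : H) : 'I_g + 'I_m := j (f x).

Lemma host_inj : injective F.
Proof. by move=> x y /ji /(balloon_inj fc). Qed.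

(** [H] has [g + D + 2] vertices, while by [skew_room] the complete part and two completely joined
    index sets offer [g + D + 1] places. *)
Lemma no_crossing_copy (l r : 'I_D -> 'I_m) : injective l -> injective r ->
  (forall a b, adj (inr (l a) : host) (inr (r b)) -> skew a b) ->
  (forall x, x \in A -> forall i, F x = inr i -> i \in l @: setT) ->
  (forall x, x \in ~: A -> forall i, F x = inr i -> i \in r @: setT) -> False.
Proof.
move=> li ri lr hA hA'.
pose S := [set a | inr (l a) \in F @: A]; pose S' := [set b | inr (r b) \in F @: ~: A].
have room : #|S| + #|S'| <= D + 1.
  apply: skew_room => a b; rewrite !inE => /imsetP [x xA e1] /imsetP [y yA e2].
  apply: lr; rewrite e1 e2; apply/ja/(balloon_adj_ends fc).
  by move: xA yA; rewrite adjE !inE => ->; case: (k y).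
have : #|[set: H]| <= g + #|S| + #|S'|.
  pose X1 := (inl : _ -> 'I_g + 'I_m) @: setT.
  pose X2 := (fun a => inr (l a) : 'I_g + 'I_m) @: S.
  pose X3 := (fun a => inr (r a) : 'I_g + 'I_m) @: S'.
  have c1 : #|X1| = g by rewrite card_imset ?cardsT ?card_ord //; apply: inl_inj.
  have c2 : #|X2| <= #|S| by apply: leq_imset_card.
  have c3 : #|X3| <= #|S'| by apply: leq_imset_card.
  suff : F @: [set: H] \subset X1 :|: X2 :|: X3.
    move/subset_leq_card; rewrite (card_imset _ host_inj) => le; apply: leq_trans le _.
    apply: leq_trans (leq_card_setU _ _) _; apply: leq_add => //.
    by apply: leq_trans (leq_card_setU _ _) _; rewrite c1 leq_add2l.
  apply/subsetP => y /imsetP [x _ ->]; rewrite !in_setU.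
  have := hA x; have := hA' x; case e : (F x) => [i|i]; first by rewrite imset_f ?inE.
  rewrite in_setC; case xA: (x \in A) => h1 h2.
    have /imsetP [a _ ea] := h2 isT i erefl.
    by rewrite ea (imset_f (fun a => inr (l a))) ?orbT // inE -ea -e imset_f.
  have /imsetP [a _ ea] := h1 isT i erefl.
  by rewrite ea (imset_f (fun a => inr (r a))) ?orbT // inE -ea -e imset_f // in_setC xA.
by rewrite cardsT -(cardsC A) cA cA'; lia.
Qed.

Lemma class_not_inside (W : {set H}) : g < #|W| -> exists2 x, x \in W & exists i, F x = inr i.
Proof.
move=> gW; case: (excluded_middle_informative (exists2 x, x \in W & exists i, F x = inr i)) => // no.
have : #|F @: W| <= #|(inl : _ -> 'I_g + 'I_m) @: setT|.
  apply/subset_leq_card/subsetP => y /imsetP [x xW ->].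
  case e : (F x) => [i|i]; first by rewrite imset_f ?inE.
  by case: no; exists x => //; exists i.
rewrite (card_imset _ host_inj) card_imset ?cardsT ?card_ord; last exact: inl_inj.
by rewrite leqNgt gW.
Qed.

Lemma block_adj a b : adj (inr (lefts Dm a) : host) (inr (rights Dm b)) -> skew a b.
Proof.
rewrite /adj /= /turan_plus_rel turan2E => /orP [|].
  by rewrite /= [odd (_ + 2)]oddD !oddM.
case/block_relP => a' [b' [p [] [/eqP e1 /eqP e2]]].
  by move: e1 e2 p => /eqP/lefts_inj -> /eqP/rights_inj ->.
by move: e2; rewrite (negbTE (left_right _ _ _)).
Qed.

(** [complete_cheap] puts a class of [H] into the complete part with the left side, and a class into
    the complete part with the right side. The same class twice would lie in the complete part,
    which is too small; different classes contradict [no_crossing_copy]. *)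
Lemma no_copy : False.
Proof.
have oe := complete_oedges.
have cl := cover_cost fc oe ji ja (@lefts_cover _ _ _ Dm).
have cr := cover_cost fc oe ji ja (@rights_cover _ _ _ Dm).
rewrite card_lefts in cl; rewrite card_rights in cr.
have sub (W : {set H}) (Y : {set 'I_m}) : W \subset [set x | match j (f x) with inl _ => true | inr i => i \in Y end] ->
    forall x, x \in W -> forall i, F x = inr i -> i \in Y.
  by move=> /subsetP h x /h + i; rewrite inE /F; case: (j (f x)) => // i' + [<-].
have both (W : {set H}) : g < #|W| -> 
    (forall x, x \in W -> forall i, F x = inr i -> i \in lefts Dm @: setT) ->
    (forall x, x \in W -> forall i, F x = inr i -> i \in rights Dm @: setT) -> False.
  move=> gW hl hr; have [x xW [i e]] := class_not_inside gW.
  have /imsetP [a _ ea] := hl x xW i e; have /imsetP [b _ eb] := hr x xW i e.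
  by have := left_right Dm a b; rewrite -ea -eb eqxx.
case/orP: (complete_cheap cl) => /sub hl; case/orP: (complete_cheap cr) => /sub hr.
- by apply: (both A) => //; rewrite cA.
- exact: (no_crossing_copy (@lefts_inj _ _ Dm) (@rights_inj _ _ Dm) block_adj hl hr).
- apply: (no_crossing_copy (@rights_inj _ _ Dm) (@lefts_inj _ _ Dm) _ hr hl) => a b.
  by rewrite adj_sym skew_sym; apply: block_adj.
- by apply: (both (~: A)) => //; rewrite cA' ltnS.
Qed.

End Lower.

Lemma complete_embed (G : graph) e (C : bool -> {set G}) (X Y : {set G}) :
  (forall b y, y \in C b -> miss y (C (~~ b)) <= e) ->
  (forall b, #|B| * e.+1 <= #|C b|) ->
  #|X| = g.+1 -> #|Y| = D.+1 -> [disjoint X & Y] ->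
  (forall x y, x \in X -> y \in Y -> adj x y) ->
  (forall x, x \in X :|: Y -> miss x (C false) <= e) -> subgraph B G.
Proof.
move=> hC cC cX cY dXY aXY mXY.
have /card_gt0P [y0 _] : 0 < #|Y| by rewrite cY.
have [s1 s1i s1X] : exists2 s : H -> G, {in A &, injective s} & forall x, x \in A -> s x \in X.
  by apply: (inj_of_card y0); rewrite cA cX.
have [s2 s2i s2Y] : exists2 s : H -> G, {in ~: A &, injective s} & forall x, x \in ~: A -> s x \in Y.
  by apply: (inj_of_card y0); rewrite cA' cY.
pose sg x := if x \in A then s1 x else s2 x.
have sX x : x \in A -> sg x \in X by move=> xA; rewrite /sg xA s1X.
have sY x : x \notin A -> sg x \in Y by move=> xA; rewrite /sg (negbTE xA) s2Y // in_setC.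
have kA x : (x \in A) = k x by rewrite inE.
have [a _] := complete_class.
apply: (@embed_fixed_copy H B G f c k C e sg a fc complete_coloring hC cC).
- move=> x y; case: (boolP (x \in A)) => xA; case: (boolP (y \in A)) => yA.
  + by rewrite /sg xA yA; apply: s1i.
  + by move=> eq; have := sX x xA; rewrite eq (disjointFl dXY (sY y yA)).
  + by move=> eq; have := sX y yA; rewrite -eq (disjointFl dXY (sY x xA)).
  + by rewrite /sg (negbTE xA) (negbTE yA); apply: s2i; rewrite in_setC.
- move=> x y; rewrite adjE -!kA; case: (boolP (x \in A)) => xA; case: (boolP (y \in A)) => yA // _.
    by apply: aXY; [apply: sX | apply: sY].
  by rewrite adj_sym; apply: aXY; [apply: sX | apply: sY].
- move=> x; apply: mXY; rewrite in_setU; case: (boolP (x \in A)) => xA; first by rewrite sX.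
  by rewrite sY ?orbT.
Qed.

(* If too few edges are missing, [U :\: J] with [#|J| + 1] vertices of [L], and
   [J] with the rest of the copy in [R], are completely joined. Taking more than
   [ur] vertices into [J] leaves enough room in [R]. *)
Lemma complete_block_bound : block_bound B g D (D * D.-1 + 1).
Proof.
move=> G e U V noB parts cU hC cC hU [L [R [b [cL cR dLR /andP [LV RV] hLR]]]].
rewrite leqNgt; apply/negP => big; apply: noB.
have D0 : 0 < D by apply: leq_trans gD.
have h1 := nonarcs_card U; rewrite cU in h1.
have inner_le : arcn (inner U V) <= 2 * arcs R L.
  have touch x y : inner U V x y -> (x \in R) || (y \in R).
    by move=> /hLR /orP [] /andP [a1 a2]; rewrite ?a1 ?a2 ?orbT.
  apply: leq_trans (arcn_touching (@inner_sym _ U V) touch) _; rewrite leq_mul2l /=.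
  apply: leq_sum => x xR; apply/subset_leq_card/subsetP => y; rewrite inE => q.
  have := hLR _ _ q; rewrite (disjointFl dLR xR) xR /= => yL.
  by case/and4P: q => _ _ a _; rewrite in_setI in_nbh a.
have h2 := arcs_miss R L; rewrite cL cR in h2.
have h3 : \sum_(u in U) miss u L + \sum_(u in U) miss u R <=
    \sum_(u in U) miss u (V true) + \sum_(u in U) miss u (V false).
  rewrite -!big_split; apply: leq_sum => u _; rewrite /= /miss.
  apply: leq_trans (_ : #|V b :\: nbh u| <= _); last by case: (b); rewrite ?leq_addr ?leq_addl.
  rewrite -cardsUI (_ : (L :\: nbh u) :&: (R :\: nbh u) = set0) ?cards0 ?addn0.
    by rewrite subset_leq_card // subUset !setSD.
  apply/setP => y; rewrite !inE; case yL: (y \in L); rewrite ?andbF //.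
  by rewrite (disjointFr dLR yL) !andbF.
set ul := \sum_(u in U) miss u L in h3; set ur := \sum_(u in U) miss u R in h3.
set rl := \sum_(x in R) miss x L in h2.
(* A violated bound leaves fewer than [D] missing pairs in all, those inside [U] being counted as
   half of [nonarcs U]. *)
have key : 2 * (rl + ul + ur) + nonarcs U + 3 <= 2 * D.
  have e1 : D * D = D * D.-1 + D by case: (D) D0 => // n _; rewrite mulnS addnC.
  lia.
have [J [JU closed bJ cJ]] := closed_of_size U ur.
have dU b' : [disjoint U & V b'] by case: parts.
pose L0 := [set l in L | (R \subset nbh l) && (U \subset nbh l)].
pose R0 := [set r in R | U :\: J \subset nbh r].
have cL0 : D <= #|L0| + rl + ul.
  have m1 := missing_neighbour_le R L; have m2 := missing_neighbour_le U L.
  have : #|L| <= #|L0 :|: [set y in L | ~~ (R \subset nbh y)] :|: [set y in L | ~~ (U \subset nbh y)]|.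
    apply/subset_leq_card/subsetP => y yL; rewrite !inE yL /=.
    by case: (R \subset _); case: (U \subset _).
  have s1 (X Y : {set G}) : #|X :|: Y| <= #|X| + #|Y| by apply: leq_card_setU.
  rewrite cL => le; apply: leq_trans le (leq_trans (s1 _ _) _); apply: leq_add => //.
  by apply: leq_trans (s1 _ _) _; rewrite leq_add2l.
have cJU : #|J| <= g by rewrite -cU subset_leq_card.
(* If [J] is all of [U], then [R0 = R] and [0 < g] gives the room; otherwise [#|J|] exceeds [ur],
   which bounds the losses in [R]. *)
have cR0 : D.+1 - #|J| <= #|R0|.
  case: bJ => [JJ|lJ].
    have -> : R0 = R by apply/setP => y; rewrite inE JJ setDv sub0set andbT.
    by rewrite cR JJ cU; lia.
  have m1 := missing_neighbour_le U R.
  have : #|R| <= #|R0 :|: [set y in R | ~~ (U \subset nbh y)]|.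
    apply/subset_leq_card/subsetP => y yR; rewrite !inE yR /=.
    case: (boolP (U \subset _)) => s; rewrite ?orbT // orbF.
    exact: subset_trans (subsetDl _ _) s.
  have s1 : #|R0 :|: [set y in R | ~~ (U \subset nbh y)]| <= #|R0| + #|[set y in R | ~~ (U \subset nbh y)]|.
    by apply: leq_card_setU.
  rewrite cR -/ur in m1 *; lia.
(* [key] and the bound [cJ] on [#|J|] together leave more than [#|J|] vertices in [L0]. *)
have [L' L'L0 cL'] : exists2 L' : {set G}, L' \subset L0 & #|L'| = #|J|.+1.
  by apply: subset_of_card; lia.
have [R' R'R0 cR'] : exists2 R' : {set G}, R' \subset R0 & #|R'| = D.+1 - #|J|.
  exact: subset_of_card.
have L'P l : l \in L' -> [/\ l \in L, l \in V b, R \subset nbh l & U \subset nbh l].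
  by move=> /(subsetP L'L0); rewrite inE => /and3P [lL ? ?]; split=> //; apply: (subsetP LV).
have R'P r : r \in R' -> [/\ r \in R, r \in V b & U :\: J \subset nbh r].
  by move=> /(subsetP R'R0); rewrite inE => /andP [rR ?]; split=> //; apply: (subsetP RV).
pose C b' := V (b' == b).
have Cne b' : C (~~ b') = V (~~ (b' == b)) by rewrite /C; case: (b'); case: (b).
have CV : C false = V (~~ b) by rewrite /C; case: (b).
apply: (@complete_embed G e C ((U :\: J) :|: L') (J :|: R')).
- by move=> b' y yC; rewrite Cne; apply: hC.
- by move=> b'; apply: cC.
- rewrite cardsU cardsD (setIidPr JU) cU cL' (_ : _ :&: _ = set0) ?cards0; first lia.
  apply/setP => y; rewrite !inE; apply/negbTE/negP => /andP [/andP [_ yU] /L'P [_ yV _ _]].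
  by rewrite (disjointFr (dU b) yU) in yV.
- rewrite cardsU cR' (_ : _ :&: _ = set0) ?cards0; first lia.
  apply/setP => y; rewrite !inE; apply/negbTE/negP => /andP [/(subsetP JU) yU /R'P [_ yV _]].
  by rewrite (disjointFr (dU b) yU) in yV.
- apply/pred0P => y; apply/negbTE/negP => /= /andP [].
  rewrite !inE => /orP [/andP [yJ yU]|/L'P [yL yV _ _]] /orP [yJ'|/R'P [yR yV' _]].
  + by rewrite yJ' in yJ.
  + by rewrite (disjointFr (dU b) yU) in yV'.
  + by rewrite (disjointFr (dU b) (subsetP JU _ yJ')) in yV.
  + by rewrite (disjointFr dLR yL) in yR.
- move=> x y; rewrite !inE => /orP [/andP [xJ xU]|/L'P [_ _ xR xU]] /orP [yJ|/R'P [yR _ yU]].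
  + by rewrite adj_sym; apply: closed.
  + by rewrite adj_sym; have := subsetP yU x; rewrite in_setD xJ xU in_nbh; apply.
  + by have := subsetP xU y (subsetP JU _ yJ); rewrite in_nbh.
  + by have := subsetP xR y yR; rewrite in_nbh.
- have h b' y : y \in V b' -> b' = b -> miss y (C false) <= e by move=> yV eb; rewrite CV -eb; apply: hC.
  move=> x; rewrite !inE CV => /orP [/orP [/andP [_ xU]|/L'P [_ xV _ _]]|/orP [/(subsetP JU) xU|/R'P [_ xV _]]];
    by [apply: hU | apply: hC].
Qed.

Theorem complete_matching_good : matching_good (single B).
Proof.
have [a ka] := complete_class.
have D0 : 0 < D by apply: leq_trans gD.
have da : #|nbh a| = D.+1 by rewrite (complete_nbh ka) cA'.
apply: (@star_matching_good H B f c k fc complete_coloring complete_oedges g D a ka da D0 cA _ skew).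
- exact: complete_min_cost.
- by rewrite card_skew.
- by rewrite card_skew; apply: complete_block_bound.
by move=> m Dm [j ji ja]; apply: no_copy ji ja.
Qed.

End CompleteBipartite.

(** The one-vertex tree has to be excluded: its ballooning has no edge and chromatic number 1, so
    [2 <= par] fails. *)
Theorem theorem1p10 (H Hodd : graph) :
  odd_ballooning H Hodd ->
  (is_tree H /\ 1 < #|H|) \/
  (exists s t : nat, [/\ 2 <= s, s <= t & iso H (complete_bipartite s t)]) ->
  matching_good (single Hodd).
Proof.
move=> [f [c fc]] [[tree H2]|[s [t [s2 st [h [h' hK h'K] hadj]]]]].
  exact: (@tree_matching_good H Hodd f c fc tree H2).
pose k x := if h x is inl _ then true else false.
have class (T : finType) (i : T -> 'I_s + 'I_t) (A : {set H}) : injective i ->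
    (forall x, (x \in A) = (h x \in i @: setT)) -> #|A| = #|T|.
  move=> ii hA; rewrite -cardsT -(card_imset setT ii) -(card_imset A (can_inj hK)).
  apply: eq_card => y; apply/imsetP/idP => [[x + ->]|yi]; first by rewrite hA.
  by exists (h' y); rewrite ?h'K // hA h'K.
have cA : #|[set x | k x]| = s.
  rewrite (class _ inl) ?card_ord //; first by move=> x y [].
  move=> x; rewrite inE /k; case: (h x) => i; first by rewrite imset_f ?inE.
  by apply/esym/negbTE/imsetP => -[].
have cA' : #|~: [set x | k x]| = t.
  rewrite (class _ inr) ?card_ord //; first by move=> x y [].
  move=> x; rewrite !inE /k; case: (h x) => i; last by rewrite imset_f ?inE.
  by apply/esym/negbTE/imsetP => -[].
apply: (@complete_matching_good H Hodd f c k fc _ s.-1 t.-1); rewrite ?cA ?cA'; try lia.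
by move=> x y; rewrite -hadj /k; case: (h x) => u; case: (h y) => v.
Qed.
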